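(* Let $(A(n))_{n\ge1}$ be an i.i.d. sequence of random topical operators on $\mathbb R^d$ with the memory loss property and let $X^0$ be an $\mathbb R^d$-valued random variable independent of $(A(n))$. Assume there is a topical $\phi:\mathbb R^d\to\mathbb R$ such that $\sup_x|\phi(A(1)x)-\phi(x)|$ has a finite second moment. Let $\alpha$ be the measure on $\mathbb R^d$ whose image by $x\mapsto(\bar x,\phi(x))$ is $\nu_0\otimes$(Lebesgue measure on $\mathbb R$). If $\gamma>0$ and the system is weakly non arithmetic, then for every continuous function $h$ with compact support on $\mathbb R^d$, $$\lim_{a\to-\infty}\sum_{n\ge1}\mathbb E[h(x(n,X^0)-a\mathbf 1)]=0,\qquad \lim_{a\to+\infty}\sum_{n\ge1}\mathbb E[h(x(n,X^0)-a\mathbf 1)]=\frac{\alpha(h)}{\gamma}.$$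
   Context: A map $A:\mathbb R^d\to\mathbb R^d$ is topical if it is isotone ($x\le y$ coordinatewise implies $Ax\le Ay$) and additively homogeneous ($A(x+a\mathbf 1)=Ax+a\mathbf 1$, $\mathbf 1=(1,\dots,1)'$). A map $\phi:\mathbb R^d\to\mathbb R$ is topical if isotone and $\phi(x+a\mathbf 1)=\phi(x)+a$. $Top_d$ is the set of topical operators, with the topology of uniform convergence on compact sets. $\mathbb{PR}^d_{\max}$ is the quotient of $\mathbb R^d$ by $x\sim y\iff x-y\in\mathbb R\mathbf 1$, $\bar x$ the class of $x$. $A$ has rank 1 if $\overline{Ax}$ does not depend on $x$. The sequence has the memory loss property if some $A(N)\cdots A(1)$ has rank 1 with positive probability. $x(0,X^0)=X^0$, $x(n,X^0)=A(n)x(n-1,X^0)$; $\gamma$ is the Lyapunov exponent ($x(n,X^0)/n\to\gamma\mathbf 1$ a.s.). $\nu_0$ is the unique invariant probability measure on $\mathbb{PR}^d_{\max}$ of the Markov chain $\bar x(n,\cdot)$. Weak non arithmeticity: let $E=Top_d\times\mathbb{PR}^d_{\max}$, $Q((A,\bar x),D)=\mathbb P((A(1),\overline{Ax})\in D)$, $\xi(A,\bar x)=\phi(Ax)-\phi(x)$, $j(A,\bar x)=\overline{Ax}$, and $\mathcal B^\infty=\{f\circ j: f$ bounded continuous complex function on $\mathbb{PR}^d_{\max}\}$ with sup norm. For $t\in\mathbb R$, $Q_t(z,dy)=e^{it\xi(y)}Q(z,dy)$. The system is weakly non arithmetic if $t\mapsto Q_t$ is continuous from $\mathbb R$ to the bounded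 operators on $\mathcal B^\infty$ and $\mathrm{Id}-Q_t$ is invertible on $\mathcal B^\infty$ for every $t\ne0$. *)

(* Defs.v *)
From HB Require Import structures.
From mathcomp Require Import all_boot all_order all_algebra.
From mathcomp Require Import all_classical all_reals all_analysis.
From mathcomp Require Import complex.
Set Implicit Arguments. Unset Strict Implicit. Unset Printing Implicit Defensive.
Import Order.TTheory GRing.Theory Num.Theory.
Import numFieldNormedType.Exports.
Local Open Scope classical_set_scope.
Local Open Scope ring_scope.

Notation vec R d := 'rV[R]_d.

Definition vshift (R : realType) (d : nat) (x : vec R d) (a : R) : vec R d :=
  x + const_mx a.

Definition vle (R : realType) (d : nat) (x y : vec R d) := forall i, x 0 i <= y 0 i.

Definition topical_op (R : realType) (d : nat) (F : vec R d -> vec R d) :=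
  (forall x y, vle x y -> vle (F x) (F y)) /\
  (forall x a, F (vshift x a) = vshift (F x) a).

Definition topical_fun (R : realType) (d : nat) (phi : vec R d -> R) :=
  (forall x y, vle x y -> phi x <= phi y) /\
  (forall x a, phi (vshift x a) = phi x + a).

(* rank 1: the class of F x in PR^d_max does not depend on x *)
Definition rank1 (R : realType) (d : nat) (F : vec R d -> vec R d) :=
  forall x y, exists a, F x = vshift (F y) a.

(* product  A(n) ... A(1)  (paper indexing: A(k) is A k, for k >= 1);
   prod_ops A 0 = identity *)
Fixpoint prod_ops (R : realType) (d : nat) (Omega : Type)
  (A : nat -> Omega -> vec R d -> vec R d) (n : nat) (w : Omega) : vec R d -> vec R d :=
  match n with
  | 0 => fun x => x
  | m.+1 => fun x => A m.+1 w (prod_ops A m w x)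
  end.

Definition traj (R : realType) (d : nat) (Omega : Type)
  (A : nat -> Omega -> vec R d -> vec R d) (X0 : Omega -> vec R d) (n : nat) (w : Omega) :=
  prod_ops A n w (X0 w).

(* Borel sigma-algebra of Top_d (topology of uniform convergence on compacts):
   generated by the evaluations F |-> (F x) i *)
Definition op_cylinders (R : realType) (d : nat) : set (set (vec R d -> vec R d)) :=
  [set S | exists (x : vec R d) (i : 'I_d) (B : set R),
       measurable B /\ S = [set F : vec R d -> vec R d | B ((F x) 0 i)]].
Definition op_sigma (R : realType) (d : nat) := <<s (@op_cylinders R d) >>.

Definition vec_cylinders (R : realType) (d : nat) : set (set (vec R d)) :=
  [set S | exists (i : 'I_d) (B : set R), measurable B /\ S = [set x : vec R d | B (x 0 i)]].
Definition vec_sigma (R : realType) (d : nat) := <<s (@vec_cylinders R d) >>.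

(* Borel sigma-algebra of PR^d_max, pulled back to R^d by the quotient map
   x |-> \bar x : generated by the differences x i - x j *)
Definition pr_cylinders (R : realType) (d : nat) : set (set (vec R d)) :=
  [set S | exists (i j : 'I_d) (B : set R),
       measurable B /\ S = [set x : vec R d | B (x 0 i - x 0 j)]].

(* PR^d_max as a measurable space: a measure on this space is exactly a
   measure on PR^d_max (its measurable sets are the preimages of Borel
   sets of PR^d_max under the quotient map) *)
Definition PRmax (R : realType) (d : nat) := g_sigma_algebraType (@pr_cylinders R d).

Definition gen_sigma (Omega T : Type) (Y : Omega -> T) (S : set (set T)) : set (set Omega) :=
  [set E | exists2 B, S B & E = Y @^-1` B].

Definition mutually_independent (R : realType) (dO : measure_display)
  (Omega : measurableType dO) (P : probability Omega R)
  (I : eqType) (F : I -> set (set Omega)) :=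
  forall (J : seq I), uniq J ->
  forall E : I -> set Omega, (forall j, j \in J -> F j (E j)) ->
  (P (\big[setI/setT]_(j <- J) E j) = \prod_(j <- J) P (E j))%E.

Section Model.
Variables (R : realType) (dO : measure_display) (Omega : measurableType dO).
Variables (P : probability Omega R) (d : nat).
Variables (A : nat -> Omega -> vec R d -> vec R d) (X0 : Omega -> vec R d).

Definition random_topical_ops :=
  (forall n w, topical_op (A n w)) /\
  (forall n x i, measurable_fun setT (fun w => (A n w x) 0 i)).
Definition random_vector := forall i, measurable_fun setT (fun w => (X0 w) 0 i).

Definition iid_and_indep :=
  mutually_independent P
    (fun k : option nat => match k with
       | None => gen_sigma X0 (@vec_sigma R d)
       | Some n => gen_sigma (A n.+1) (@op_sigma R d) end) /\
  (forall n S, @op_sigma R d S -> (0 < n)%N -> P (A n @^-1` S) = P (A 1 @^-1` S)).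

Definition memory_loss :=
  exists N : nat, (0 < N)%N /\ (0 < P [set w | rank1 (prod_ops A N w)])%E.

Definition sup_incr (phi : vec R d -> R) (F : vec R d -> vec R d) : \bar R :=
  ereal_sup [set (`|phi (F x) - phi x|)%:E | x in [set: vec R d]].

Definition finite_second_moment (phi : vec R d -> R) :=
  (\int[P]_w (sup_incr phi (A 1 w) * sup_incr phi (A 1 w)) < +oo)%E.

Definition lyapunov_exponent (gamma : R) :=
  {ae P, forall w, forall i : 'I_d,
     (fun n : nat => (traj A X0 n w) 0 i / n%:R) @ \oo --> gamma}.

Definition invariant_measure (nu0 : probability (@PRmax R d) R) :=
  forall S : set (@PRmax R d), measurable S ->
    (\int[nu0]_x (P [set w | S (A 1 w x)]) = nu0 S)%E.

(* alpha(h), where alpha is the measure on R^d whose image by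
   x |-> (\bar x, phi x) is nu0 (x) Lebesgue; the inverse of this map is
   (\bar x, t) |-> x + (t - phi x) 1, so (Fubini)
   alpha(h) = int nu0(d \bar x) int dt h (x + (t - phi x) 1). *)
Definition alpha_int (phi : vec R d -> R) (nu0 : probability (@PRmax R d) R)
  (h : vec R d -> R) : \bar R :=
  (\int[nu0]_x (\int[lebesgue_measure]_t (h (vshift x (t - phi x)))%:E))%E.

Local Open Scope complex_scope.

(* E = Top_d x PR^d_max, points represented by (A, x) with A topical and x a
   representative of the class; complex functions on E are g : E_t -> R[i]
   considered on topical first components only. *)
Definition Espace := ((vec R d -> vec R d) * vec R d)%type.

Definition Ebounded (g : Espace -> R[i]) (M : R) :=
  forall F x, topical_op F -> Normc.normc (g (F, x)) <= M.

(* B^infty = { f o j : f bounded continuous complex function on PR^d_max },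
   j (A, \bar x) = \bar (A x); f is given as a function on R^d constant on
   classes and continuous (quotient topology) *)
Definition Binf (g : Espace -> R[i]) :=
  exists f : vec R d -> R[i],
    (forall x a, f (vshift x a) = f x) /\
    continuous (fun x => complex.Re (f x)) /\ continuous (fun x => complex.Im (f x)) /\
    (exists M, forall x, Normc.normc (f x) <= M) /\
    (forall F x, topical_op F -> g (F, x) = f (F x)).

Definition cexpect (Y : Omega -> R[i]) : R[i] :=
  Complex (Rintegral P setT (fun w => complex.Re (Y w))) (Rintegral P setT (fun w => complex.Im (Y w))).

Definition expi (s : R) : R[i] := Complex (cos s) (sin s).

Definition Qt (phi : vec R d -> R) (t : R) (g : Espace -> R[i]) : Espace -> R[i] :=
  fun z => let y := z.1 z.2 in
    cexpect (fun w => expi (t * (phi (A 1 w y) - phi y)) * g (A 1 w, y)).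

Definition weakly_non_arithmetic (phi : vec R d -> R) :=
  (forall t g, Binf g -> Binf (Qt phi t g)) /\
  (forall t0 (eps : R), 0 < eps -> exists delta : R, 0 < delta /\
     forall t, `|t - t0| < delta ->
     forall g M, Binf g -> Ebounded g M ->
       Ebounded (fun z => Qt phi t g z - Qt phi t0 g z) (eps * M)) /\
  (* Id - Q_t invertible (bijective with bounded inverse) for t <> 0 *)
  (forall t, t != 0 ->
     (forall k, Binf k -> exists g, Binf g /\
        forall F x, topical_op F -> g (F, x) - Qt phi t g (F, x) = k (F, x)) /\
     (exists C : R, forall g M, Binf g ->
        Ebounded (fun z => g z - Qt phi t g z) M -> Ebounded g (C * M))).

End Model.

(* E[h(x(n, X0) - a 1)] for n >= 1 (the series index k corresponds to n = k+1) *)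
Definition renewal_term (R : realType) (dO : measure_display) (Omega : measurableType dO)
  (P : probability Omega R) (d : nat)
  (A : nat -> Omega -> vec R d -> vec R d) (X0 : Omega -> vec R d)
  (h : vec R d -> R) (a : R) (k : nat) : R :=
  Rintegral P setT (fun w => h (vshift (traj A X0 k.+1 w) (- a))).

(* Main.v *)
Require Import Defs.
From HB Require Import structures.
From mathcomp Require Import all_boot all_order all_algebra.
From mathcomp Require Import all_classical all_reals all_analysis.
From mathcomp Require Import measurable_realfun complex ring lra.
Set Implicit Arguments. Unset Strict Implicit. Unset Printing Implicit Defensive.
Import Order.TTheory GRing.Theory Num.Theory.
Import numFieldNormedType.Exports.
Local Open Scope classical_set_scope.
Local Open Scope ring_scope.

(* Let [xi] be the increment of [phi] along one step. For [t <> 0] weak non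
   arithmeticity inverts [Id - Q_t]; applied to the Fourier transform of [h] along the
   fibres of [x |-> \bar x], the inverse has at [t = 0] a simple pole with residue
   proportional to [alpha(h) / gamma]. Memory loss makes the Markov operator contract
   oscillations, which bounds the solutions with the pole removed uniformly near [0]
   and makes them Lipschitz away from [0].

   If [h] is smoothed by a Fejer kernel, Fourier inversion telescopes the renewal sum
   into a difference of two values of a potential: a regular part, which vanishes as
   [phi] tends to infinity by the Riemann-Lebesgue lemma, plus the contribution of the
   pole, a sine integral, whose jump between [-oo] and [+oo] gives the limit. The error
   of the smoothing is at most [delta / (1 + phi^2)], and
   [sum_n E (1 + (phi (x(n)) - a)^2)^-1] is bounded uniformly in [a]: this weight is
   dominated by the mean growth of the bounded function [atan (phi - a)] over finitely
   many steps. *)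

(** * Bounded measurable functions *)

(** Weak non arithmeticity says nothing at [t = 0], and its inverses come without any bound uniform
    in [t]. Near 0 the bound is built by hand: memory loss bounds the oscillation of a solution, and
    averaging the equation against [nu0] bounds its mean, at the price of a division by [t]. This is
    why the right-hand side must have mean [O(t)], and hence why the pole is removed before the
    equation is solved. With two moments only, the solutions are Lipschitz with constant [C / t^2]
    and may be discontinuous at 0, so the telescoping identity is first proved with the frequencies
    near 0 cut off.

    The order of the limits is the other obstacle. Up to an error uniform in [a] and [M], the sum of
    the first [M] terms is [E g(first) - E g(last)], where [g] tends to [A0 / 2] when [phi] tends to
    [+oo], to [- A0 / 2] when [phi] tends to [-oo], and [A0 = - alpha(h) / gamma]. As [gamma > 0]
    the last position always escapes to [+oo]; the first one goes to [+oo] when [a] tends to [-oo]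
    and to [-oo] when [a] tends to [+oo]. This gives [0] and [- A0]. *)

Ltac nonneg := repeat first
  [ assumption | exact: ler01 | exact: ler0n | exact: sqr_ge0 | exact: normr_ge0
  | (apply: ltW; assumption) | apply: addr_ge0 | apply: divr_ge0 | apply: mulr_ge0
  | apply: exprn_ge0 | rewrite invr_ge0 ].

Section bounded_measurable.
Context {d : measure_display} {T : measurableType d} {R : realType}.
Implicit Types (f g : T -> R).

(** Such functions are integrable for every finite measure, which serves [P], [nu0] and Lebesgue
    measure on a bounded interval alike. *)
Definition bmf f := measurable_fun setT f /\ exists M, forall x, `|f x| <= M.

Lemma bmf_cst (c : R) : bmf (fun=> c).
Proof. by split; [exact: measurable_cst | exists `|c|]. Qed.

Lemma bmfD f g : bmf f -> bmf g -> bmf (fun x => f x + g x).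
Proof.
move=> [mf [M fM]] [mg [N gN]]; split; first exact: measurable_funD.
by exists (M + N) => x; rewrite (le_trans (ler_normD _ _))// lerD.
Qed.

Lemma bmfN f : bmf f -> bmf (fun x => - f x).
Proof.
move=> [mf [M fM]]; split; first exact: measurableT_comp.
by exists M => x; rewrite normrN.
Qed.

Lemma bmfB f g : bmf f -> bmf g -> bmf (fun x => f x - g x).
Proof. by move=> bf /bmfN; exact: bmfD. Qed.

Lemma bmfM f g : bmf f -> bmf g -> bmf (fun x => f x * g x).
Proof.
move=> [mf [M fM]] [mg [N gN]]; split; first exact: measurable_funM.
by exists (M * N) => x; rewrite normrM ler_pM.
Qed.

Lemma bmf_norm f : bmf f -> bmf (fun x => `|f x|).
Proof.
move=> [mf [M fM]]; split; first exact: measurableT_comp.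
by exists M => x; rewrite normr_id.
Qed.

Lemma bmf_comp (g : R -> R) f (M : R) : measurable_fun setT f ->
  measurable_fun setT g -> (forall x, `|g x| <= M) -> bmf (fun x => g (f x)).
Proof.
by move=> mf mg gM; split; [exact: measurableT_comp | exists M].
Qed.

Lemma bmf_cos f : measurable_fun setT f -> bmf (fun x => cos (f x)).
Proof.
move=> mf; apply: (@bmf_comp _ _ 1 mf) => [|x]; last exact: cos_max.
by apply: continuous_measurable_fun; exact: continuous_cos.
Qed.

Lemma bmf_sin f : measurable_fun setT f -> bmf (fun x => sin (f x)).
Proof.
move=> mf; apply: (@bmf_comp _ _ 1 mf) => [|x]; last exact: sin_max.
by apply: continuous_measurable_fun; exact: continuous_sin.
Qed.

Lemma bmf_preimage f (B : set R) : measurable_fun setT f -> measurable B ->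
  measurable (f @^-1` B).
Proof. by move=> mf mB; rewrite -[X in measurable X]setTI; exact: mf. Qed.

Variable mu : {finite_measure set T -> \bar R}.

Lemma bmf_integrable f : bmf f -> mu.-integrable setT (EFin \o f).
Proof.
move=> [mf [M fM]]; apply: measurable_bounded_integrable => //.
  by rewrite -ge0_fin_numE//; exact: fin_num_measure.
exists M; split; first exact: num_real.
by move=> N MN x _ /=; exact: le_trans (fM x) (ltW MN).
Qed.

Lemma Rintegral_norm_le f M : mu.-integrable setT (EFin \o f) -> (forall x, `|f x| <= M) ->
  `|\int[mu]_x f x| <= M * fine (mu setT).
Proof.
move=> bf fM; rewrite (le_trans (le_normr_Rintegral _ _))//.
rewrite -Rintegral_cst//; apply: le_Rintegral => //.
  exact: integrable_norm.
by apply: bmf_integrable; exact: bmf_cst.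
Qed.

Lemma bmf_dominated (f_ : nat -> T -> R) f M :
  (forall n, measurable_fun setT (f_ n)) -> measurable_fun setT f ->
  (forall n x, `|f_ n x| <= M) ->
  {ae mu, forall x, f_ n x @[n --> \oo] --> f x} ->
  \int[mu]_x f_ n x @[n --> \oo] --> \int[mu]_x f x.
Proof.
move=> mf_ mf fM fcvg.
have [||| | |intf _ cvgi] := @dominated_convergence _ T R mu setT measurableT
  (fun n x => (f_ n x)%:E) (EFin \o f) (EFin \o cst M).
- by move=> n; exact/measurable_EFinP.
- exact/measurable_EFinP.
- by apply: filterS fcvg => x fx _; apply: cvg_EFin => //; exact: nearW.
- by apply: bmf_integrable; exact: bmf_cst.
- by apply: aeW => x n _; rewrite lee_fin.
apply: fine_cvg; rewrite fineK; first exact: cvgi.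
exact: integrable_fin_num.
Qed.

End bounded_measurable.

Section bmf_fubini.
Context {d1 d2 : measure_display} {T1 : measurableType d1} {T2 : measurableType d2} {R : realType}.
Variables (m1 : {finite_measure set T1 -> \bar R}) (m2 : {finite_measure set T2 -> \bar R}).
Variable F : T1 * T2 -> R.
Hypothesis bF : bmf F.

Lemma bmf_pair1 x : bmf (fun y => F (x, y)).
Proof.
case: bF => mF [M FM]; split; last by exists M => y.
exact: measurableT_comp.
Qed.

Lemma bmf_pair2 y : bmf (fun x => F (x, y)).
Proof.
case: bF => mF [M FM]; split; last by exists M => x.
exact: measurableT_comp.
Qed.

Let integrableF : (m1 \x m2)%E.-integrable setT (EFin \o F).
Proof.
case: bF => mF [M FM].
apply/integrable12ltyP; first exact/measurable_EFinP.
have M0 : 0 <= M by rewrite (le_trans _ (FM (point, point))).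
apply: (@le_lt_trans _ _ (\int[m1]_x \int[m2]_y M%:E)%E).
  apply: ge0_le_integral => //=.
  - by move=> x _; exact: integral_ge0.
  - apply: (measurable_fun_fubini_tonelli_F (fun z => `|(F z)%:E|%E)) => //=.
    apply/measurable_EFinP; exact: measurableT_comp.
  - move=> x _; apply: ge0_le_integral => //=.
    + apply/measurable_EFinP; apply: measurableT_comp => //.
      exact: measurableT_comp.
    + by move=> y _; rewrite lee_fin.
under eq_integral do rewrite integral_cst//.
rewrite integral_cst//.
have f1 : m1 setT \is a fin_num by exact: fin_num_measure.
have f2 : m2 setT \is a fin_num by exact: fin_num_measure.
by rewrite ltey_eq; apply/orP; left; rewrite !fin_numM.
Qed.

Lemma bmf_Rintegral2 : bmf (fun x => \int[m2]_y F (x, y)).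
Proof.
case: (bF) => mF [M FM]; split.
  apply/measurable_EFinP.
  have /= := measurable_fubini_F integrableF.
  apply: eq_measurable_fun => x _ /=; rewrite /fubini_F /Rintegral fineK//.
  apply: integrable_fin_num => //; apply: bmf_integrable; exact: bmf_pair1.
exists (M * fine (m2 setT)) => x; apply: Rintegral_norm_le => //.
by apply: bmf_integrable; exact: bmf_pair1.
Qed.

Lemma bmf_Rintegral1 : bmf (fun y => \int[m1]_x F (x, y)).
Proof.
case: (bF) => mF [M FM]; split.
  apply/measurable_EFinP.
  have /= := measurable_fubini_G integrableF.
  apply: eq_measurable_fun => x _ /=; rewrite /fubini_G /Rintegral fineK//.
  apply: integrable_fin_num => //; apply: bmf_integrable; exact: bmf_pair2.
exists (M * fine (m1 setT)) => x; apply: Rintegral_norm_le => //.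
by apply: bmf_integrable; exact: bmf_pair2.
Qed.

Lemma bmf_Fubini : \int[m1]_x \int[m2]_y F (x, y) = \int[m2]_y \int[m1]_x F (x, y).
Proof.
have := Fubini integrableF => /= FE.
rewrite /Rintegral; congr fine.
transitivity (\int[m1]_x \int[m2]_y (F (x, y))%:E)%E.
  apply: eq_integral => x _; rewrite fineK//.
  apply: integrable_fin_num => //; apply: bmf_integrable; exact: bmf_pair1.
rewrite FE; apply: eq_integral => y _; rewrite fineK//.
apply: integrable_fin_num => //; apply: bmf_integrable; exact: bmf_pair2.
Qed.

End bmf_fubini.

Section probability_integral.
Context {d : measure_display} {T : measurableType d} {R : realType}.
Variable P : probability T R.
Implicit Types (f g : T -> R).

Lemma Rintegral_prob_cst (c : R) : \int[P]_x c = c.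
Proof.
by rewrite Rintegral_cst//= probability_setT mulr1.
Qed.

Lemma Rintegral_prob_addr f (c : R) : bmf f -> \int[P]_x (f x + c) = \int[P]_x f x + c.
Proof.
move=> bf; rewrite RintegralD//.
- by rewrite Rintegral_prob_cst.
- exact: bmf_integrable.
- by apply: bmf_integrable; exact: bmf_cst.
Qed.

Lemma le_Rintegral_prob f M : P.-integrable setT (EFin \o f) -> (forall x, f x <= M) ->
  \int[P]_x f x <= M.
Proof.
move=> bf fM; rewrite -[leRHS]Rintegral_prob_cst; apply: le_Rintegral => //.
by apply: bmf_integrable; exact: bmf_cst.
Qed.

Lemma ge_Rintegral_prob f M : P.-integrable setT (EFin \o f) -> (forall x, M <= f x) ->
  M <= \int[P]_x f x.
Proof.
move=> bf fM; rewrite -[leLHS]Rintegral_prob_cst; apply: le_Rintegral => //.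
by apply: bmf_integrable; exact: bmf_cst.
Qed.

Lemma norm_Rintegral_prob_le f M : P.-integrable setT (EFin \o f) -> (forall x, `|f x| <= M) ->
  `|\int[P]_x f x| <= M.
Proof.
move=> bf fM; rewrite ler_norml; apply/andP; split.
  by apply: ge_Rintegral_prob => // x; have := fM x; rewrite ler_norml => /andP[].
by apply: le_Rintegral_prob => // x; have := fM x; rewrite ler_norml => /andP[].
Qed.

End probability_integral.

(** * Topical maps and measurability *)

Section vectors.
Context {R : realType} {d : nat}.
Implicit Types (x y : vec R d) (F : vec R d -> vec R d) (phi : vec R d -> R).

Lemma vec_norm_le x (e : R) : 0 <= e -> (forall i, `|x 0 i| <= e) -> `|x| <= e.
Proof.
move=> e0 xe; rewrite [`|x|]mx_normrE; apply/bigmax_leP; split => // -[i j] _ /=.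
by rewrite ord1.
Qed.

Lemma vec_coord_le x i : `|x 0 i| <= `|x|.
Proof. by rewrite [`|x|]mx_normrE; exact: (le_bigmax _ _ (0, i)). Qed.

Lemma vshiftE x a i : vshift x a 0 i = x 0 i + a.
Proof. by rewrite !mxE. Qed.

Lemma vshift_add x a b : vshift (vshift x a) b = vshift x (a + b).
Proof. by apply/rowP => i; rewrite !mxE addrA. Qed.

Lemma vshift0 x : vshift x 0 = x.
Proof. by apply/rowP => i; rewrite !mxE addr0. Qed.

Lemma vle_shift_norm x y : vle x (vshift y `|x - y|).
Proof.
move=> i; rewrite vshiftE -lerBlDl (le_trans (ler_norm _))//.
by have := vec_coord_le (x - y) i; rewrite !mxE.
Qed.

Lemma topical_op_lip F x y : topical_op F -> `|F x - F y| <= `|x - y|.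
Proof.
move=> [Fle Fsh]; apply: vec_norm_le => // i; rewrite !mxE ler_norml.
have := Fle _ _ (vle_shift_norm x y) i; rewrite Fsh vshiftE => h1.
have := Fle _ _ (vle_shift_norm y x) i; rewrite Fsh vshiftE => h2.
rewrite (distrC y x) in h2.
by apply/andP; split; lra.
Qed.

Lemma topical_fun_lip phi x y : topical_fun phi -> `|phi x - phi y| <= `|x - y|.
Proof.
move=> [Fle Fsh]; rewrite ler_norml.
have := Fle _ _ (vle_shift_norm x y); rewrite Fsh => h1.
have := Fle _ _ (vle_shift_norm y x); rewrite Fsh => h2.
rewrite (distrC y x) in h2.
by apply/andP; split; lra.
Qed.

Lemma lip_continuous (V : normedModType R) (f : vec R d -> V) :
  (forall x y, `|f x - f y| <= `|x - y|) -> continuous f.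
Proof.
move=> fl x U /= /(nbhs_ballP (f x))[e /= e0 es].
apply/nbhs_ballP; exists e => //= y; rewrite -ball_normE /= => xy.
by apply: es; rewrite -ball_normE /=; exact: le_lt_trans (fl _ _) xy.
Qed.

Lemma topical_op_continuous F : topical_op F -> continuous F.
Proof. by move=> tF; apply: lip_continuous => x y; exact: topical_op_lip. Qed.

Lemma topical_fun_continuous phi : topical_fun phi -> continuous phi.
Proof. by move=> tF; apply: lip_continuous => x y; exact: topical_fun_lip. Qed.

Lemma vshift_continuous a : continuous (fun x => vshift x a).
Proof.
apply: lip_continuous => x y; rewrite /vshift.
by rewrite opprD addrACA subrr addr0.
Qed.

Lemma vshift_dist x a b : `|vshift x a - vshift x b| <= `|a - b|.
Proof. by apply: vec_norm_le => // i; rewrite !mxE opprD addrACA subrr add0r. Qed.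

(** Grid of mesh [1 / (k + 1)]. Rounding a random vector to the grid makes it countably valued, so
    that questions about a random map at a random point reduce to deterministic points; continuity
    of the map removes the rounding in the limit. *)
Definition cell_index (k : nat) (x : vec R d) : 'rV[int]_d :=
  \row_i Num.floor (k.+1%:R * x 0 i).

Definition cell_point (k : nat) (z : 'rV[int]_d) : vec R d :=
  \row_i ((z 0 i)%:~R / k.+1%:R).

Lemma cell_point_dist k x : `|x - cell_point k (cell_index k x)| <= k.+1%:R^-1.
Proof.
apply: vec_norm_le => [|i]; first by rewrite invr_ge0.
rewrite !mxE; have /andP[] := floor_itv (k.+1%:R * x 0 i).
set m : R := (_)%:~R => h1; rewrite intrD -/m => h2.
have k0 : 0 < k.+1%:R :> R by rewrite ltr0n.
have -> : x 0 i - m / k.+1%:R = (k.+1%:R * x 0 i - m) / k.+1%:R.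
  by rewrite mulrBl mulrAC mulfV ?gt_eqF// mul1r.
rewrite normrM normfV (ger0_norm (ltW k0)) ler_pdivrMr// mulVf ?gt_eqF//.
by rewrite ger0_norm; lra.
Qed.

Lemma cell_point_cvg x : cell_point k (cell_index k x) @[k --> \oo] --> x.
Proof.
apply/cvgrPdist_lt => e e0; near=> k.
rewrite (le_lt_trans (cell_point_dist k x))//; near: k.
exact: near_infty_natSinv_lt (PosNum e0).
Unshelve. all: by end_near. Qed.

End vectors.

Section measurable_cells.
Context {dT : measure_display} {T : measurableType dT} {R : realType} {d : nat}.

Definition mvec (y : T -> vec R d) := forall i, measurable_fun setT (fun t => y t 0 i).

Lemma measurable_cell (y : T -> vec R d) k z : mvec y ->
  measurable [set t | cell_index k (y t) = z].
Proof.
move=> my.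
have -> : [set t | cell_index k (y t) = z] =
   \bigcap_i ((fun t => k.+1%:R * y t 0 i) @^-1` `[(z 0 i)%:~R, (z 0 i + 1)%:~R[).
  apply/seteqP; split => t /=.
    by move=> <- i _ /=; rewrite mxE in_itv/= floor_itv.
  move=> h; apply/rowP => i; rewrite mxE.
  have /= := h i Logic.I; rewrite in_itv/= => zi.
  exact: floor_def.
apply: fin_bigcap_measurable => // i _.
by apply: bmf_preimage => //; exact: measurable_funM.
Qed.

(** On each cell the rounded argument is constant, so the rounded function is measurable piece by
    piece over countably many cells; continuity of [g t] passes to the limit. *)
Lemma measurable_caratheodory (g : T -> vec R d -> R) (y : T -> vec R d) :
  mvec y -> (forall v, measurable_fun setT (g ^~ v)) -> (forall t, continuous (g t)) ->
  measurable_fun setT (fun t => g t (y t)).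
Proof.
move=> my mg cg.
apply: (@measurable_fun_cvg _ _ _ _ (fun k t => g t (cell_point k (cell_index k (y t))))).
  move=> k _ B mB; rewrite setTI.
  have -> : (fun t => g t (cell_point k (cell_index k (y t)))) @^-1` B =
    \bigcup_z ([set t | cell_index k (y t) = z] `&` (g ^~ (cell_point k z)) @^-1` B).
    apply/seteqP; split => t /=.
      by move=> Bt; exists (cell_index k (y t)).
    by move=> [z _ [/= <-]].
  apply: countable_bigcupT_measurable => // z.
  apply: measurableI; first exact: measurable_cell.
  exact: bmf_preimage.
move=> t _; apply: continuous_cvg; first exact: cg.
exact: cell_point_cvg.
Qed.

Lemma measurable_continuous_vec (g : vec R d -> R) (y : T -> vec R d) :
  mvec y -> continuous g -> measurable_fun setT (fun t => g (y t)).
Proof.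
by move=> my cg; exact: (@measurable_caratheodory (fun=> g)).
Qed.

Lemma coord_cont (f : vec R d -> vec R d) i : continuous f -> continuous (fun x => f x 0 i).
Proof.
move=> cf x; apply: (@continuous_comp _ _ _ f (fun v : vec R d => v 0 i) x (cf x)).
exact: coord_continuous.
Qed.

Lemma mvec_caratheodory (F : T -> vec R d -> vec R d) (y : T -> vec R d) :
  mvec y -> (forall v, mvec (F ^~ v)) -> (forall t, continuous (F t)) ->
  mvec (fun t => F t (y t)).
Proof.
move=> my mF cF i; apply: (@measurable_caratheodory (fun t v => F t v 0 i)) => //.
  by move=> v; exact: mF.
by move=> t; apply: coord_cont.
Qed.

End measurable_cells.

Lemma measurable_caratheodory1 {dT : measure_display} {T : measurableType dT} {R : realType}
  (g : T -> R -> R) (y : T -> R) :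
  measurable_fun setT y -> (forall v, measurable_fun setT (g ^~ v)) ->
  (forall t, continuous (g t)) -> measurable_fun setT (fun t => g t (y t)).
Proof.
move=> my mg cg.
rewrite (_ : (fun t => _) = fun t => (fun t v => g t (v 0 0)) t (\row_(i < 1) y t)); last first.
  by apply/funext => t; rewrite mxE.
apply: (@measurable_caratheodory _ T R 1 (fun t v => g t (v 0 0))) => //.
- by move=> i; under eq_fun do rewrite mxE.
- move=> t v.
  apply: (@continuous_comp _ _ _ (fun v : 'rV[R]_1 => v 0 0) (g t) v); last exact: cg.
  exact: coord_continuous.
Qed.

(** Dominated convergence speaks of sequences; this turns it into continuity of integrals that
    depend on a parameter. *)
Lemma seq_continuous {R : realType} {d : nat} (f : vec R d -> R) (p : vec R d) :
  (forall u : nat -> vec R d, u n @[n --> \oo] --> p -> f (u n) @[n --> \oo] --> f p) ->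
  {for p, continuous f}.
Proof.
move=> fp; apply: contrapT => nc.
have [e e0 he] : exists2 e : R, 0 < e &
    forall dl : R, 0 < dl -> exists2 u, `|p - u| < dl & e <= `|f p - f u|.
  apply: contrapT => ne; apply: nc => U /= /(nbhs_ballP (f p))[e /= e0 eU].
  apply: contrapT => nU; apply: ne; exists e => // dl dl0.
  apply: contrapT => nu; apply: nU; apply/nbhs_ballP; exists dl => //= u.
  rewrite -ball_normE /= => pu; apply: eU; rewrite -ball_normE /= ltNge.
  by apply/negP => eu; apply: nu; exists u.
have /choice[u hu] n : exists u, `|p - u| < n.+1%:R^-1 /\ e <= `|f p - f u|.
  by have [|u] := he n.+1%:R^-1; [rewrite invr_gt0 | exists u].
have up : u n @[n --> \oo] --> p.
  apply/cvgrPdist_lt => dl dl0; near=> n.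
  rewrite (lt_trans (hu n).1)//; near: n.
  exact: near_infty_natSinv_lt (PosNum dl0).
have /cvgrPdist_lt/(_ _ e0)[N _ /(_ N (leqnn N))] := fp u up.
by rewrite ltNge (hu N).2.
Unshelve. all: by end_near. Qed.

Section restriction.
Context {dT : measure_display} {T : measurableType dT} {R : realType}.
Lemma ge0_integral_mrestr (mu : {measure set T -> \bar R}) (D : set T) (mD : measurable D) (f : T -> \bar R) : measurable_fun setT f ->
  (forall x, 0 <= f x)%E ->
  (\int[mrestr mu mD]_x f x = \int[mu]_(x in D) f x)%E.
Proof.
move=> mf f0; have mDC := measurableC mD.
rewrite -(setUv D) ge0_integral_setU//; last 2 first.
- exact: measurable_funTS.
- by apply/disj_setPCl.
rewrite [X in (_ + X)%E](_ : _ = 0%E) ?adde0; last first.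
  have fS : measurable_fun (~` D) f by exact: measurable_funTS.
  rewrite -[LHS](@eq_integral _ _ _ _ _ _ (fun x => `|f x|%E)); last first.
    by move=> x _; rewrite gee0_abs.
  apply: integral_abs_eq0 => //.
  by rewrite /= /mrestr setICl measure0.
apply: eq_measure_integral => B mB BD.
by rewrite /= /mrestr setIidl.
Qed.

Variables (mu : {finite_measure set T -> \bar R}) (D : set T) (mD : measurable D).

Lemma ge0_integral_indep (f : T -> R) (f' : T -> R) :
  measurable_fun setT f -> measurable_fun setT f' ->
  (forall x, 0 <= f x) -> (forall x, 0 <= f' x) ->
  (forall B, measurable B -> mu (D `&` f @^-1` B) = mu D * mu (f' @^-1` B))%E ->
  (\int[mu]_(x in D) (f x)%:E = mu D * \int[mu]_x (f' x)%:E)%E.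
Proof.
move=> mf mf' f0 f'0 ind.
have muD : mu D \is a fin_num by exact: fin_num_measure.
have muD0 : 0 <= fine (mu D) by rewrite fine_ge0.
rewrite -ge0_integral_mrestr; last 2 first.
- exact/measurable_EFinP.
- by move=> x; rewrite lee_fin.
(* Both sides become integrals of one nonnegative function on [R], against image measures that agree
   by the independence hypothesis. *)
pose g (y : R) := (Num.max y 0)%:E.
have mg : measurable_fun setT g.
  by apply/measurable_EFinP; apply: measurable_maxr => //; exact: measurable_cst.
have g0 y : (0 <= g y)%E by rewrite lee_fin le_max lexx orbT.
have gf x : (f x)%:E = (g \o f) x by rewrite /g/= max_l.
have gf' x : (f' x)%:E = (g \o f') x by rewrite /g/= max_l.
under eq_integral do rewrite gf.
under [in RHS]eq_integral do rewrite gf'.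
rewrite -[LHS]/(\int[mrestr mu mD]_(x in f @^-1` setT) (g \o f) x)%E.
rewrite -[X in (_ = _ * X)%E]/(\int[mu]_(x in f' @^-1` setT) (g \o f') x)%E.
rewrite -!ge0_integral_pushforward//=.
rewrite -{1}(fineK muD) -[fine _]/((NngNum muD0)%:num) -ge0_integral_mscale//.
apply: eq_measure_integral => B mB _ /=.
rewrite /pushforward /mscale /mrestr /= setIC ind// fineK//.
Qed.

End restriction.

(** * Independence and the Markov property *)

Section transfer.
Context {R : realType} {dO : measure_display} {Omega : measurableType dO}.
Variables (P : probability Omega R) (d : nat).
Variables (A : nat -> Omega -> vec R d -> vec R d) (X0 : Omega -> vec R d).
Hypothesis tA : random_topical_ops A.
Hypothesis rX0 : random_vector X0.
Hypothesis iid : iid_and_indep P A X0.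

Definition source_sigma (k : option nat) : set (set Omega) :=
  match k with
  | None => gen_sigma X0 (@vec_sigma R d)
  | Some n => gen_sigma (A n.+1) (@op_sigma R d)
  end.

Lemma measurable_op n : measurable_fun setT (A n : Omega -> g_sigma_algebraType (@op_cylinders R d)).
Proof.
apply: (@measurability _ _ Omega (g_sigma_algebraType (@op_cylinders R d)) setT _
  (@op_cylinders R d)) => //.
move=> _ [_ [x [i [B [mB ->]]]] <-]; rewrite setTI.
rewrite [X in measurable X](_ : _ = (fun w => A n w x 0 i) @^-1` B)//.
by apply: bmf_preimage => //; exact: tA.2.
Qed.

Lemma measurable_init : measurable_fun setT (X0 : Omega -> g_sigma_algebraType (@vec_cylinders R d)).
Proof.
apply: (@measurability _ _ Omega (g_sigma_algebraType (@vec_cylinders R d)) setT _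
  (@vec_cylinders R d)) => //.
move=> _ [_ [i [B [mB ->]]] <-]; rewrite setTI.
rewrite [X in measurable X](_ : _ = (fun w => X0 w 0 i) @^-1` B)//.
exact: bmf_preimage.
Qed.

Lemma source_sigma_measurable k E : source_sigma k E -> measurable E.
Proof.
case: k => [n|] [B SB ->]; rewrite -[X in measurable X]setTI.
  exact: measurable_op.
exact: measurable_init.
Qed.

Lemma op_mvec n x : mvec (fun w => A n w x).
Proof. by move=> i; exact: tA.2. Qed.

Lemma op_eval_mvec x : mvec (fun F : g_sigma_algebraType (@op_cylinders R d) => F x).
Proof.
move=> i _ B mB; rewrite setTI; apply: sub_sigma_algebra.
by exists x, i, B.
Qed.

Variable Y0 : Omega -> vec R d.
Hypothesis Y0X0 : forall B, @vec_sigma R d B -> source_sigma None (Y0 @^-1` B).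

(** The start [Y0] has to be determined by [X0]. This covers [X0] itself and also the deterministic
    points, for which the chain represents the iterates of the Markov operator. *)
Definition state (n : nat) (w : Omega) := prod_ops A n w (Y0 w).

(** Rounding takes place at every step: an event about the current cell is then a countable disjoint
    union of intersections of events that concern one operator at one fixed point. Topical maps are
    nonexpansive, so the rounding errors only add up. *)
Fixpoint cell_state (k n : nat) (w : Omega) : 'rV[int]_d :=
  match n with
  | 0 => cell_index k (Y0 w)
  | m.+1 => cell_index k (A m.+1 w (cell_point k (cell_state k m w)))
  end.

Lemma state_mvec n : mvec (state n).
Proof.
elim: n => [|n ih].
  move=> i _ B mB; rewrite setTI.
  apply: (@source_sigma_measurable None).
  apply: (Y0X0 (B := [set x : vec R d | B (x 0 i)])).
  by apply: sub_sigma_algebra; exists i, B.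
apply: (@mvec_caratheodory _ _ _ _ (A n.+1) (state n)) => //.
  by move=> v; exact: op_mvec.
by move=> t; apply: topical_op_continuous; exact: tA.1.
Qed.

Lemma cell_state_dist k n w :
  `|state n w - cell_point k (cell_state k n w)| <= n.+1%:R / k.+1%:R.
Proof.
elim: n => [|n ih]; first by rewrite mul1r cell_point_dist.
have -> : state n.+1 w = A n.+1 w (state n w) by [].
set v := A n.+1 w (cell_point k (cell_state k n w)).
have -> : cell_state k n.+1 w = cell_index k v by [].
rewrite -(subrKA v) (le_trans (ler_normD _ _))// -[n.+2]addn1 natrD mulrDl mul1r lerD//.
  by rewrite (le_trans (topical_op_lip _ _ (tA.1 _ _))).
exact: cell_point_dist.
Qed.

Lemma cell_state_cvg n w : cell_point k (cell_state k n w) @[k --> \oo] --> state n w.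
Proof.
apply/cvgrPdist_lt => e e0; near=> k.
rewrite (le_lt_trans (cell_state_dist k n w))//.
rewrite ltr_pdivrMr// -ltr_pdivrMl// mulrC -[ltRHS]natr1.
near: k; exists (Num.truncn (n.+1%:R / e)).+1 => // k /= kn.
rewrite (lt_trans (truncnS_gt _))// (le_lt_trans (y := k%:R))// ?ler_nat// ltrDl//.
Unshelve. all: by end_near. Qed.

(* [E] is independent of the operators of index larger than [n]. *)
Definition past_event (n : nat) (E : set Omega) :=
  measurable E /\
  forall (J : seq (option nat)) (B : option nat -> set Omega), uniq J ->
    (forall j, j \in J -> if j is Some m then (n <= m)%N else false) ->
    (forall j, j \in J -> source_sigma j (B j)) ->
    (P (E `&` \big[setI/setT]_(j <- J) B j) = P E * \prod_(j <- J) P (B j))%E.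

Lemma past_event0 E : source_sigma None E -> past_event 0 E.
Proof.
move=> FE; split; first exact: source_sigma_measurable FE.
move=> J B uJ J0 JB.
have NJ : None \notin J by apply/negP => /J0.
pose C (j : option nat) := if j is None then E else B j.
have CB j : j \in J -> B j = C j by case: j => // NJ'; move: NJ; rewrite NJ'.
rewrite (eq_big_seq (fun j => P (C j))); last by move=> j /CB ->.
rewrite (eq_big_seq C) //.
have := iid.1 (None :: J) _ C; rewrite !big_cons /= NJ; apply => //.
by move=> [m|]//; rewrite inE/=; exact: (JB (Some m)).
Qed.

Lemma past_event_indep n E C : past_event n E -> source_sigma (Some n) C ->
  P (E `&` C) = (P E * P C)%E.
Proof.
move=> [mE indE] FC.
have := indE [:: Some n] (fun=> C); rewrite !big_seq1; apply => //.
  by move=> j; rewrite inE => /eqP ->.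
by move=> j; rewrite inE => /eqP ->.
Qed.

(** The index [Some n], carrying [C], is added to the family [J]; the product rule for [E] then
    yields the one for the intersection. *)
Lemma past_eventS n E C : past_event n E -> source_sigma (Some n) C ->
  past_event n.+1 (E `&` C).
Proof.
move=> pE FC; have [mE indE] := pE.
split; first by apply: measurableI => //; exact: source_sigma_measurable FC.
move=> J B uJ Jn JB; rewrite (past_event_indep pE FC).
have NJ : Some n \notin J by apply/negP => /Jn; rewrite ltnn.
pose B' (j : option nat) := if j == Some n then C else B j.
have BB j : j \in J -> B j = B' j.
  by rewrite /B'; case: eqP => // -> nJ; move: NJ; rewrite nJ.
rewrite (eq_big_seq (fun j => P (B' j))); last by move=> j /BB ->.
rewrite (eq_big_seq B') //.
have := indE (Some n :: J) B'.
rewrite !big_cons /B' eqxx -/B' setIA muleA; apply => /=.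
- by rewrite NJ.
- move=> j; rewrite inE => /predU1P[->//|/Jn]; case: j => // m.
  exact: ltnW.
- by move=> j; rewrite inE; case: eqP => [->//|_ /= /JB].
Qed.

Lemma past_event_bigcup n (E : nat -> set Omega) : trivIset setT E ->
  (forall i, past_event n (E i)) -> past_event n (\bigcup_i E i).
Proof.
move=> tE pE; split; first by apply: bigcupT_measurable => i; exact: (pE i).1.
move=> J B uJ Jn JB.
have mB : measurable (\big[setI/setT]_(j <- J) B j).
  rewrite big_seq; apply: bigsetI_measurable => j /JB.
  exact: source_sigma_measurable.
rewrite setI_bigcupl !measure_bigcup//=; last first.
- exact: trivIset_setIr.
- by move=> i _; apply: measurableI => //; exact: (pE i).1.
- by move=> i _; exact: (pE i).1.
rewrite (eq_eseriesr (g := fun i => (\prod_(j <- J) P (B j) * P (E i))%E)); last first.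
  by move=> i _; rewrite (pE i).2// muleC.
have fin : (\prod_(j <- J) P (B j))%E \is a fin_num.
  rewrite big_seq; elim/big_ind : _ => //; first by move=> *; exact: fin_numM.
  by move=> j /JB /source_sigma_measurable mBj; exact: fin_num_measure.
rewrite -(fineK fin) nneseriesZl; last by move=> i _; exact: measure_ge0.
by rewrite muleC.
Qed.

Definition enum_family {I : countType} {T : Type} (E : I -> set T) (m : nat) : set T :=
  if pickle_inv m is Some u then E u else set0.

Lemma enum_family_bigcup (I : countType) (T : Type) (E : I -> set T) :
  \bigcup_m enum_family E m = \bigcup_u E u.
Proof.
apply/seteqP; split => [t [m _]|t [u _ Et]].
  by rewrite /enum_family; case: (pickle_inv m) => // u Et; exists u.
by exists (pickle u) => //; rewrite /enum_family pickleK_inv.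
Qed.

Lemma enum_family_trivIset (I : countType) (T : Type) (E : I -> set T) :
  trivIset setT E -> trivIset setT (enum_family E).
Proof.
move=> tE i j _ _ [t []]; rewrite /enum_family.
case ui: (pickle_inv i) => [u|//]; case uj: (pickle_inv j) => [v|//] Eu Ev.
have uv : u = v by apply: tE => //; exists t.
have := @pickle_invK I i; rewrite ui /= => <-.
by have := @pickle_invK I j; rewrite uj /= => <-; rewrite uv.
Qed.

Lemma cell_state_past k n z : past_event n [set w | cell_state k n w = z].
Proof.
elim: n z => [|n ih] z.
  apply: past_event0.
  have -> : [set w | cell_state k 0 w = z] =
      Y0 @^-1` [set x | cell_index k x = z] by [].
  apply: Y0X0.
  have : mvec (id : g_sigma_algebraType (@vec_cylinders R d) -> vec R d).
    move=> i _ B mB; rewrite setTI; apply: sub_sigma_algebra.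
    by exists i, B.
  by move=> /(measurable_cell k z).
pose E u := [set w | cell_state k n w = u] `&`
            [set w | cell_index k (A n.+1 w (cell_point k u)) = z].
have -> : [set w | cell_state k n.+1 w = z] = \bigcup_m enum_family E m.
  rewrite enum_family_bigcup; apply/seteqP; split => w /=.
    by move=> zw; exists (cell_state k n w).
  by move=> [u _ [/= ->]].
apply: past_event_bigcup.
  apply: enum_family_trivIset => u v _ _ [w [[/= + _] [/= + _]]].
  by move=> -> ->.
move=> m; rewrite /enum_family; case: (pickle_inv m) => [u|]; last first.
  split => // J B uJ Jn JB; rewrite set0I measure0 mul0e//.
apply: past_eventS => //.
exists [set F : vec R d -> vec R d | cell_index k (F (cell_point k u)) = z] => //.
exact: (measurable_cell k z (op_eval_mvec (cell_point k u))).
Qed.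

Lemma op_same_law n S : @op_sigma R d S -> P (A n.+1 @^-1` S) = P (A 1 @^-1` S).
Proof. by move=> oS; exact: iid.2. Qed.

Section one_step.
Variable r : (vec R d -> vec R d) -> vec R d -> R.
Variable M : R.
Hypothesis cr : forall F, topical_op F -> continuous (r F).
Hypothesis mr : forall v, measurable_fun setT (r ^~ v : g_sigma_algebraType (@op_cylinders R d) -> R).
Hypothesis rM : forall F v, `|r F v| <= M.

Definition one_step (v : vec R d) : R := \int[P]_w r (A 1 w) v.

Lemma measurable_step n v : measurable_fun setT (fun w => r (A n w) v).
Proof.
move=> _ B mB; have h := mr v measurableT mB; rewrite setTI in h.
exact: (measurable_op n measurableT h).
Qed.

Lemma bmf_step n v : bmf (fun w => r (A n w) v).
Proof. by split; [exact: measurable_step | exists M]. Qed.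

Lemma one_step_le v : `|one_step v| <= M.
Proof.
apply: norm_Rintegral_prob_le => //.
by apply: bmf_integrable; exact: bmf_step.
Qed.

Lemma one_step_cvg (v_ : nat -> vec R d) v : v_ k @[k --> \oo] --> v ->
  one_step (v_ k) @[k --> \oo] --> one_step v.
Proof.
move=> vv; apply: (@bmf_dominated _ _ _ P _ _ M) => //.
- by move=> k; exact: measurable_step.
- exact: measurable_step.
- apply: aeW => w; apply: (@continuous_cvg _ _ _ \oo _ v_ (r (A 1 w)) v _ vv).
  by apply: cr; exact: tA.1.
Qed.

Lemma measurable_step_state n : measurable_fun setT (fun w => r (A n.+1 w) (state n w)).
Proof.
apply: (@measurable_caratheodory _ _ _ _ (fun w => r (A n.+1 w)) (state n)) => [|v|t].
- exact: state_mvec.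
- exact: measurable_step.
- by apply: cr; exact: tA.1.
Qed.

(** On the event that the rounded state is in a given cell, its value is a fixed point, and the next
    operator is independent of that event and distributed as [A 1]. Adding [M] makes the integrands
    nonnegative, so that the integrals split over countably many cells. *)
Lemma cell_transfer k n (c := fun w => cell_point k (cell_state k n w)) :
  (\int[P]_w (r (A n.+1 w) (c w) + M)%:E = \int[P]_w (one_step (c w) + M)%:E)%E.
Proof.
pose S := enum_family (fun u => [set w | cell_state k n w = u]).
have mS m : measurable (S m).
  rewrite /S /enum_family; case: (pickle_inv m) => [u|]; last exact: measurable0.
  exact: (cell_state_past k n u).1.
have tS : trivIset setT S.
  by apply: enum_family_trivIset => u v _ _ [w [/= <- <-]].
have ST : \bigcup_m S m = setT.
  rewrite enum_family_bigcup; apply/seteqP; split => // w _.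
  by exists (cell_state k n w).
have r0 F v : 0 <= r F v + M by have := rM F v; rewrite ler_norml => /andP[]; lra.
have s0 v : 0 <= one_step v + M by have := one_step_le v; rewrite ler_norml => /andP[]; lra.
have mc (g : vec R d -> R) : measurable_fun setT (fun w => g (c w)).
  move=> _ B mB; rewrite setTI.
  have -> : (fun w => g (c w)) @^-1` B =
     \bigcup_u (if `[< B (g (cell_point k u)) >] then
        [set w | cell_state k n w = u] else set0).
    apply/seteqP; split => w /=.
      by move=> Bw; exists (cell_state k n w) => //; case: asboolP.
    by move=> [u _]; case: asboolP => //= Bu wu; rewrite /c wu.
  apply: countable_bigcupT_measurable => // u; case: asboolP => _ //.
  exact: (cell_state_past k n u).1.
have mrc : measurable_fun setT (fun w => r (A n.+1 w) (c w)).
  apply: (@measurable_caratheodory _ _ _ _ (fun w => r (A n.+1 w)) c) => [i|v|t].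
  - exact: (mc (fun v => v 0 i)).
  - exact: measurable_step.
  - by apply: cr; exact: tA.1.
have mrcM : measurable_fun setT (fun w => (r (A n.+1 w) (c w) + M)%:E).
  by apply/measurable_EFinP; apply: measurable_funD => //; exact: measurable_cst.
have msM : measurable_fun setT (fun w => (one_step (c w) + M)%:E).
  by apply/measurable_EFinP; exact: (mc (fun v => one_step v + M)).
rewrite -ST !ge0_integral_bigcup//=; try by rewrite ST.
all: try by move=> w _; rewrite lee_fin.
apply: eq_eseriesr => m _.
case E: (pickle_inv m) => [u|]; last first.
  by rewrite /S /enum_family E !integral_set0.
have Su : S m = [set w | cell_state k n w = u] by rewrite /S /enum_family E.
transitivity (\int[P]_(w in S m) (r (A n.+1 w) (cell_point k u) + M)%:E)%E.
  by apply: eq_integral => w; rewrite Su inE /= => wu; rewrite /c wu.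
transitivity (\int[P]_(w in S m) (one_step (cell_point k u) + M)%:E)%E; last first.
  by apply: eq_integral => w; rewrite Su inE /= => wu; rewrite /c wu.
have mrM j : measurable_fun setT (fun w => r (A j w) (cell_point k u) + M).
  by apply: measurable_funD; [exact: measurable_step | exact: measurable_cst].
rewrite (@ge0_integral_indep _ _ _ P _ (mS m) _ (fun w => r (A 1 w) (cell_point k u) + M))//.
  rewrite integral_cst// muleC; congr (_ * _)%E.
  under eq_integral do rewrite EFinD.
  rewrite integralD_EFin//; last 2 first.
  - by apply: bmf_integrable; exact: bmf_step.
  - by apply: bmf_integrable; exact: bmf_cst.
  rewrite EFinD integral_cst//= probability_setT mule1; congr (_ + _)%E.
  rewrite /one_step /Rintegral fineK//; apply: integrable_fin_num => //.
  by apply: bmf_integrable; exact: bmf_step.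
move=> B mB.
pose C := [set F : vec R d -> vec R d | B (r F (cell_point k u) + M)].
have oC : @op_sigma R d C.
  rewrite -[C]setTI.
  have /= := @measurable_funD _ (g_sigma_algebraType (@op_cylinders R d)) R setT _ (fun=> M)
    (mr (cell_point k u)) (measurable_cst _).
  by apply.
rewrite Su.
transitivity (P [set w | cell_state k n w = u] * P (A n.+1 @^-1` C))%E.
  by apply: (past_event_indep (cell_state_past k n u)); exists C.
by congr (_ * _)%E; exact: op_same_law.
Qed.

Lemma one_step_continuous : continuous one_step.
Proof. by move=> v; apply: seq_continuous => v_; exact: one_step_cvg. Qed.

Lemma measurable_one_step_state n : measurable_fun setT (fun w => one_step (state n w)).
Proof.
apply: measurable_continuous_vec; first exact: state_mvec.
exact: one_step_continuous.
Qed.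

(** The Markov property, obtained from [cell_transfer] as the mesh tends to 0: [r F] and [one_step]
    are continuous and bounded, so dominated convergence applies to both sides. *)
Lemma transfer n :
  \int[P]_w r (A n.+1 w) (state n w) = \int[P]_w one_step (state n w).
Proof.
pose c k w : vec R d := cell_point k (cell_state k n w).
have mc k : mvec (c k).
  move=> i _ B mB; rewrite setTI.
  have -> : (fun w => c k w 0 i) @^-1` B =
     \bigcup_u (if `[< B (cell_point k u 0 i : R) >] then
        [set w | cell_state k n w = u] else set0).
    apply/seteqP; split => w /=.
      by move=> Bw; exists (cell_state k n w) => //; case: asboolP.
    by move=> [u _]; case: asboolP => //= Bu wu; rewrite /c wu.
  apply: countable_bigcupT_measurable => // u; case: asboolP => _ //.
  exact: (cell_state_past k n u).1.
have mrc k : measurable_fun setT (fun w => r (A n.+1 w) (c k w)).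
  apply: (@measurable_caratheodory _ _ _ _ (fun w => r (A n.+1 w)) (c k)) => // [v|t].
  - exact: measurable_step.
  - by apply: cr; exact: tA.1.
have msc k : measurable_fun setT (fun w => one_step (c k w)).
  by apply: measurable_continuous_vec => //; exact: one_step_continuous.
have h k : \int[P]_w r (A n.+1 w) (c k w) = \int[P]_w one_step (c k w).
  have b1 : bmf (fun w => r (A n.+1 w) (c k w)) by split; [|exists M].
  have b2 : bmf (fun w => one_step (c k w)).
    by split=> //; exists M => w; exact: one_step_le.
  apply/(addIr M).
  rewrite -!Rintegral_prob_addr//.
  by rewrite /Rintegral cell_transfer.
have c1 : \int[P]_w r (A n.+1 w) (c k w) @[k --> \oo] --> \int[P]_w r (A n.+1 w) (state n w).
  apply: (@bmf_dominated _ _ _ P _ _ M) => //; first exact: measurable_step_state.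
  apply: aeW => w; apply: (@continuous_cvg _ _ _ \oo _ (c^~ w) (r (A n.+1 w)) (state n w)).
    by apply: cr; exact: tA.1.
  exact: cell_state_cvg.
have c2 : \int[P]_w one_step (c k w) @[k --> \oo] --> \int[P]_w one_step (state n w).
  apply: (@bmf_dominated _ _ _ P _ _ M) => //; first exact: measurable_one_step_state.
    by move=> k w; exact: one_step_le.
  apply: aeW => w; apply: (@continuous_cvg _ _ _ \oo _ (c^~ w) one_step (state n w)).
    exact: one_step_continuous.
  exact: cell_state_cvg.
rewrite -(cvg_lim _ c1)// -(cvg_lim _ c2)//.
by congr (limn _); apply/funext => k; exact: h.
Qed.

End one_step.
End transfer.

(** * The Markov operator and memory loss *)

Section operator.
Context {R : realType} {dO : measure_display} {Omega : measurableType dO}.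
Variables (P : probability Omega R) (d : nat).
Variables (A : nat -> Omega -> vec R d -> vec R d) (X0 : Omega -> vec R d).
Hypothesis tA : random_topical_ops A.
Hypothesis rX0 : random_vector X0.
Hypothesis iid : iid_and_indep P A X0.

Definition cb (g : vec R d -> R) := continuous g /\ exists M, forall x, `|g x| <= M.

(** Functions on the projective space are represented by functions on [vec R d] that are constant
    along shifts. *)
Definition shinv (g : vec R d -> R) := forall x a, g (vshift x a) = g x.

Definition Top (g : vec R d -> R) (v : vec R d) : R := \int[P]_w g (A 1 w v).

Lemma cb_eval_meas g v : cb g ->
  measurable_fun setT ((fun F => g (F v)) : g_sigma_algebraType (@op_cylinders R d) -> R).
Proof.
move=> [cg _]; apply: measurable_continuous_vec => //.
exact: op_eval_mvec.
Qed.

Lemma cb_comp_op g F : cb g -> topical_op F -> continuous (fun v => g (F v)).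
Proof.
move=> [cg _] tF v; apply: (@continuous_comp _ _ _ F g v); last exact: cg.
exact: topical_op_continuous.
Qed.

Lemma cb_bmf {dT : measure_display} {T : measurableType dT} (y : T -> vec R d) g :
  mvec y -> cb g -> bmf (fun t => g (y t)).
Proof.
move=> my [cg [M gM]]; split; last by exists M.
exact: measurable_continuous_vec.
Qed.

Lemma bmf_cb_op g n v : cb g -> bmf (fun w => g (A n w v)).
Proof. by apply: (@cb_bmf _ _ (fun w => A n w v)) => i; exact: tA.2. Qed.

Lemma cb_Top g : cb g -> cb (Top g).
Proof.
move=> cbg; have [cg [M gM]] := cbg; split.
  by apply: (@one_step_continuous _ _ _ P _ A tA (fun F v => g (F v)) M) => //
    [F|v]; [exact: cb_comp_op | exact: cb_eval_meas].
exists M => v; apply: norm_Rintegral_prob_le => //.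
by apply: bmf_integrable; exact: bmf_cb_op.
Qed.

Lemma cb_iter_Top g n : cb g -> cb (iter n Top g).
Proof. by move=> cg; elim: n => //= n; exact: cb_Top. Qed.

Lemma Top_bound g M : cb g -> (forall x, `|g x| <= M) -> forall x, `|Top g x| <= M.
Proof.
move=> cg gM x; apply: norm_Rintegral_prob_le => //.
by apply: bmf_integrable; exact: bmf_cb_op.
Qed.

Lemma cbD f g : cb f -> cb g -> cb (fun x => f x + g x).
Proof.
move=> [cf [M fM]] [cg [N gN]]; split; first by move=> x; apply: (@continuousD _ _ _ f g x (cf x) (cg x)).
by exists (M + N) => x; rewrite (le_trans (ler_normD _ _))// lerD.
Qed.

Lemma cbZ c f : cb f -> cb (fun x => c * f x).
Proof.
move=> [cf [M fM]]; split; first by move=> x; apply: (@continuousM _ _ (fun=> c) f x (@cst_continuous _ _ c x) (cf x)).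
by exists (`|c| * M) => x; rewrite normrM ler_wpM2l.
Qed.

Lemma cb_cst c : cb (fun=> c).
Proof. by split; [move=> x; exact: cst_continuous | exists `|c|]. Qed.

Lemma cbN f : cb f -> cb (fun x => - f x).
Proof.
move=> [cf [M fM]]; split; first by move=> x; apply: (@continuousN _ _ _ f x (cf x)).
by exists M => x; rewrite normrN.
Qed.

Lemma cbB f g : cb f -> cb g -> cb (fun x => f x - g x).
Proof. by move=> cf /cbN; exact: cbD. Qed.

Lemma TopD f g x : cb f -> cb g -> Top (fun x => f x + g x) x = Top f x + Top g x.
Proof.
by move=> cf cg; rewrite /Top RintegralD//; apply: bmf_integrable; exact: bmf_cb_op.
Qed.

Lemma TopB f g x : cb f -> cb g -> Top (fun x => f x - g x) x = Top f x - Top g x.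
Proof.
by move=> cf cg; rewrite /Top RintegralB//; apply: bmf_integrable; exact: bmf_cb_op.
Qed.

Lemma TopZ c f x : cb f -> Top (fun x => c * f x) x = c * Top f x.
Proof.
by move=> cf; rewrite /Top RintegralZl//; apply: bmf_integrable; exact: bmf_cb_op.
Qed.

Lemma Top_cst c x : Top (fun=> c) x = c.
Proof. exact: Rintegral_prob_cst. Qed.

Lemma shinv_Top g : shinv g -> shinv (Top g).
Proof.
by move=> sg x a; rewrite /Top; apply: eq_Rintegral => w _; rewrite (tA.1 1 w).2 sg.
Qed.

Lemma shinv_iter_Top g n : shinv g -> shinv (iter n Top g).
Proof. by move=> cg; elim: n => //= n; exact: shinv_Top. Qed.

Section start.
Variable Y0 : Omega -> vec R d.
Hypothesis Y0X0 : forall B, @vec_sigma R d B -> source_sigma A X0 None (Y0 @^-1` B).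

Lemma bmf_state g n : cb g -> bmf (fun w => g (state A Y0 n w)).
Proof. by apply: (@cb_bmf _ _ (state A Y0 n)); exact: (state_mvec tA rX0 Y0X0). Qed.

Lemma state_Top g n : cb g ->
  \int[P]_w g (state A Y0 n.+1 w) = \int[P]_w Top g (state A Y0 n w).
Proof.
move=> cbg; have [cg [M gM]] := cbg.
apply: (@transfer _ _ _ P _ A X0 tA rX0 iid Y0 Y0X0 (fun F v => g (F v)) M) => //.
  by move=> F; exact: cb_comp_op.
by move=> v; exact: cb_eval_meas.
Qed.

Lemma state_iter_Top g n m : cb g ->
  \int[P]_w g (state A Y0 (n + m) w) = \int[P]_w iter n Top g (state A Y0 m w).
Proof.
elim: n g => [//|n ih] g cg; rewrite addSn state_Top// ih; last exact: cb_Top.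
by rewrite iterSr.
Qed.

End start.

Lemma const_start x B : @vec_sigma R d B -> source_sigma A X0 None ((fun=> x) @^-1` B).
Proof.
move=> _; have [Bx|nBx] := pselect (B x).
  exists setT => //; last by apply/seteqP; split.
  exact: (@measurableT _ (g_sigma_algebraType (@vec_cylinders R d))).
exists set0 => //; last by apply/seteqP; split.
exact: (@measurable0 _ (g_sigma_algebraType (@vec_cylinders R d))).
Qed.

Lemma init_start B : @vec_sigma R d B -> source_sigma A X0 None (X0 @^-1` B).
Proof. by move=> SB; exists B. Qed.

Lemma iter_TopE g n x : cb g -> iter n Top g x = \int[P]_w g (prod_ops A n w x).
Proof.
move=> cg; have := state_iter_Top (const_start x) n 0 cg.
by rewrite addn0 /state /= Rintegral_prob_cst.
Qed.

Lemma prod_ops_topical n w : topical_op (prod_ops A n w).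
Proof.
elim: n => [|n [h1 h2]]; first by split.
have [t1 t2] := tA.1 n.+1 w; split => [x y xy|x a] /=.
  by apply: t1; exact: h1.
by rewrite h2 t2.
Qed.

Lemma prod_ops_mvec n x : mvec (fun w => prod_ops A n w x).
Proof. by have := state_mvec tA rX0 (@const_start x); move=> /(_ n). Qed.

(** By continuity rank 1 can be tested on grid points, which are countably many: this is what makes
    the event measurable. *)
Lemma rank1P (F : vec R d -> vec R d) : topical_op F ->
  rank1 F <-> forall (k : nat) (z z' : 'rV[int]_d) i j,
    F (cell_point k z) 0 i - F (cell_point k z') 0 i =
    F (cell_point k z) 0 j - F (cell_point k z') 0 j.
Proof.
move=> tF; split=> [r1 k z z' i j|h x y].
  have [a ->] := r1 (cell_point k z) (cell_point k z').
  by rewrite !vshiftE; lra.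
have hxy i j : F x 0 i - F y 0 i = F x 0 j - F y 0 j.
  have cF v l : F (cell_point k (cell_index k v)) 0 l @[k --> \oo] --> F v 0 l.
    apply: (@continuous_cvg _ _ _ \oo _ _ (fun v => F v 0 l) v); last exact: cell_point_cvg.
    by apply: coord_cont; exact: topical_op_continuous.
  rewrite -(cvg_lim _ (cvgB (cF x i) (cF y i)))// -(cvg_lim _ (cvgB (cF x j) (cF y j)))//.
  by congr (limn _); apply/funext => k; exact: h.
(* The shift is read off any one coordinate; without coordinates every shift works. *)
have [i0|i0] := pselect (exists i : 'I_d, True).
  have [i _] := i0; exists (F x 0 i - F y 0 i); apply/rowP => j.
  by rewrite vshiftE (hxy i j); lra.
by exists 0; apply/rowP => j; exfalso; apply: i0; exists j.
Qed.

Lemma measurable_rank1 n : measurable [set w | rank1 (prod_ops A n w)].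
Proof.
have -> : [set w | rank1 (prod_ops A n w)] = \bigcap_(q : nat * ('rV[int]_d * 'rV[int]_d) * ('I_d * 'I_d))
  [set w | prod_ops A n w (cell_point q.1.1 q.1.2.1) 0 q.2.1 - prod_ops A n w (cell_point q.1.1 q.1.2.2) 0 q.2.1 =
     prod_ops A n w (cell_point q.1.1 q.1.2.1) 0 q.2.2 - prod_ops A n w (cell_point q.1.1 q.1.2.2) 0 q.2.2].
  apply/seteqP; split => w /=.
    by move=> /(rank1P (prod_ops_topical n w)) h [[k [z z']] [i j]] _ /=; exact: h.
  move=> h; apply/(rank1P (prod_ops_topical n w)) => k z z' i j.
  exact: (h ((k, (z, z')), (i, j))).
rewrite -[X in measurable X]setCK setC_bigcap; apply: measurableC.
apply: countable_bigcupT_measurable => // q; apply: measurableC.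
set f1 := (X in [set w | X w = _]); set f2 := (X in [set w | _ = X w]).
have m1 : measurable_fun setT f1 by apply: measurable_funB; exact: prod_ops_mvec.
have m2 : measurable_fun setT f2 by apply: measurable_funB; exact: prod_ops_mvec.
have -> : [set w | f1 w = f2 w] = (fun w => f1 w - f2 w) @^-1` [set 0].
  by apply/seteqP; split => w /=; [move=> ->; rewrite subrr | move/eqP; rewrite subr_eq0 => /eqP].
by apply: bmf_preimage; [exact: measurable_funB | exact: measurable_set1].
Qed.

Section doeblin.
Variables (N : nat) (p : R).
Hypothesis p0 : 0 < p.
Hypothesis pE : P [set w | rank1 (prod_ops A N w)] = p%:E.

(** Where the product has rank 1 the images of [x] and [y] differ by a shift, which [f] does not
    see. The oscillation survives only on the complement, of probability [1 - p]. *)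
Lemma doeblin_contraction f b : cb f -> shinv f -> 0 <= b -> (forall x y, f x - f y <= b) ->
  forall x y, iter N Top f x - iter N Top f y <= (1 - p) * b.
Proof.
move=> cf sf b0 fb x y; rewrite !iter_TopE//.
pose RR := [set w | rank1 (prod_ops A N w)].
have mRR : measurable RR by exact: measurable_rank1.
have bf v : bmf (fun w => f (prod_ops A N w v)).
  by apply: (@cb_bmf _ _ (fun w => prod_ops A N w v)) => //; exact: prod_ops_mvec.
rewrite -RintegralB//; [|exact: bmf_integrable|exact: bmf_integrable].
have bi : bmf (\1_(~` RR) : Omega -> R).
  split; first by apply: measurable_indic; exact: measurableC.
  by exists 1 => w; rewrite indicE; case: (_ \in _); rewrite ?normr1 ?normr0.
have -> : (1 - p) * b = \int[P]_w (b * \1_(~` RR) w).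
  rewrite RintegralZl//; last exact: bmf_integrable.
  rewrite mulrC; congr (_ * _).
  rewrite /Rintegral integral_indic//; last exact: measurableC.
  by rewrite setIT /= probability_setC// /RR pE.
apply: le_Rintegral => //.
- by apply: bmf_integrable; exact: bmfB.
- by apply: bmf_integrable; apply: bmfM => //; exact: bmf_cst.
move=> w _; rewrite indicE in_setC; case: (boolP (w \in RR)) => /= [|_].
  rewrite inE => /(_ x y)[a ->]; rewrite sf subrr mulr0//.
by rewrite mulr1.
Qed.

Lemma iter_Top_dist f e n : cb f -> (forall x, `|f x - Top f x| <= e) ->
  forall x, `|f x - iter n Top f x| <= n%:R * e.
Proof.
move=> cf fe; elim: n => [|n ih] x; first by rewrite subrr normr0 mul0r.
have h : `|iter n Top f x - iter n.+1 Top f x| <= e.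
  elim: n {ih} x => [//|n ih'] x.
  have c0 := cb_iter_Top n cf; have c1 := cb_iter_Top n.+1 cf.
  by rewrite -[_ - _](TopB x c0 c1); apply: Top_bound => //; exact: cbB.
rewrite -(subrKA (iter n Top f x)) (le_trans (ler_normD _ _))//.
by rewrite -natr1 mulrDl mul1r lerD//; exact: ih.
Qed.

(** This replaces a spectral gap. Iterating [N] times moves [f] by at most [N e], so the oscillation
    [S] of [f] satisfies [S <= 2 N e + (1 - p) S]. *)
Lemma poisson_osc f e : cb f -> shinv f -> (forall x, `|f x - Top f x| <= e) ->
  forall x y, f x - f y <= 2 * N%:R * e / p.
Proof.
move=> cf sf fe; have [_ [M fM]] := cf.
pose S := [set f q.1 - f q.2 | q in [set: vec R d * vec R d]].
have hS : has_sup S.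
  split; first by exists (f 0 - f 0); exists (0, 0).
  exists (M + M) => _ [[x y] _ <-] /=.
  have := fM x; have := fM y; rewrite !ler_norml => /andP[? ?] /andP[? ?]; lra.
have Sb x y : f x - f y <= sup S by apply: ub_le_sup; [exact: hS.2 | exists (x, y)].
have S0 : 0 <= sup S by rewrite -(subrr (f 0)).
have h x y : f x - f y <= 2 * N%:R * e + (1 - p) * sup S.
  have := doeblin_contraction cf sf S0 Sb x y.
  have := iter_Top_dist N cf fe x; have := iter_Top_dist N cf fe y.
  rewrite !ler_norml => /andP[? ?] /andP[? ?] ?; lra.
have : sup S <= 2 * N%:R * e + (1 - p) * sup S.
  by apply: ge_sup; [exact: hS.1 | move=> _ [[x y] _ <-] /=].
move=> hs x y; rewrite (le_trans (Sb x y))// ler_pdivlMr//; lra.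
Qed.

End doeblin.

End operator.

Section invariant.
Context {R : realType} {dO : measure_display} {Omega : measurableType dO}.
Variables (P : probability Omega R) (d : nat).
Variables (A : nat -> Omega -> vec R d -> vec R d).
Hypothesis tA : random_topical_ops A.
Variable i0 : 'I_d.
Variable nu0 : probability (PRmax R d) R.
Hypothesis inv : invariant_measure P A nu0.

(** The sigma-algebra of [PRmax] sees the differences of coordinates, not the coordinates. The
    representative whose coordinate [i0] vanishes is measurable, and a shift invariant function may
    be evaluated there. *)
Definition normalize (x : vec R d) : vec R d := vshift x (- x 0 i0).

Lemma normalize_mvec : mvec (normalize : PRmax R d -> vec R d).
Proof.
move=> j _ B mB; rewrite setTI; apply: sub_sigma_algebra.
by exists j, i0, B; split => //; apply/seteqP; split => x /=; rewrite vshiftE.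
Qed.

Lemma shinv_normalize (f : vec R d -> R) x : shinv f -> f (normalize x) = f x.
Proof. by move=> ->. Qed.

Lemma bmf_PR (f : vec R d -> R) : cb f -> shinv f -> bmf (f : PRmax R d -> R).
Proof.
move=> cf sf; have := cb_bmf normalize_mvec cf.
by congr (bmf _); apply/funext => x; exact: shinv_normalize.
Qed.

Definition PRstep (q : PRmax R d * Omega) : PRmax R d := A 1 q.2 q.1.

Lemma measurable_PRstep : measurable_fun setT PRstep.
Proof.
apply: (@measurability _ _ _ (PRmax R d) setT _ (@pr_cylinders R d)) => //.
move=> _ [_ [i [j [B [mB ->]]]] <-]; rewrite setTI.
have my : mvec (fun q : PRmax R d * Omega => normalize q.1).
  by move=> k; exact: (measurableT_comp (normalize_mvec k) measurable_fst).
have mA : mvec (fun q : PRmax R d * Omega => A 1 q.2 (normalize q.1)).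
  apply: (@mvec_caratheodory _ _ _ _ (fun q : PRmax R d * Omega => A 1 q.2)) => // [v k|q].
    exact: (measurableT_comp (tA.2 1 v k) measurable_snd).
  exact: topical_op_continuous (tA.1 _ _).
have -> : PRstep @^-1` [set x | B (x 0 i - x 0 j)] =
   (fun q => A 1 q.2 (normalize q.1) 0 i - A 1 q.2 (normalize q.1) 0 j) @^-1` B.
  apply/seteqP; split => q /=; rewrite (tA.1 1 q.2).2 !vshiftE /PRstep;
    by rewrite opprD addrACA subrr addr0.
by apply: bmf_preimage => //; exact: measurable_funB.
Qed.

(** Invariance is given on sets: [nu0] is the image of the product of [nu0] and [P] under [PRstep].
    Tonelli transfers it to functions, made nonnegative by adding [M]. *)
Lemma nu_Top f : cb f -> shinv f -> \int[nu0]_x Top P A f x = \int[nu0]_x f x.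
Proof.
move=> cf sf; have [_ [M fM]] := cf.
have bf := bmf_PR cf sf.
have bTf : bmf (Top P A f : PRmax R d -> R).
  by apply: bmf_PR; [exact: cb_Top | exact: shinv_Top].
apply/(addIr M); rewrite -!Rintegral_prob_addr// /Rintegral; congr fine.
have f0 x : (0 <= (f x + M)%:E)%E.
  by rewrite lee_fin; have := fM x; rewrite ler_norml => /andP[? _]; lra.
have mfM : measurable_fun setT (fun x : PRmax R d => (f x + M)%:E).
  apply/measurable_EFinP; apply: measurable_funD; last exact: measurable_cst.
  exact: bf.1.
have mfS : measurable_fun setT (fun q : PRmax R d * Omega => (f (PRstep q) + M)%:E).
  exact: (measurableT_comp mfM measurable_PRstep).
transitivity (\int[nu0]_x \int[P]_w (f (PRstep (x, w)) + M)%:E)%E.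
  apply: eq_integral => x _; rewrite /Top -(Rintegral_prob_addr P M (bmf_cb_op tA 1 x cf)).
  rewrite /Rintegral fineK//; apply: integrable_fin_num => //; apply: bmf_integrable.
  by apply: bmfD; [exact: (bmf_cb_op tA 1 x cf) | exact: bmf_cst].
rewrite -[LHS](fubini_tonelli1 (fun q => (f (PRstep q) + M)%:E))//.
transitivity (\int[(nu0 \x P)]_(z in PRstep @^-1` setT)
  (((fun x : PRmax R d => (f x + M)%:E) \o PRstep) z))%E; first by [].
rewrite -(ge0_integral_pushforward measurable_PRstep)//.
apply: eq_measure_integral; first exact: measurable_PRstep.
move=> mm S mS _.
rewrite /= /pushforward -[RHS]inv//.
apply: eq_integral => x _.
by congr (P _); rewrite /xsection; apply/seteqP; split => w; rewrite /= inE.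
Qed.

End invariant.

(** * Occupation times *)

Section atan_bound.
Context {R : realType}.

(* Obtained from the mean value theorem, except for large negative [x], where
   the quadratic term exceeds [pi]. *)
Lemma atan_expansion (s x : R) :
  x / (1 + s ^+ 2) - 16 * x ^+ 2 / (1 + s ^+ 2) <= atan (s + x) - atan s.
Proof.
have s0 : 0 < 1 + s ^+ 2 by have := sqr_ge0 s; lra.
set k := (1 + s ^+ 2)^-1.
have k0 : 0 < k by rewrite invr_gt0.
have kE : (1 + s ^+ 2) * k = 1 by rewrite mulfV// gt_eqF.
pose G (r : R) := atan r - k * (r - s) + 16 * k * (r - s) ^+ 2.
pose dG (r : R) := (1 + r ^+ 2)^-1 - k + 16 * k * (2 * (r - s)).
have dGE (r : R) : is_derive r 1 G (dG r).
  have h1 : is_derive r 1 (fun r : R => r - s) 1.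
    by apply: is_derive_eq; rewrite ?subr0.
  have h2 : is_derive r 1 (fun r : R => (r - s) ^+ 2) (2 * (r - s)).
    by apply: is_derive_eq; rewrite -![_ *: _]/(_ * _) mulr1; ring.
  have e := is_deriveD (is_deriveB (is_derive1_atan r) (is_deriveZ k h1)) (is_deriveZ (16 * k) h2).
  apply: (is_derive_eq e).
  by rewrite /dG -![_ *: _]/(_ * _) mulr1.
(* The sign of [dG r] is that of [r - s] as soon as the middle factor is nonnegative: this holds to
   the right of [s], and to its left as long as the distance from [r] to [s] is at most
   [1 + r ^+ 2]. *)
have dGfact (r : R) : dG r = (r - s) * ((r - s) - 2 * r + 32 * (1 + r ^+ 2)) * (k / (1 + r ^+ 2)).
  have r0 : 1 + r ^+ 2 != 0 by rewrite gt_eqF//; have := sqr_ge0 r; lra.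
  have s1 : 1 + s ^+ 2 != 0 by rewrite gt_eqF.
  by rewrite /dG /k; field; rewrite r0 s1.
have kr0 (r : R) : 0 <= k / (1 + r ^+ 2).
  by apply: divr_ge0; [exact: ltW | have := sqr_ge0 r; lra].
have Gs : G s = atan s by rewrite /G subrr expr2 !mulr0 subr0 addr0.
have Gx : G (s + x) = atan (s + x) - x * k + 16 * x ^+ 2 * k.
  by rewrite /G (addrC s) addrK; ring.
suff : G s <= G (s + x) by rewrite Gs Gx; lra.
have cG (a b : R) : {within `[a, b], continuous G}.
  apply: continuous_subspaceT => y.
  apply/differentiable_continuous/derivable1_diffP.
  by have [] := dGE y.
have sq (r : R) : 2 * `|r| <= 1 + r ^+ 2.
  by rewrite -(real_normK (num_real r)); have := sqr_ge0 (`|r| - 1); rewrite sqrrB; lra.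
have [x0|x0] := leP 0 x.
  have sx : s <= s + x by lra.
  have [c] := @MVT_segment R G dG s (s + x) sx (fun r _ => dGE r) (cG _ _).
  rewrite in_itv /= => /andP[sc cx] dE.
  rewrite -subr_ge0 dE dGfact; apply: mulr_ge0; last lra.
  apply: mulr_ge0 => //; apply: mulr_ge0; first lra.
  have := sq c; have := ler_norm c; have := normr_ge0 c; lra.
have [xs|xs] := ltP (x ^+ 2) ((1 + s ^+ 2) / 4).
  have sx : s + x <= s by lra.
  have [c] := @MVT_segment R G dG (s + x) s sx (fun r _ => dGE r) (cG _ _).
  rewrite in_itv /= => /andP[sc cx] dE.
  rewrite -subr_le0 dE dGfact -mulrA; apply: mulr_le0_ge0; last first.
    by apply: mulr_ge0 => //; lra.
  apply: mulr_le0_ge0; first lra.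
  set y := c - s.
  have y2 : y ^+ 2 <= x ^+ 2 by rewrite /y !expr2; nra.
  have h1 : y ^+ 2 <= 1 + c ^+ 2.
    have : s = c - y by rewrite /y; ring.
    move=> sE; move: xs y2; rewrite sE; have := sqr_ge0 (c + y).
    rewrite !expr2; nra.
  clearbody y; have h2 : `|y| <= 1 + c ^+ 2.
    by have := sq y; have := sqr_ge0 c; lra.
  have := sq c; have := ler_norm c; have := normr_ge0 c.
  by have := lerNnormlW h2; lra.
have pi2 : pi / 2 <= 2 :> R by have /andP[] := (@pihalf_02_cos_pihalf R).1.
rewrite Gs Gx; have := atan_gtNpi2 (s + x); have := atan_ltpi2 s => h1 h2.
have h3 : 4 <= 16 * x ^+ 2 * k.
  have e : 4 = 4 * (1 + s ^+ 2) * k by rewrite -mulrA kE mulr1.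
  by rewrite [leLHS]e ler_pM2r//; lra.
have : x * k <= 0 by rewrite nmulr_rle0// ltW.
lra.
Qed.
End atan_bound.

Section truncation.
Context {R : realType}.
Implicit Types (K y : R).

(** A truncation at height of order [K] that is continuous, as [transfer] requires. Its error is
    quadratic in [y], hence controlled by second moments, and tends to 0 as [K] grows. *)
Definition atrunc K y : R := K * atan (y / K).

Lemma atan_abs_le2 y : `|atan y| <= 2.
Proof.
have pi2 : pi / 2 <= 2 :> R by have /andP[] := (@pihalf_02_cos_pihalf R).1.
by rewrite ler_norml; have := atan_gtNpi2 y; have := atan_ltpi2 y => ? ?; apply/andP; split; lra.
Qed.

Lemma atrunc_le K y : 0 < K -> `|atrunc K y| <= 2 * K.
Proof. by move=> K0; rewrite normrM gtr0_norm// mulrC ler_wpM2r ?atan_abs_le2// ltW. Qed.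

Lemma atrunc_dist K y : 0 < K -> `|y - atrunc K y| <= 16 * y ^+ 2 / K.
Proof.
move=> K0.
have h (u : R) : u - atan u <= 16 * u ^+ 2.
  have := atan_expansion 0 u; rewrite add0r atan0 subr0 expr0n/= addr0 !divr1; lra.
have h' (u : R) : `|u - atan u| <= 16 * u ^+ 2.
  rewrite ler_norml; apply/andP; split; last exact: h.
  have := h (- u); rewrite atanN sqrrN; lra.
have e : y - atrunc K y = K * (y / K - atan (y / K)) by rewrite /atrunc; field; rewrite gt_eqF.
rewrite e normrM gtr0_norm//.
have -> : 16 * y ^+ 2 / K = K * (16 * (y / K) ^+ 2) by field; rewrite gt_eqF.
by rewrite ler_wpM2l// ltW.
Qed.

Lemma atrunc_continuous K : continuous (atrunc K).
Proof.
move=> y; apply: (@continuousM _ _ (fun=> K) (fun y => atan (y / K)) y (@cst_continuous _ _ K y)).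
apply: (@continuous_comp _ _ _ (fun y => y / K) atan y); last exact: continuous_atan.
exact: mulrr_continuous.
Qed.

End truncation.

Section uniform_limit.
Context {R : realType} {d : nat}.

Lemma continuous_uniform_approx (g : vec R d -> R) :
  (forall e, 0 < e -> exists2 f : vec R d -> R, continuous f & forall x, `|g x - f x| <= e) ->
  continuous g.
Proof.
move=> h x; apply: seq_continuous => u ux; apply/cvgrPdist_lt => e e0.
have e4 : 0 < e / 4 by rewrite divr_gt0.
have [f cf gf] := h _ e4.
have fu : f (u n) @[n --> \oo] --> f x by apply: (@continuous_cvg _ _ _ \oo _ u f x _ ux); exact: cf.
move/cvgrPdist_lt : fu => /(_ _ e4); apply: filterS => n fn.
have := gf x; have := gf (u n) => h1 h2.
have -> : g x - g (u n) = (g x - f x) + (f x - f (u n)) - (g (u n) - f (u n)) by ring.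
rewrite (le_lt_trans (ler_normB _ _))// (le_lt_trans (lerD (ler_normD _ _) (lexx _)))//.
by move: fn h1 h2 => /=; lra.
Qed.
End uniform_limit.

Section monotone_truncation.
Context {R : realType}.

(** Bounded continuous functions that increase to the identity on nonnegative arguments: [transfer]
    applies to each of them, and monotone convergence then reaches unbounded integrands such as
    squares. *)
Definition softcap (k : nat) (u : R) : R := u / (1 + `|u| / k.+1%:R).

Lemma softcap_den k (u : R) : 0 < 1 + `|u| / k.+1%:R.
Proof. by rewrite ltr_pwDl// divr_ge0. Qed.

Lemma softcap_continuous k : continuous (softcap k).
Proof.
move=> u; apply: (@continuousM _ _ id (fun u => (1 + `|u| / k.+1%:R)^-1) u).
  exact: cvg_id.
apply: (@continuousV _ _ (fun u => 1 + `|u| / k.+1%:R) u).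
  by rewrite gt_eqF// softcap_den.
apply: cvgD; first exact: cvg_cst.
apply: cvgM; last exact: cvg_cst.
by apply: cvg_norm; exact: cvg_id.
Qed.

Lemma softcap_ge0 k u : 0 <= u -> 0 <= softcap k u.
Proof. by move=> u0; rewrite divr_ge0// ltW// softcap_den. Qed.

Lemma softcap_lt k u : `|softcap k u| <= k.+1%:R.
Proof.
rewrite /softcap normrM normfV (gtr0_norm (softcap_den _ _)).
rewrite ler_pdivrMr ?softcap_den//.
by rewrite mulrDr mulr1 mulrCA mulfV ?mulr1 ?lerDr.
Qed.

Lemma softcap_le_id k u : 0 <= u -> softcap k u <= u.
Proof.
move=> u0; rewrite /softcap ler_pdivrMr ?softcap_den// mulrDr mulr1 lerDl.
by rewrite mulr_ge0// divr_ge0.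
Qed.

Lemma softcap_nd u : 0 <= u -> nondecreasing_seq (fun k => softcap k u).
Proof.
move=> u0; apply/nondecreasing_seqP => k; rewrite /softcap ler_wpM2l//.
rewrite lef_pV2 ?posrE ?softcap_den// lerD2l ler_wpM2l//.
by rewrite lef_pV2 ?posrE ?ltr0n// ler_nat.
Qed.

Lemma softcap_cvg u : softcap k u @[k --> \oo] --> u.
Proof.
rewrite -[X in _ --> X]mulr1 /softcap; apply: cvgM; first exact: cvg_cst.
rewrite -[X in _ --> X]invr1; apply: cvgV => //.
rewrite -[X in _ --> X]addr0; apply: cvgD; first exact: cvg_cst.
rewrite -[X in _ --> X](mulr0 `|u|); apply: cvgM; first exact: cvg_cst.
apply/cvgrPdist_lt => e e0; near=> n.
rewrite sub0r normrN ger0_norm ?invr_ge0//; near: n.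
exact: near_infty_natSinv_lt (PosNum e0).
Unshelve. all: by end_near. Qed.

Context {dT : measure_display} {T : measurableType dT}.
Variable P : probability T R.

Lemma integrable_of_softcap (f : T -> R) (B : R) : measurable_fun setT f ->
  (forall t, 0 <= f t) -> (forall k, \int[P]_t softcap k (f t) <= B) ->
  P.-integrable setT (EFin \o f) /\ \int[P]_t f t <= B.
Proof.
move=> mf f0 fB.
have mg k : measurable_fun setT (fun t => softcap k (f t)).
  apply: (measurableT_comp _ mf).
  by apply: continuous_measurable_fun; exact: softcap_continuous.
have bg k : bmf (fun t => softcap k (f t)).
  by split=> //; exists k.+1%:R => t; exact: softcap_lt.
have le1 : (\int[P]_t (f t)%:E <= B%:E)%E.
  have c : (\int[P]_t (softcap k (f t))%:E @[k --> \oo] --> \int[P]_t (f t)%:E)%E.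
    have -> : (\int[P]_t (f t)%:E = \int[P]_t limn (fun k => (softcap k (f t))%:E))%E.
      apply: eq_integral => t _; apply/esym/cvg_lim => //.
      by apply: cvg_EFin; [exact: nearW | exact: softcap_cvg].
    apply: cvg_monotone_convergence => //.
    - by move=> k; exact/measurable_EFinP.
    - by move=> k t _; rewrite lee_fin softcap_ge0.
    - by move=> t _ m n mn; rewrite lee_fin; exact: softcap_nd.
  rewrite -(cvg_lim _ c)//; apply: lime_le; first by apply/cvg_ex; eexists; exact: c.
  apply: nearW => k; rewrite -[leLHS]fineK; first by rewrite lee_fin; exact: fB.
  by apply: integrable_fin_num => //; exact: bmf_integrable.
have intf : P.-integrable setT (EFin \o f).
  apply/integrableP; split; first exact/measurable_EFinP.
  under eq_integral do rewrite /= ger0_norm//.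
  exact: le_lt_trans le1 (ltry _).
split => //; rewrite -lee_fin /Rintegral fineK//; exact: integrable_fin_num.
Qed.

End monotone_truncation.

(** * Moments of the increments of [phi] *)

Section second_moment.
Context {R : realType} {dO : measure_display} {Omega : measurableType dO}.
Variables (P : probability Omega R) (d : nat).
Variables (A : nat -> Omega -> vec R d -> vec R d) (X0 : Omega -> vec R d).
Hypothesis tA : random_topical_ops A.
Hypothesis rX0 : random_vector X0.
Hypothesis iid : iid_and_indep P A X0.
Variable phi : vec R d -> R.
Hypothesis tphi : topical_fun phi.

Definition incr (x : vec R d) (w : Omega) : R := phi (A 1 w x) - phi x.

Lemma phi_op_meas n x : measurable_fun setT (fun w => phi (A n w x)).
Proof.
apply: measurable_continuous_vec; first by move=> i; exact: tA.2.
exact: topical_fun_continuous.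
Qed.

Lemma incr_meas x : measurable_fun setT (incr x).
Proof. by apply: measurable_funB; [exact: phi_op_meas | exact: measurable_cst]. Qed.

Lemma incr_shift x a w : incr (vshift x a) w = incr x w.
Proof. by rewrite /incr (tA.1 1 w).2 !tphi.2; ring. Qed.

Lemma exists_second_moment : finite_second_moment P A phi ->
  exists2 B, 0 <= B & forall x, P.-integrable setT (EFin \o (fun w => incr x w ^+ 2)) /\
    \int[P]_w (incr x w ^+ 2) <= B.
Proof.
rewrite /finite_second_moment; set S := (\int[P]_w _)%E => Sfin.
have sup0 w : (0 <= sup_incr phi (A 1 w))%E.
  by apply: ereal_sup_ge; exists (`|phi (A 1 w 0) - phi 0|)%:E; [exists 0 | rewrite lee_fin].
have S0 : (0 <= S)%E by apply: integral_ge0 => w _; exact: mule_ge0.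
have Sfn : S \is a fin_num by rewrite ge0_fin_numE.
exists (fine S); first exact: fine_ge0.
move=> x.
have le1 : (\int[P]_w (incr x w ^+ 2)%:E <= S)%E.
  (* The supremum [sup_incr] runs over uncountably many points and its measurability is not at hand.
     The two integrals are compared as suprema over the simple functions below the integrands. *)
  rewrite /S !ge0_integralTE; last 2 first.
  - by move=> w; exact: mule_ge0.
  - by move=> w; rewrite lee_fin sqr_ge0.
  apply: ereal_sup_le => _ [h hf <-]; exists h => // w.
  rewrite (le_trans (hf w))// -(real_normK (num_real _)) expr2 EFinM.
  have le_sup : ((`|incr x w|)%:E <= sup_incr phi (A 1 w))%E.
    by apply: ereal_sup_ubound; exists x.
  by rewrite lee_pmul// lee_fin.
have intf : P.-integrable setT (EFin \o (fun w => incr x w ^+ 2)).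
  apply/integrableP; split.
    by apply/measurable_EFinP; apply: measurable_funX; exact: incr_meas.
  under eq_integral do rewrite /= ger0_norm ?sqr_ge0//.
  exact: le_lt_trans le1 Sfin.
split => //; rewrite -lee_fin /Rintegral !fineK//; exact: integrable_fin_num.
Qed.

Variable B : R.
Hypothesis B0 : 0 <= B.
Hypothesis HB : forall x, P.-integrable setT (EFin \o (fun w => incr x w ^+ 2)) /\
    \int[P]_w (incr x w ^+ 2) <= B.

Lemma sq_integrable_abs {T : measurableType dO} (Q : probability T R) (f : T -> R) (b : R) :
  measurable_fun setT f -> Q.-integrable setT (EFin \o (fun w => f w ^+ 2)) ->
  \int[Q]_w (f w ^+ 2) <= b ->
  Q.-integrable setT (EFin \o f) /\ \int[Q]_w `|f w| <= 1 + b.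
Proof.
move=> mf if2 fb.
have i1 : Q.-integrable setT (EFin \o (fun w => 1 + f w ^+ 2)).
  have := integrableD measurableT (bmf_integrable Q (bmf_cst 1)) if2.
  by [].
have le1 w : `|f w| <= 1 + f w ^+ 2.
  by rewrite -(real_normK (num_real (f w))); have := sqr_ge0 (`|f w| - 1); have := normr_ge0 (f w);
     rewrite sqrrB; lra.
have ifn : Q.-integrable setT (EFin \o f).
  apply: le_integrable i1 => //; first exact/measurable_EFinP.
  move=> w _; rewrite /= lee_fin (le_trans (le1 w))// ler_norm//.
split => //; rewrite (le_trans (y := \int[Q]_w (1 + f w ^+ 2)))//.
  by apply: le_Rintegral => //; exact: integrable_norm.
rewrite RintegralD//; last by apply: bmf_integrable; exact: bmf_cst.
by rewrite Rintegral_prob_cst lerD2l.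
Qed.

Lemma incr_integrable x : P.-integrable setT (EFin \o incr x).
Proof. by have [h1 h2] := HB x; exact: (sq_integrable_abs (incr_meas x) h1 h2).1. Qed.

Lemma incr_abs x : \int[P]_w `|incr x w| <= 1 + B.
Proof. by have [h1 h2] := HB x; exact: (sq_integrable_abs (incr_meas x) h1 h2).2. Qed.

Definition drift (x : vec R d) : R := \int[P]_w incr x w.

Lemma drift_shinv : shinv drift.
Proof. by move=> x a; apply: eq_Rintegral => w _; exact: incr_shift. Qed.

Lemma Rintegral_atrunc {T : measurableType dO} (Q : probability T R) (f : T -> R) (b K : R) :
  0 < K -> measurable_fun setT f -> Q.-integrable setT (EFin \o (fun w => f w ^+ 2)) ->
  \int[Q]_w (f w ^+ 2) <= b ->
  `|\int[Q]_w f w - \int[Q]_w atrunc K (f w)| <= 16 * b / K.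
Proof.
move=> K0 mf if2 fb; have [fi _] := sq_integrable_abs mf if2 fb.
have bt : bmf (fun w => atrunc K (f w)).
  split; last by exists (2 * K) => w; exact: atrunc_le.
  apply: (measurableT_comp _ mf); apply: continuous_measurable_fun.
  exact: atrunc_continuous.
have it := bmf_integrable Q bt.
rewrite -RintegralB//.
have id : Q.-integrable setT (EFin \o (fun w => f w - atrunc K (f w))).
  by have := integrableB measurableT fi it.
rewrite (le_trans (le_normr_Rintegral _ _))//.
rewrite (le_trans (y := \int[Q]_w (16 / K * f w ^+ 2)))//.
  apply: le_Rintegral => //.
  - exact: integrable_norm.
  - by have := integrableZl measurableT (16 / K) if2.
  - by move=> w _; rewrite (le_trans (atrunc_dist _ K0))// mulrAC.
rewrite RintegralZl// mulrAC ler_wpM2r ?invr_ge0 ?(ltW K0)// ler_wpM2l//.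
Qed.

Lemma trunc_step_continuous (f : R -> R) F : continuous f -> topical_op F ->
  continuous (fun v => f (phi (F v) - phi v)).
Proof.
move=> cf tF v; apply: (@continuous_comp _ _ _ (fun v => phi (F v) - phi v) f v); last exact: cf.
have cphi := topical_fun_continuous tphi.
apply: (@continuousB _ _ _ (fun v => phi (F v)) phi v); last exact: cphi.
apply: (@continuous_comp _ _ _ F phi v); last exact: cphi.
exact: topical_op_continuous.
Qed.

Lemma trunc_step_meas (f : R -> R) v : continuous f ->
  measurable_fun setT ((fun F => f (phi (F v) - phi v)) : g_sigma_algebraType (@op_cylinders R d) -> R).
Proof.
move=> cf; apply: (@measurableT_comp _ _ _ _ _ _ f).
  exact: continuous_measurable_fun.
apply: measurable_funB; last exact: measurable_cst.
apply: measurable_continuous_vec; first exact: op_eval_mvec.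
exact: topical_fun_continuous.
Qed.

(** The mean increment is a uniform limit of truncated means, which are continuous by dominated
    convergence: the truncation error [16 * B / K] does not depend on the point. *)
Lemma drift_cb : cb drift.
Proof.
split; last first.
  exists (1 + B) => x; rewrite (le_trans (le_normr_Rintegral _ (incr_integrable x)))//.
  exact: incr_abs.
apply: continuous_uniform_approx => e e0.
pose K := (16 * B + 1) / e.
have K0 : 0 < K by apply: divr_gt0 => //; have := B0; lra.
exists (one_step P A (fun F v => atrunc K (phi (F v) - phi v))).
  apply: (@one_step_continuous _ _ _ P _ A tA _ (2 * K)) => //.
  - by move=> F tF; apply: trunc_step_continuous => //; exact: atrunc_continuous.
  - by move=> v; apply: trunc_step_meas; exact: atrunc_continuous.
  - by move=> F v; exact: atrunc_le.
move=> x; have [h1 h2] := HB x.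
rewrite (le_trans (Rintegral_atrunc K0 (incr_meas x) h1 h2))//.
have eK : e * K = 16 * B + 1 by rewrite /K mulrC divfK// gt_eqF.
by rewrite ler_pdivrMr// eK; lra.
Qed.

Definition chain_incr n (w : Omega) : R := phi (state A X0 n.+1 w) - phi (state A X0 n w).

Let mstate n := state_mvec tA rX0 (@init_start _ _ _ _ A X0) n.

Lemma phi_state_meas n : measurable_fun setT (fun w => phi (state A X0 n w)).
Proof.
apply: measurable_continuous_vec; first exact: mstate.
exact: topical_fun_continuous.
Qed.

Lemma chain_incr_meas n : measurable_fun setT (chain_incr n).
Proof. by apply: measurable_funB; exact: phi_state_meas. Qed.

Lemma chain_incr_transfer n (f : R -> R) M : continuous f -> (forall y, `|f y| <= M) ->
  \int[P]_w f (chain_incr n w) =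
  \int[P]_w one_step P A (fun F v => f (phi (F v) - phi v)) (state A X0 n w).
Proof.
move=> cf fM.
apply: (@transfer _ _ _ P _ A X0 tA rX0 iid X0 (@init_start _ _ _ _ A X0)
  (fun F v => f (phi (F v) - phi v)) M) => //.
- by move=> F tF; exact: trunc_step_continuous.
- by move=> v; exact: trunc_step_meas.
Qed.

Lemma chain_incr_sq n : P.-integrable setT (EFin \o (fun w => chain_incr n w ^+ 2)) /\
  \int[P]_w (chain_incr n w ^+ 2) <= B.
Proof.
apply: integrable_of_softcap.
- by apply: measurable_funX; exact: chain_incr_meas.
- by move=> w; exact: sqr_ge0.
move=> k; pose f (y : R) := softcap k (y ^+ 2).
have cf : continuous f.
  rewrite /f => y.
  apply: (@continuous_comp R R R (fun y => y ^+ 2) (softcap k) y).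
    exact: exprn_continuous.
  exact: softcap_continuous.
have fM y : `|f y| <= k.+1%:R by exact: softcap_lt.
rewrite -[X in X <= _]/(\int[P]_w f (chain_incr n w)) (chain_incr_transfer _ cf fM).
apply: le_Rintegral_prob.
  apply: bmf_integrable; split.
    apply: (@measurable_one_step_state _ _ _ P _ A X0 tA rX0 X0 (@init_start _ _ _ _ A X0) _ k.+1%:R) => //.
    - by move=> F tF; exact: trunc_step_continuous.
    - by move=> v; exact: trunc_step_meas.
  exists k.+1%:R => w; apply: (@one_step_le _ _ _ P _ A tA) => //.
  by move=> v; exact: trunc_step_meas.
move=> w; set x := state _ _ _ _; have [h1 h2] := HB x.
apply: le_trans h2; apply: le_Rintegral => //.
  apply: bmf_integrable; split; last by exists k.+1%:R.
  apply: (measurableT_comp _ (incr_meas x)); exact: continuous_measurable_fun.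
by move=> w' _; apply: softcap_le_id; exact: sqr_ge0.
Qed.

Lemma chain_incr_integrable n : P.-integrable setT (EFin \o chain_incr n).
Proof. by have [h1 h2] := chain_incr_sq n; exact: (sq_integrable_abs (chain_incr_meas n) h1 h2).1. Qed.

Lemma ler_forall_div (a b : R) : (forall K, 0 < K -> a <= b / K) -> a <= 0.
Proof.
move=> h; rewrite leNgt; apply/negP => a0.
have K0 : 0 < (`|b| + 1) / a by rewrite divr_gt0// ltr_wpDl.
have := h _ K0; rewrite invf_div mulrA mulrAC -ler_pdivrMr// divff ?gt_eqF//.
by rewrite ler_pdivlMr ?ltr_wpDl// mul1r; have := ler_norm b; lra.
Qed.

Lemma chain_incr_mean n : \int[P]_w chain_incr n w = \int[P]_w drift (state A X0 n w).
Proof.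
apply/eqP; rewrite -subr_eq0 -normr_le0; apply/(@ler_forall_div _ (32 * B)) => K K0.
have [h1 h2] := chain_incr_sq n.
have := Rintegral_atrunc K0 (chain_incr_meas n) h1 h2.
have tM y : `|atrunc K y| <= 2 * K by exact: atrunc_le.
rewrite (chain_incr_transfer _ (@atrunc_continuous _ K) tM).
set g := one_step _ _ _.
have bg : bmf (fun w => g (state A X0 n w)).
  split.
    apply: (@measurable_one_step_state _ _ _ P _ A X0 tA rX0 X0 (@init_start _ _ _ _ A X0) _ (2 * K)) => //.
    - by move=> F tF; apply: trunc_step_continuous => //; exact: atrunc_continuous.
    - by move=> v; apply: trunc_step_meas; exact: atrunc_continuous.
  exists (2 * K) => w; apply: (@one_step_le _ _ _ P _ A tA) => //.
  by move=> v; apply: trunc_step_meas; exact: atrunc_continuous.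
have bd : bmf (fun w => drift (state A X0 n w)).
  apply: (@cb_bmf _ _ _ _ (state A X0 n)); first exact: mstate.
  exact: drift_cb.
have : `|\int[P]_w drift (state A X0 n w) - \int[P]_w g (state A X0 n w)| <= 16 * B / K.
  rewrite -RintegralB//; try exact: bmf_integrable.
  apply: norm_Rintegral_prob_le; first by apply: bmf_integrable; exact: bmfB.
  move=> w; have [h3 h4] := HB (state A X0 n w).
  exact: (Rintegral_atrunc K0 (incr_meas _) h3 h4).
have -> : 32 * B / K = 16 * B / K + 16 * B / K by rewrite -mulrDl -mulrDl; congr (_ * _ / _); ring.
rewrite !ler_norml => /andP[? ?] /andP[? ?]; apply/andP; split; lra.
Qed.

End second_moment.

(** * Mean drift under the invariant measure *)

Section mean_drift.
Context {R : realType} {dO : measure_display} {Omega : measurableType dO}.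
Variables (P : probability Omega R) (d : nat).
Variables (A : nat -> Omega -> vec R d -> vec R d) (X0 : Omega -> vec R d).
Hypothesis tA : random_topical_ops A.
Hypothesis rX0 : random_vector X0.
Hypothesis iid : iid_and_indep P A X0.
Variable phi : vec R d -> R.
Hypothesis tphi : topical_fun phi.
Variable B : R.
Hypothesis B0 : 0 <= B.
Hypothesis HB : forall x, P.-integrable setT (EFin \o (fun w => incr A phi x w ^+ 2)) /\
    \int[P]_w (incr A phi x w ^+ 2) <= B.
Variable i0 : 'I_d.
Variable nu0 : probability (PRmax R d) R.
Hypothesis inv : invariant_measure P A nu0.
Variables (N : nat) (p : R).
Hypothesis p0 : 0 < p.
Hypothesis pE : P [set w | rank1 (prod_ops A N w)] = p%:E.

Let g := drift P A phi.
Let T := Top P A.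
Let cg : cb g := drift_cb tA tphi B0 HB.
Let sg : shinv g := drift_shinv P tA tphi.

(** The sum of the first [n] iterates of the drift under the Markov operator; [displacement_mean]
    identifies its mean at [X0] with the mean displacement of [phi] in [n] steps. *)
Fixpoint drift_sum (n : nat) (x : vec R d) : R :=
  if n is m.+1 then drift_sum m x + iter m (Top P A) (drift P A phi) x else 0.
Let W := drift_sum.

Lemma drift_sum_cb n : cb (W n).
Proof.
elim: n => [|n ih]; first exact: cb_cst.
exact: (cbD ih (cb_iter_Top P tA n cg)).
Qed.

Lemma drift_sum_shinv n : shinv (W n).
Proof.
elim: n => [//|n ih] x a /=.
by rewrite -/W ih -/g (shinv_iter_Top P tA n sg).
Qed.

Lemma iter_TopD n (f f' : vec R d -> R) x : cb f -> cb f' ->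
  iter n T (fun x => f x + f' x) x = iter n T f x + iter n T f' x.
Proof.
move=> cf cf'; elim: n x => [//|n ih] x /=.
rewrite -(TopD P tA x (cb_iter_Top P tA n cf) (cb_iter_Top P tA n cf')).
by congr (Top P A _ x); apply/funext => y; exact: ih.
Qed.

Lemma iter_Top_cst n (c : R) : iter n T (fun=> c) = fun=> c.
Proof. by elim: n => [//|n /= ->]; apply/funext => x; exact: Top_cst. Qed.

Lemma drift_sum_add n m x : W (n + m) x = W n x + iter n T (W m) x.
Proof.
elim: m x => [|m ih] x.
  rewrite addn0 -[LHS]addr0; congr (_ + _).
  by have /(congr1 (@^~ x)) /= -> := iter_Top_cst n 0.
rewrite addnS.
change (W (n + m) x + iter (n + m) T g x = W n x + iter n T (fun x => W m x + iter m T g x) x).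
rewrite ih -addrA; congr (_ + _).
by rewrite iter_TopD -?iterD//; [exact: drift_sum_cb | exact: (cb_iter_Top P tA m cg)].
Qed.

Lemma drift_abs x : `|g x| <= 1 + B.
Proof.
rewrite (le_trans (le_normr_Rintegral _ (incr_integrable tA tphi HB x)))//.
exact: (incr_abs tA tphi HB).
Qed.

Lemma drift_sum_abs n x : `|W n x| <= n%:R * (1 + B).
Proof.
elim: n x => [|n ih] x; first by rewrite normr0 mul0r.
rewrite /= -/W (le_trans (ler_normD _ _))// -natr1 mulrDl mul1r lerD//.
elim: n x {ih} => [|n ih] x; first exact: drift_abs.
apply: (Top_bound P tA _ ih); exact: (cb_iter_Top P tA n cg).
Qed.

(** The fixed point of [D = 2 N (1 + B) + (1 - p) D]: an oscillation bound by [D] survives one more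
    block of [N] steps, of which the first term is the cost and the second the contracted
    remainder. *)
Definition drift_osc := 2 * N%:R * (1 + B) / p.
Let D := drift_osc.

Lemma drift_osc_ge0 : 0 <= D.
Proof.
by apply: divr_ge0; [apply: mulr_ge0; [apply: mulr_ge0 | apply: addr_ge0] | exact: ltW].
Qed.

Lemma drift_sum_osc j x y : W (j * N) x - W (j * N) y <= D.
Proof.
elim: j x y => [|j ih] x y; first by rewrite mul0n /W/= subr0 drift_osc_ge0.
rewrite mulSn !drift_sum_add.
have h := doeblin_contraction tA rX0 iid pE (drift_sum_cb (j * N)) (drift_sum_shinv (j * N))
  drift_osc_ge0 ih x y.
have := drift_sum_abs N x; have := drift_sum_abs N y.
have pD : p * D = 2 * N%:R * (1 + B) by rewrite /D /drift_osc mulrC divfK// gt_eqF.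
rewrite !ler_norml => /andP[? ?] /andP[? ?]; rewrite -/T in h; lra.
Qed.

Definition mean_drift := \int[nu0]_x g x.

Lemma nu_iter_Top n f : cb f -> shinv f -> \int[nu0]_x iter n T f x = \int[nu0]_x f x.
Proof.
move=> cf sf; elim: n => [//|n ih] /=; rewrite -ih.
by apply: (nu_Top tA i0 inv); [exact: cb_iter_Top | exact: shinv_iter_Top].
Qed.

Lemma nu_drift_sum n : \int[nu0]_x W n x = n%:R * mean_drift.
Proof.
elim: n => [|n ih]; first by rewrite mul0r; exact: Rintegral_prob_cst.
rewrite /= RintegralD//.
- by rewrite -/W ih nu_iter_Top// -natr1 mulrDl mul1r.
- by apply: bmf_integrable; apply: (bmf_PR i0); [exact: drift_sum_cb | exact: drift_sum_shinv].
- apply: bmf_integrable; apply: (bmf_PR i0).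
    exact: (cb_iter_Top P tA n cg).
  exact: (shinv_iter_Top P tA n sg).
Qed.

Lemma nu_osc f b x : cb f -> shinv f -> (forall x y, f x - f y <= b) ->
  `|f x - \int[nu0]_y f y| <= b.
Proof.
move=> cf sf fb; have bf := bmf_PR i0 cf sf.
have fi := bmf_integrable nu0 bf.
rewrite ler_norml; apply/andP; split.
  suff : \int[nu0]_y f y <= f x + b by lra.
  by apply: le_Rintegral_prob => // y; have := fb y x; lra.
suff : f x - b <= \int[nu0]_y f y by lra.
by apply: ge_Rintegral_prob => // y; have := fb x y; lra.
Qed.

Lemma drift_sum_dist j x : `|W (j * N) x - (j * N)%:R * mean_drift| <= D.
Proof.
rewrite -nu_drift_sum; apply: nu_osc; [exact: drift_sum_cb|exact: drift_sum_shinv|].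
exact: drift_sum_osc.
Qed.

Definition displacement n w : R := phi (state A X0 n w) - phi (X0 w).

Lemma displacementS n w : displacement n.+1 w = displacement n w + chain_incr A X0 phi n w.
Proof. by rewrite /displacement /chain_incr; ring. Qed.

Lemma displacement_meas n : measurable_fun setT (displacement n).
Proof.
by apply: measurable_funB; [exact: (phi_state_meas tA rX0 tphi n) | exact: (phi_state_meas tA rX0 tphi 0)].
Qed.

Lemma displacement_integrable n : P.-integrable setT (EFin \o displacement n).
Proof.
elim: n => [|n ih].
  have -> : displacement 0 = fun=> 0 by apply/funext => w; rewrite /displacement subrr.
  by apply: bmf_integrable; exact: bmf_cst.
have := integrableD measurableT ih (chain_incr_integrable tA rX0 iid tphi HB n).
by congr (_.-integrable _ _); apply/funext => w /=; rewrite displacementS EFinD.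
Qed.

Lemma displacement_mean n : \int[P]_w displacement n w = \int[P]_w W n (X0 w).
Proof.
elim: n => [|n ih].
  by apply: eq_Rintegral => w _; rewrite /displacement subrr.
under eq_Rintegral do rewrite displacementS.
rewrite RintegralD//; [|exact: displacement_integrable|exact: (chain_incr_integrable tA rX0 iid tphi HB n)].
rewrite ih (chain_incr_mean tA rX0 iid tphi B0 HB).
have := state_iter_Top tA rX0 iid (@init_start _ _ _ _ A X0) n 0 cg.
rewrite addn0 -/g => ->; rewrite /= RintegralD//.
- apply: bmf_integrable; apply: (bmf_state tA rX0 (@init_start _ _ _ _ A X0) 0).
  exact: drift_sum_cb.
- apply: bmf_integrable; apply: (bmf_state tA rX0 (@init_start _ _ _ _ A X0) 0).
  exact: (cb_iter_Top P tA n cg).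
Qed.

Lemma displacement_sq n : P.-integrable setT (EFin \o (fun w => displacement n w ^+ 2)) /\
  \int[P]_w (displacement n w ^+ 2) <= n%:R ^+ 2 * B.
Proof.
elim: n => [|n [ih1 ih2]].
  have -> : (fun w => displacement 0 w ^+ 2) = cst 0.
    by apply/funext => w; rewrite /displacement subrr expr0n.
  split; first by apply: bmf_integrable; exact: bmf_cst.
  by rewrite Rintegral_prob_cst mulr_ge0// sqr_ge0.
have [h1 h2] := chain_incr_sq tA rX0 iid tphi HB n.
case: n => [|n] in ih1 ih2 h1 h2 *.
  have -> : displacement 1 = chain_incr A X0 phi 0.
    by apply/funext => w; rewrite displacementS /displacement subrr add0r.
  by rewrite expr1n mul1r.
(* The weight of Young's inequality, chosen so that [(1 + 1/c) c^2 + (1 + c) = (c + 1)^2]: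
   Minkowski's inequality without square roots. *)
pose c : R := n.+1%:R.
have c0 : 0 < c by rewrite ltr0n.
have le w : displacement n.+2 w ^+ 2 <=
    (1 + c^-1) * displacement n.+1 w ^+ 2 + (1 + c) * chain_incr A X0 phi n.+1 w ^+ 2.
  rewrite displacementS; set a := displacement _ _; set b := chain_incr _ _ _ _ _.
  have : 0 <= c^-1 * (a - c * b) ^+ 2 by rewrite mulr_ge0 ?sqr_ge0// invr_ge0 ltW.
  have -> : c^-1 * (a - c * b) ^+ 2 = c^-1 * a ^+ 2 - 2 * a * b + c * b ^+ 2.
    by field; rewrite gt_eqF.
  rewrite -[in X in _ -> X]subr_ge0.
  by congr (0 <= _); ring.
have i1 := integrableZl measurableT (1 + c^-1) ih1.
have i2 := integrableZl measurableT (1 + c) h1.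
have i3 := integrableD measurableT i1 i2.
have int : P.-integrable setT (EFin \o (fun w => displacement n.+2 w ^+ 2)).
  apply: le_integrable i3 => //.
    by apply/measurable_EFinP; apply: measurable_funX; exact: displacement_meas.
  move=> w _ /=; rewrite lee_fin ger0_norm ?sqr_ge0//.
  by rewrite (le_trans (le w))// ler_norm.
split => //.
apply: (@le_trans _ _ (\int[P]_w ((1 + c^-1) * displacement n.+1 w ^+ 2 + (1 + c) * chain_incr A X0 phi n.+1 w ^+ 2))).
  by apply: le_Rintegral.
rewrite RintegralD// !RintegralZl//.
have e1 : (1 + c^-1) * \int[P]_w (displacement n.+1 w ^+ 2) <= (1 + c^-1) * (c ^+ 2 * B).
  by rewrite ler_wpM2l// addr_ge0// invr_ge0 ltW.
have e2 : (1 + c) * \int[P]_w (chain_incr A X0 phi n.+1 w ^+ 2) <= (1 + c) * B.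
  by rewrite ler_wpM2l// addr_ge0// ltW.
rewrite (le_trans (lerD e1 e2))// -[n.+2%:R]natr1 -/c.
have -> : (1 + c^-1) * (c ^+ 2 * B) + (1 + c) * B = (c + 1) ^+ 2 * B by field; rewrite gt_eqF.
by [].
Qed.

End mean_drift.

(** * Lyapunov exponent, correctors and occupation *)

Section renewal_bound.
Context {R : realType} {dO : measure_display} {Omega : measurableType dO}.
Variables (P : probability Omega R) (d : nat).
Variables (A : nat -> Omega -> vec R d -> vec R d) (X0 : Omega -> vec R d).
Hypothesis tA : random_topical_ops A.
Hypothesis rX0 : random_vector X0.
Hypothesis iid : iid_and_indep P A X0.
Variable phi : vec R d -> R.
Hypothesis tphi : topical_fun phi.
Variable B : R.
Hypothesis B0 : 0 <= B.
Hypothesis HB : forall x, P.-integrable setT (EFin \o (fun w => incr A phi x w ^+ 2)) /\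
    \int[P]_w (incr A phi x w ^+ 2) <= B.
Variable i0 : 'I_d.
Variable nu0 : probability (PRmax R d) R.
Hypothesis inv : invariant_measure P A nu0.
Variables (N : nat) (p : R).
Hypothesis p0 : 0 < p.
Hypothesis pE : P [set w | rank1 (prod_ops A N w)] = p%:E.

Let g := drift P A phi.
Let T := Top P A.

Let W := drift_sum P A phi.
Let D := drift_osc B N p.
Hypothesis N0 : (0 < N)%N.

Let sdist j x : `|W (j * N) x - (j * N)%:R * mean_drift P A phi nu0| <= D.
Proof. exact: (drift_sum_dist tA rX0 iid tphi B0 HB i0 inv p0 pE). Qed.

(** Homogeneity makes [phi 0 + n gamma] the value of [phi] at the constant vector [n gamma], from
    which [u n] is at distance [o(n)]; and [phi] is 1-Lipschitz. *)
Lemma phi_cvg_ratio (u : nat -> vec R d) (gamma : R) :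
  (forall i, u n 0 i / n%:R @[n --> \oo] --> gamma) ->
  phi (u n) / n%:R @[n --> \oo] --> gamma.
Proof.
move=> ucv; apply/cvgrPdist_lt => e e0.
have e2 : 0 < e / 2 by rewrite divr_gt0.
have h : \forall n \near \oo, forall i, `|gamma - u n 0 i / n%:R| < e / 2.
  apply: filter_forall => i.
  by move/cvgrPdist_lt : (ucv i) => /(_ _ e2).
near=> n.
have n0 : 0 < n%:R :> R by rewrite ltr0n; near: n; exists 1%N.
have hn : forall i, `|gamma - u n 0 i / n%:R| < e / 2 by near: n.
have h1 : `|phi (u n) - phi 0 - n%:R * gamma| <= n%:R * (e / 2).
  have -> : phi (u n) - phi 0 - n%:R * gamma = phi (u n) - phi (vshift 0 (n%:R * gamma)).
    by rewrite tphi.2; ring.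
  rewrite (le_trans (topical_fun_lip _ _ tphi))//; apply: vec_norm_le => [|i].
    by rewrite mulr_ge0 ?ltW.
  rewrite !mxE add0r distrC.
  have -> : n%:R * gamma - u n 0 i = n%:R * (gamma - u n 0 i / n%:R).
    by field; rewrite gt_eqF.
  by rewrite normrM gtr0_norm// ler_wpM2l// ltW.
have h2 : `|phi 0| < n%:R * (e / 2).
  rewrite -ltr_pdivrMr//; near: n.
  exists (Num.truncn (`|phi 0| / (e / 2))).+1 => // n /= kn.
  by rewrite (lt_le_trans (truncnS_gt _))// ler_nat.
have -> : gamma - phi (u n) / n%:R = - ((phi (u n) - phi 0 - n%:R * gamma) + phi 0) / n%:R.
  by field; rewrite gt_eqF.
rewrite normrM normrN normfV (gtr0_norm n0) ltr_pdivrMr//.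
rewrite (le_lt_trans (ler_normD _ _))//.
have -> : e * n%:R = n%:R * (e / 2) + n%:R * (e / 2) by field.
exact: ler_ltD.
Unshelve. all: by end_near. Qed.

Lemma displacement_cvg gamma : lyapunov_exponent P A X0 gamma ->
  {ae P, forall w, displacement A X0 phi n w / n%:R @[n --> \oo] --> gamma}.
Proof.
apply: filterS => w hw.
have h := @phi_cvg_ratio (fun n => state A X0 n w) gamma hw.
have -> : (fun n => displacement A X0 phi n w / n%:R) =
    (fun n => phi (state A X0 n w) / n%:R - phi (X0 w) / n%:R).
  by apply/funext => n; rewrite /displacement mulrBl.
have -> : gamma = gamma - phi (X0 w) * 0 by rewrite mulr0 subr0.
apply: cvgB; first exact: h.
apply: cvgM; first exact: cvg_cst.
apply/cvgrPdist_lt => e e0; near=> n.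
have n0 : 0 < n%:R :> R by rewrite ltr0n; near: n; exists 1%N.
rewrite sub0r normrN ger0_norm ?invr_ge0//.
rewrite -[ltRHS]invrK ltf_pV2 ?posrE// ?invr_gt0//; near: n.
exists (Num.truncn (e^-1)).+1 => // n /= kn.
by rewrite (lt_le_trans (truncnS_gt _))// ler_nat.
Unshelve. all: by end_near. Qed.

(** Bounded second moments turn the almost sure limit [gamma] of displacement over time into a limit
    of means: [atrunc K] gives it up to an error of order [1 / K]. Along multiples of [N] the same
    means converge to [mean_drift], because [drift_sum] stays within a constant of its linear
    part. *)
Lemma lyapunov_mean_drift gamma : lyapunov_exponent P A X0 gamma ->
  mean_drift P A phi nu0 = gamma.
Proof.
move=> /displacement_cvg Zcv; set mu := mean_drift _ _ _ _.
pose Z n w := displacement A X0 phi n w / n%:R.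
have mZ n : measurable_fun setT (Z n).
  by apply: measurable_funM; [exact: (displacement_meas tA rX0 tphi) | exact: measurable_cst].
have Z2 n : P.-integrable setT (EFin \o (fun w => Z n.+1 w ^+ 2)) /\ \int[P]_w (Z n.+1 w ^+ 2) <= B.
  have [h1 h2] := displacement_sq tA rX0 iid tphi B0 HB n.+1.
  have -> : (fun w => Z n.+1 w ^+ 2) = (fun w => (n.+1%:R ^+ 2)^-1 * displacement A X0 phi n.+1 w ^+ 2).
    by apply/funext => w; rewrite /Z expr_div_n mulrC.
  split; first by have := integrableZl measurableT (n.+1%:R ^+ 2)^-1 h1.
  rewrite RintegralZl// mulrC ler_pdivrMr ?exprn_gt0// mulrC//.
have bt K n : 0 < K -> bmf (fun w => atrunc K (Z n w)).
  move=> K0; split; last by exists (2 * K) => w; exact: atrunc_le.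
  by apply: (measurableT_comp _ (mZ n)); apply: continuous_measurable_fun; exact: atrunc_continuous.
have key K : 0 < K -> `|atrunc K gamma - mu| <= 16 * B / K.
  move=> K0; apply/ler_addgt0Pr => e e0.
  have c : \int[P]_w atrunc K (Z n w) @[n --> \oo] --> atrunc K gamma.
    rewrite -[X in _ --> X](Rintegral_prob_cst P).
    apply: (@bmf_dominated _ _ _ P _ _ (2 * K)) => //.
    - by move=> n; exact: (bt K n K0).1.
    - by move=> n w; exact: atrunc_le.
    - apply: filterS Zcv => w Zw.
      by apply: (@continuous_cvg _ _ _ \oo _ (Z^~ w) (atrunc K) gamma _ Zw); exact: atrunc_continuous.
  have e2 : 0 < e / 2 by rewrite divr_gt0.
  have [n0 _ hn0] : \forall n \near \oo, `|atrunc K gamma - \int[P]_w atrunc K (Z n w)| < e / 2.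
    by move/cvgrPdist_lt : c => /(_ _ e2).
  (* The time [j * N] lies beyond [n0] and is large enough for [D / (j * N)] to be at most
     [e / 2]. *)
  pose j := (n0 + Num.truncn (D / (e / 2))).+1.
  have jN : (j <= j * N)%N by rewrite leq_pmulr.
  have jN0 : (0 < j * N)%N by rewrite (leq_trans _ jN).
  have h1 : `|atrunc K gamma - \int[P]_w atrunc K (Z (j * N) w)| < e / 2.
    by apply: hn0 => /=; rewrite (leq_trans _ jN)// /j -addSn leqW// leq_addr.
  have [z1 z2] := Z2 (j * N).-1; rewrite prednK// in z1 z2.
  have h2 := Rintegral_atrunc K0 (mZ _) z1 z2.
  have jR : 0 < (j * N)%:R :> R by rewrite ltr0n.
  have h3 : `|\int[P]_w Z (j * N) w - mu| <= e / 2.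
    have -> : \int[P]_w Z (j * N) w = (j * N)%:R^-1 * \int[P]_w W (j * N) (X0 w).
      rewrite -(displacement_mean tA rX0 iid tphi B0 HB).
      rewrite -RintegralZl//; last exact: (displacement_integrable tA rX0 iid tphi HB).
      by apply: eq_Rintegral => w _; rewrite /Z mulrC.
    have -> : (j * N)%:R^-1 * \int[P]_w W (j * N) (X0 w) - mu =
        (\int[P]_w W (j * N) (X0 w) - (j * N)%:R * mu) / (j * N)%:R.
      by rewrite mulrBl [_ * mu / _]mulrAC mulfV ?gt_eqF// mul1r mulrC.
    rewrite normrM normfV (gtr0_norm jR) ler_pdivrMr//.
    apply: (@le_trans _ _ D).
      have bW : bmf (fun w => W (j * N) (X0 w)).
        apply: (bmf_state tA rX0 (@init_start _ _ _ _ A X0) 0).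
        exact: (drift_sum_cb tA tphi B0 HB).
      have -> : \int[P]_w W (j * N) (X0 w) - (j * N)%:R * mu =
          \int[P]_w (W (j * N) (X0 w) + - ((j * N)%:R * mu)).
        by rewrite Rintegral_prob_addr.
      apply: norm_Rintegral_prob_le => [|w]; last exact: sdist.
      by apply: bmf_integrable; apply: bmfD => //; exact: bmf_cst.
    rewrite mulrC -ler_pdivrMr// ltW// (lt_le_trans (truncnS_gt _))// ler_nat.
    by rewrite (leq_trans _ jN)// /j ltnS leq_addl.
  have : `|atrunc K gamma - mu| <= `|atrunc K gamma - \int[P]_w atrunc K (Z (j * N) w)| +
     `|\int[P]_w Z (j * N) w - \int[P]_w atrunc K (Z (j * N) w)| + `|\int[P]_w Z (j * N) w - mu|.
    set a := \int[P]_w atrunc K (Z (j * N) w); set b := \int[P]_w Z (j * N) w.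
    have -> : atrunc K gamma - mu = (atrunc K gamma - a) - (b - a) + (b - mu) by ring.
    by rewrite (le_trans (ler_normD _ _))// lerD// ler_normB.
  by move=> h4; move: h1 h2 h3 h4; lra.
apply/eqP; rewrite -subr_eq0 -normr_le0; apply/(@ler_forall_div _ _ (16 * B + 16 * gamma ^+ 2)) => K K0.
have := key K K0; have := atrunc_dist gamma K0.
rewrite mulrDl => h1 h2.
have -> : mu - gamma = - ((gamma - atrunc K gamma) + (atrunc K gamma - mu)) by ring.
rewrite normrN (le_trans (ler_normD _ _))//; lra.
Qed.

(** An approximate solution of the Poisson equation. Since [T] maps [drift_sum m] to
    [drift_sum m.+1 - g], the sum telescopes under [T], and for [u = corrector_sum n / n] one gets
    [g + T u - u = drift_sum n / n]: the drift is replaced by its average over [n] steps. *)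
Fixpoint corrector_sum (n : nat) (x : vec R d) : R :=
  if n is m.+1 then corrector_sum m x + drift_sum P A phi m x else 0.
Let C := corrector_sum.

Lemma corrector_sum_cb n : cb (C n).
Proof.
elim: n => [|n ih]; first exact: cb_cst.
exact: (cbD ih (drift_sum_cb tA tphi B0 HB n)).
Qed.

Lemma Top_corrector_sum n x : T (C n) x = C n x + W n x - n%:R * g x.
Proof.
elim: n => [|n ih]; first by rewrite [LHS](Top_cst P A 0 x) /W /=; ring.
have -> : C n.+1 = fun x => C n x + W n x by [].
rewrite [LHS](TopD P tA x (corrector_sum_cb n) (drift_sum_cb tA tphi B0 HB n)).
rewrite -/T -/C -/W ih.
have e : W n.+1 x = g x + T (W n) x.
  by rewrite /W -add1n (drift_sum_add tA tphi B0 HB) /= add0r.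
have -> : T (W n) x = W n.+1 x - g x by rewrite e; ring.
by rewrite -natr1; ring.
Qed.

Hypothesis mu0 : 0 < mean_drift P A phi nu0.

(** The drift is positive only in the mean and may be negative at some points. The corrected drift
    is an average over [j * N] steps, within [D / (j * N)] of the mean drift everywhere, so it has a
    positive lower bound at every point. *)
Lemma exists_corrector : exists u : vec R d -> R, cb u /\
  forall x, mean_drift P A phi nu0 / 2 <= g x + T u x - u x.
Proof.
set mu := mean_drift _ _ _ _; have mu0' : 0 < mu by exact: mu0.
pose j := (Num.truncn (D / (mu / 2))).+1.
have jN0 : (0 < j * N)%N by rewrite muln_gt0 N0.
have jR : 0 < (j * N)%:R :> R by rewrite ltr0n.
exists (fun x => (j * N)%:R^-1 * C (j * N) x); split.
  by apply: cbZ; exact: corrector_sum_cb.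
move=> x; rewrite [T _ x](TopZ P tA _ x (corrector_sum_cb (j * N))) -/T Top_corrector_sum.
have fieldE (c q G r : R) : r != 0 -> G + r^-1 * (c + q - r * G) - r^-1 * c = q / r.
  by move=> r0; field.
set c := C _ _; set q := W _ _; set G := g x; set r : R := (j * N)%:R in jR *.
have -> : G + r^-1 * (c + q - r * G) - r^-1 * c = q / r.
  by rewrite fieldE ?gt_eqF.
rewrite ler_pdivlMr//.
have := sdist j x; rewrite -/q -/mu ler_norml => /andP[h _].
have h2 : D <= (j * N)%:R * (mu / 2).
  rewrite -ler_pdivrMr ?divr_gt0// ltW// (lt_le_trans (truncnS_gt _))// ler_nat.
  by rewrite -/j leq_pmulr.
have -> : mu / 2 * (j * N)%:R = (j * N)%:R * mu - (j * N)%:R * (mu / 2) by field.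
lra.
Qed.

Definition weight (a : R) (x : vec R d) : R := (1 + (phi x - a) ^+ 2)^-1.

Lemma inv_sqr_den (y : R) : 0 < 1 + y ^+ 2.
Proof. by have := sqr_ge0 y; lra. Qed.

Lemma inv_sqr_le1 (y : R) : 0 <= (1 + y ^+ 2)^-1 <= 1.
Proof.
have y0 := inv_sqr_den y; rewrite invr_ge0 ltW//=.
by rewrite invf_le1//; have := sqr_ge0 y; lra.
Qed.

Lemma weight_continuous a : continuous (weight a).
Proof.
have cphi := topical_fun_continuous tphi.
rewrite /weight => x.
apply: (@continuous_comp _ _ _ (fun x => phi x - a) (fun y => (1 + y ^+ 2)^-1) x).
  exact: (@continuousB _ _ _ phi (fun=> a) x (cphi x) (@cst_continuous _ _ a x)).
apply: (@continuousV R R (fun y : R => 1 + y ^+ 2) (phi x - a)).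
  by rewrite gt_eqF// inv_sqr_den.
apply: cvgD; first exact: cvg_cst.
exact: exprn_continuous.
Qed.

Lemma weight_cb a : cb (weight a).
Proof.
split; first exact: weight_continuous.
by exists 1 => x; rewrite /weight ger0_norm; have /andP[] := inv_sqr_le1 (phi x - a).
Qed.

(** The function [atan ((phi + u - a) / L)] is bounded, and from every point it grows in mean by at
    least [k0 * (1 + S ^+ 2)^-1]. Summing the growths telescopes, whence a bound that depends
    neither on [a] nor on [n]. *)
Lemma occupation_bound : exists Cst, forall a n,
  \sum_(k < n) \int[P]_w weight a (state A X0 k w) <= Cst.
Proof.
have [u [cu hu]] := exists_corrector.
have [cont_u [U uU]] := cu.
have U0 : 0 <= U by rewrite (le_trans _ (uU 0)).
have mu_gt0 := mu0; move: mu_gt0 hu; set mu := mean_drift _ _ _ _ => mu_gt0 hu.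
have cphi := topical_fun_continuous tphi.
(* The increment of [phi + u]: its mean is at least [mu / 2] from every start, and its second moment
   is still bounded. *)
pose eta x w : R := incr A phi x w + (u (A 1 w x) - u x).
have bu x : bmf (fun w => u (A 1 w x) - u x).
  by apply: bmfB; [exact: (bmf_cb_op tA 1 x cu) | exact: bmf_cst].
have meta x : measurable_fun setT (eta x).
  by apply: measurable_funD; [exact: (incr_meas tA tphi) | exact: (bu x).1].
pose B' := 2 * B + 8 * U ^+ 2.
have B'0 : 0 <= B' by rewrite addr_ge0// mulr_ge0// sqr_ge0.
have eta2 x : P.-integrable setT (EFin \o (fun w => eta x w ^+ 2)) /\ \int[P]_w (eta x w ^+ 2) <= B'.
  have [h1 h2] := HB x.
  have le w : eta x w ^+ 2 <= 2 * incr A phi x w ^+ 2 + 8 * U ^+ 2.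
    rewrite /eta; set b := u _ - u _; set c := incr _ _ _ _.
    have bU : b ^+ 2 <= 4 * U ^+ 2.
      have -> : 4 * U ^+ 2 = (2 * U) ^+ 2 by ring.
      rewrite -(real_normK (num_real b)) ler_pXn2r ?nnegrE ?mulr_ge0//.
      rewrite (le_trans (ler_normB _ _))//.
      by have := uU (A 1 w x); have := uU x; lra.
    have e : (c + b) ^+ 2 = 2 * c ^+ 2 + 2 * b ^+ 2 - (c - b) ^+ 2 by ring.
    by rewrite e; have := sqr_ge0 (c - b); lra.
  have i1 := integrableZl measurableT 2 h1.
  have i2 := integrableD measurableT i1 (bmf_integrable P (bmf_cst (8 * U ^+ 2))).
  have i3 : P.-integrable setT (EFin \o (fun w => eta x w ^+ 2)).
    apply: le_integrable i2 => //.
      by apply/measurable_EFinP; apply: measurable_funX.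
    move=> w _ /=; rewrite lee_fin ger0_norm ?sqr_ge0//.
    by rewrite (le_trans (le w))// ler_norm.
  split => //.
  apply: (@le_trans _ _ (\int[P]_w (2 * incr A phi x w ^+ 2 + 8 * U ^+ 2))).
    by apply: le_Rintegral.
  rewrite RintegralD//; last by apply: bmf_integrable; exact: bmf_cst.
  rewrite RintegralZl// Rintegral_prob_cst /B'; lra.
have eta1 x : P.-integrable setT (EFin \o eta x).
  by have [h1 h2] := eta2 x; exact: (sq_integrable_abs (meta x) h1 h2).1.
have meaneta x : mu / 2 <= \int[P]_w eta x w.
  rewrite RintegralD//; last 2 first.
  - exact: (incr_integrable tA tphi HB x).
  - by apply: bmf_integrable.
  rewrite RintegralB//; last 2 first.
  - by apply: bmf_integrable; exact: (bmf_cb_op tA 1 x cu).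
  - by apply: bmf_integrable; exact: bmf_cst.
  by rewrite Rintegral_prob_cst; have := hu x; rewrite /g /T /drift /Top; lra.
(* At this scale the quadratic loss in [atan_expansion], at most [16 * B' / L], eats no more than
   half of the gain [mu / 2]; the rest gives [k0]. *)
pose L := 1 + 64 * B' / mu.
have L1 : 1 <= L by rewrite lerDl divr_ge0// ?mulr_ge0// ltW.
have L0 : 0 < L by lra.
have LB : 16 * B' / L <= mu / 4.
  rewrite ler_pdivrMr//.
  have -> : mu / 4 * L = mu / 4 + 16 * B' by rewrite /L; field; rewrite gt_eqF.
  by rewrite lerDr divr_ge0// ltW.
pose S a x : R := (phi x + u x - a) / L.
pose f a x : R := atan (S a x).
have cS a : continuous (S a).
  move=> x; apply: (@continuousM _ _ (fun x => phi x + u x - a) (fun=> L^-1) x);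
    last exact: cst_continuous.
  apply: (@continuousB _ _ _ (fun x => phi x + u x) (fun=> a) x); last exact: cst_continuous.
  exact: (@continuousD _ _ _ phi u x (cphi x) (cont_u x)).
have cf a : cb (f a).
  split; last by exists 2 => x; exact: atan_abs_le2.
  move=> x; apply: (@continuous_comp _ _ _ (S a) atan x); first exact: cS.
  exact: continuous_atan.
pose k0 := mu / (4 * L).
have k00 : 0 < k0 by rewrite divr_gt0// mulr_gt0.
have step a x : k0 * (1 + S a x ^+ 2)^-1 <= T (f a) x - f a x.
  set s := S a x; set q := (1 + s ^+ 2)^-1.
  have q0 : 0 <= q by have /andP[] := inv_sqr_le1 s.
  have [h1 h2] := eta2 x.
  have i1 := integrableZl measurableT (q / L) (eta1 x).
  have i2 := integrableZl measurableT (16 * q / L ^+ 2) h1.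
  have i3 := integrableB measurableT i1 i2.
  have b3 : bmf (fun w => f a (A 1 w x) - f a x).
    by apply: bmfB; [exact: (bmf_cb_op tA 1 x (cf a)) | exact: bmf_cst].
  have -> : T (f a) x - f a x = \int[P]_w (f a (A 1 w x) - f a x).
    rewrite RintegralB ?Rintegral_prob_cst//.
    - by apply: bmf_integrable; exact: (bmf_cb_op tA 1 x (cf a)).
    - by apply: bmf_integrable; exact: bmf_cst.
  apply: (@le_trans _ _ (\int[P]_w (q / L * eta x w - 16 * q / L ^+ 2 * eta x w ^+ 2))).
    rewrite RintegralB// !RintegralZl//.
    apply: (@le_trans _ _ (q / L * (mu / 2) - 16 * q / L ^+ 2 * B')); last first.
      apply: lerB; apply: ler_wpM2l => //; first by rewrite divr_ge0// ltW.
      by apply: divr_ge0; [exact: mulr_ge0 | exact: sqr_ge0].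
    have -> : k0 * q = q / L * (mu / 4) by rewrite /k0; field; rewrite gt_eqF.
    have -> : q / L * (mu / 2) - 16 * q / L ^+ 2 * B' = q / L * (mu / 2 - 16 * B' / L).
      by field; rewrite gt_eqF.
    by apply: ler_wpM2l; [rewrite divr_ge0// ltW | lra].
  apply: le_Rintegral => //.
    exact: bmf_integrable.
  move=> w _; have := atan_expansion s (eta x w / L).
  have -> : s + eta x w / L = S a (A 1 w x).
    by rewrite /s /S /eta /incr; field; rewrite gt_eqF.
  rewrite -/(f a _) -/(f a x) -/q => h; apply: le_trans h.
  by rewrite le_eqVlt; apply/orP; left; apply/eqP; field; rewrite gt_eqF.
(* As [L >= 1] and [u] is bounded by [U], [1 + S a x ^+ 2] is at most [C1] times
   [1 + (phi x - a) ^+ 2]. *)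
pose C1 := 2 + 2 * U ^+ 2.
have C10 : 0 < C1 by rewrite ltr_pwDl// mulr_ge0// sqr_ge0.
have wle a x : weight a x <= C1 * (1 + S a x ^+ 2)^-1.
  rewrite /weight -[leLHS]mul1r ler_pdivrMr ?inv_sqr_den// mulrAC ler_pdivlMr ?inv_sqr_den// mul1r.
  have sle : S a x ^+ 2 <= (phi x + u x - a) ^+ 2.
    rewrite /S expr_div_n ler_pdivrMr ?exprn_gt0//.
    by rewrite ler_peMr ?sqr_ge0// expr2; nra.
  have uu : u x ^+ 2 <= U ^+ 2.
    by rewrite -(real_normK (num_real (u x))) ler_pXn2r ?nnegrE.
  have e : (phi x + u x - a) ^+ 2 = 2 * (phi x - a) ^+ 2 + 2 * u x ^+ 2 - (phi x - a - u x) ^+ 2 by ring.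
  rewrite e in sle.
  have gen (s2 v z u2 t : R) : 0 <= z -> 0 <= v -> 0 <= t -> u2 <= z ->
      s2 <= 2 * v + 2 * u2 - t -> 1 + s2 <= (2 + 2 * z) * (1 + v).
    by move=> z0 v0 t0 uz st; have := mulr_ge0 z0 v0; lra.
  by apply: gen uu sle; exact: sqr_ge0.
exists (C1 / k0 * 4) => a n.
have sw m : bmf (fun w => weight a (state A X0 m w)).
  exact: (bmf_state tA rX0 (@init_start _ _ _ _ A X0) m (weight_cb a)).
have sf m : bmf (fun w => f a (state A X0 m w)).
  exact: (bmf_state tA rX0 (@init_start _ _ _ _ A X0) m (cf a)).
have sTf m : bmf (fun w => T (f a) (state A X0 m w)).
  exact: (bmf_state tA rX0 (@init_start _ _ _ _ A X0) m (cb_Top P tA (cf a))).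
have one m : \int[P]_w weight a (state A X0 m w) <=
   C1 / k0 * (\int[P]_w f a (state A X0 m.+1 w) - \int[P]_w f a (state A X0 m w)).
  rewrite (state_Top tA rX0 iid (@init_start _ _ _ _ A X0) m (cf a)) -/T.
  rewrite -RintegralB//; try exact: bmf_integrable.
  rewrite -RintegralZl//; last by apply: bmf_integrable; exact: bmfB.
  apply: le_Rintegral => //; try exact: bmf_integrable.
    by apply: bmf_integrable; apply: bmfM; [exact: bmf_cst | exact: bmfB].
  move=> w _; rewrite (le_trans (wle _ _))// -mulrA ler_pM2l// mulrC ler_pdivlMr// mulrC.
  exact: step.
have tele : \sum_(k < n) \int[P]_w weight a (state A X0 k w) <=
   C1 / k0 * (\int[P]_w f a (state A X0 n w) - \int[P]_w f a (state A X0 0 w)).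
  elim: n => [|n ih]; first by rewrite big_ord0 subrr mulr0.
  rewrite big_ord_recr /=; have := one n; move: ih.
  set a1 := \sum_(i < n) _; set a2 := \int[P]_w f a (state A X0 0 w).
  set a3 := \int[P]_w f a (state A X0 n w); set a4 := \int[P]_w f a (state A X0 n.+1 w).
  set c := C1 / k0; rewrite !mulrBr; lra.
rewrite (le_trans tele)// ler_wpM2l//; first by rewrite divr_ge0// ltW.
have b2 m : `|\int[P]_w f a (state A X0 m w)| <= 2.
  by apply: norm_Rintegral_prob_le => [|w]; [exact: bmf_integrable | exact: atan_abs_le2].
have := b2 n; have := b2 0%N; rewrite !ler_norml => /andP[? ?] /andP[? ?]; lra.
Qed.

End renewal_bound.

(** * Twisted operators *)

Section trig_bounds.
Context {R : realType}.
Implicit Types u v : R.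

Lemma lip_of_derive (f df : R -> R) : (forall x : R, is_derive x 1 f (df x)) ->
  (forall x, `|df x| <= 1) -> forall u v, `|f u - f v| <= `|u - v|.
Proof.
move=> fd df1; suff h u v : u <= v -> `|f v - f u| <= `|v - u|.
  by move=> u v; have [/h|/ltW/h //] := leP u v; rewrite distrC (distrC v).
move=> uv.
have cf : {within `[u, v], continuous f}.
  apply: continuous_subspaceT => y.
  apply/differentiable_continuous/derivable1_diffP.
  by have [] := fd y.
have [c _ ->] := MVT_segment uv (fun x _ => fd x) cf.
by rewrite normrM ler_piMl.
Qed.

Lemma sin_lip u v : `|sin u - sin v| <= `|u - v|.
Proof. by apply: (@lip_of_derive sin cos) => x; exact: cos_max. Qed.

Lemma cos_lip u v : `|cos u - cos v| <= `|u - v|.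
Proof.
by apply: (@lip_of_derive cos (fun x => - sin x)) => x; rewrite normrN; exact: sin_max.
Qed.

Lemma sin_abs u : `|sin u| <= `|u|.
Proof. by have := sin_lip u 0; rewrite sin0 !subr0. Qed.

Lemma mvt_quadratic (f df : R -> R) : (forall x : R, is_derive x 1 f (df x)) ->
  (forall x, `|df x| <= `|x|) -> forall u, `|f u - f 0| <= u ^+ 2.
Proof.
move=> fd dfx u.
have cf a b : {within `[a, b], continuous f}.
  apply: continuous_subspaceT => y.
  apply/differentiable_continuous/derivable1_diffP.
  by have [] := fd y.
have fin (c : R) : `|c| <= `|u| -> `|df c * u| <= u ^+ 2.
  move=> cu; rewrite normrM -(real_normK (num_real u)) expr2.
  by rewrite ler_wpM2r// (le_trans (dfx c)).
have [u0|u0] := leP 0 u.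
  have [c] := MVT_segment u0 (fun x _ => fd x) (cf 0 u).
  rewrite in_itv /= subr0 => /andP[c0 cu] ->; apply: fin.
  by rewrite !ger0_norm.
have [c] := MVT_segment (ltW u0) (fun x _ => fd x) (cf u 0).
rewrite in_itv /= sub0r => /andP[c0 cu] e; rewrite distrC e mulrN normrN; apply: fin.
by rewrite !ler0_norm ?lerN2// ltW.
Qed.

Lemma cos_sub1 u : `|cos u - 1| <= u ^+ 2.
Proof.
rewrite -[X in _ - X]cos0; apply: (@mvt_quadratic cos (fun x => - sin x)) => x.
by rewrite normrN; exact: sin_abs.
Qed.

Lemma sin_sub_id u : `|sin u - u| <= u ^+ 2.
Proof.
have := @mvt_quadratic (sin - id) (fun x => cos x - 1).
rewrite /= !fctE => /(_ _ _ u); rewrite sin0 !subr0; apply.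
move=> x; have := cos_lip x 0; rewrite cos0 subr0//.
Qed.

End trig_bounds.

Section twisted.
Context {R : realType} {dO : measure_display} {Omega : measurableType dO}.
Variables (P : probability Omega R) (d : nat).
Variables (A : nat -> Omega -> vec R d -> vec R d).
Hypothesis tA : random_topical_ops A.
Variable phi : vec R d -> R.
Hypothesis tphi : topical_fun phi.

Definition twist_integrand (t : R) (f1 f2 : vec R d -> R) x w : R :=
  cos (t * incr A phi x w) * f1 (A 1 w x) - sin (t * incr A phi x w) * f2 (A 1 w x).

(* Real part of [E (e^{i t xi} (f1 + i f2) (A x))]; the imaginary part is
   obtained from the pair [(f2, - f1)]. *)
Definition twist (t : R) (f1 f2 : vec R d -> R) (x : vec R d) : R :=
  \int[P]_w twist_integrand t f1 f2 x w.

Lemma mt_incr t x : measurable_fun setT (fun w => t * incr A phi x w).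
Proof. by apply: measurable_funM; [exact: measurable_cst | exact: (incr_meas tA tphi)]. Qed.

Lemma bmf_twist t f1 f2 x : cb f1 -> cb f2 -> bmf (twist_integrand t f1 f2 x).
Proof.
move=> c1 c2; apply: bmfB; apply: bmfM.
- exact/bmf_cos/mt_incr.
- exact: (bmf_cb_op tA 1 x c1).
- exact/bmf_sin/mt_incr.
- exact: (bmf_cb_op tA 1 x c2).
Qed.

Local Open Scope complex_scope.

Lemma normc_le (z : R[i]) M : `|complex.Re z| <= M -> `|complex.Im z| <= M -> Normc.normc z <= 2 * M.
Proof.
case: z => a b /= aM bM.
have M0 : 0 <= M by rewrite (le_trans _ aM).
rewrite -[leRHS]ger0_norm ?mulr_ge0// -sqrtr_sqr ler_sqrt ?sqr_ge0//.
rewrite -(real_normK (num_real a)) -(real_normK (num_real b)).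
have := normr_ge0 a; have := normr_ge0 b; rewrite !expr2; nra.
Qed.

Lemma ReIm_le_normc (z : R[i]) M : Normc.normc z <= M ->
  `|complex.Re z| <= M /\ `|complex.Im z| <= M.
Proof.
case: z => a b /= h; split; apply: le_trans h; rewrite -[leLHS]sqrtr_sqr; apply: ler_wsqrtr.
  by rewrite lerDl sqr_ge0.
by rewrite lerDr sqr_ge0.
Qed.

Lemma shinv_ReIm (f : vec R d -> R[i]) : (forall x a, f (vshift x a) = f x) ->
  shinv (fun x => complex.Re (f x)) /\ shinv (fun x => complex.Im (f x)).
Proof. by move=> fs; split => x a; rewrite fs. Qed.

Lemma Qt_twist t (f : vec R d -> R[i]) (g : Espace R d -> R[i]) F x :
  (forall F x, topical_op F -> g (F, x) = f (F x)) ->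
  Qt P A phi t g (F, x) = Complex
    (twist t (fun x => complex.Re (f x)) (fun x => complex.Im (f x)) (F x))
    (twist t (fun x => complex.Im (f x)) (fun x => - complex.Re (f x)) (F x)).
Proof.
move=> gf; rewrite /Qt /cexpect /twist /twist_integrand /=; congr Complex; apply: eq_Rintegral => w _.
  rewrite gf; last exact: tA.1.
  by rewrite /expi /incr; case: (f _).
rewrite gf; last exact: tA.1.
by rewrite /expi /incr; case: (f _) => a b /=; ring.
Qed.

Hypothesis wna : weakly_non_arithmetic P A phi.

Lemma id_topical : topical_op (id : vec R d -> vec R d).
Proof. by split. Qed.

(** Surjectivity of the inverse problem in real coordinates. Elements of [Binf] depend on [(F, x)]
    only through [F x], so the equation is read off at [F = id]. *)
Lemma twist_resolvent t k1 k2 : t != 0 -> cb k1 -> shinv k1 -> cb k2 -> shinv k2 ->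
  exists f1 f2, [/\ cb f1 /\ shinv f1, cb f2 /\ shinv f2,
    forall x, f1 x - twist t f1 f2 x = k1 x &
    forall x, f2 x - twist t f2 (fun y => - f1 y) x = k2 x].
Proof.
move=> t0 [c1 [M1 kM1]] s1 [c2 [M2 kM2]] s2; have [ex _] := wna.2.2 t t0.
pose K (z : Espace R d) : R[i] := Complex (k1 (z.1 z.2)) (k2 (z.1 z.2)).
have BK : Binf K.
  exists (fun x => Complex (k1 x) (k2 x)); split; first by move=> x a; rewrite s1 s2.
  split => //; split => //; split => //.
  exists (2 * Num.max M1 M2) => x; apply: normc_le => /=.
    by rewrite le_max kM1.
  by rewrite le_max kM2 orbT.
have [g [[f [fs [cr [ci [[M fM] gf]]]]] gE]] := ex K BK.
exists (fun x => complex.Re (f x)), (fun x => complex.Im (f x)).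
have [s3 s4] := shinv_ReIm fs.
have E x : f x - Qt P A phi t g (id, x) = Complex (k1 x) (k2 x).
  by have := gE id x id_topical; rewrite gf//; exact: id_topical.
split.
- split => //; split => //; exists M => x; exact: (ReIm_le_normc (fM x)).1.
- split => //; split => //; exists M => x; exact: (ReIm_le_normc (fM x)).2.
- by move=> x; have := E x; rewrite (Qt_twist t id x gf); case: (f x) => a b [].
- by move=> x; have := E x; rewrite (Qt_twist t id x gf); case: (f x) => a b [].
Qed.

Lemma twist_bound t : t != 0 -> exists2 C, 0 <= C & forall f1 f2 M,
  cb f1 -> shinv f1 -> cb f2 -> shinv f2 ->
  (forall x, `|f1 x - twist t f1 f2 x| <= M) ->
  (forall x, `|f2 x - twist t f2 (fun y => - f1 y) x| <= M) ->
  forall x, `|f1 x| <= C * M /\ `|f2 x| <= C * M.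
Proof.
move=> t0; have [_ [C HC]] := wna.2.2 t t0.
exists (`|C| * 2); first by rewrite mulr_ge0.
move=> f1 f2 M [c1 [M1 fM1]] s1 [c2 [M2 fM2]] s2 h1 h2 x.
pose f x : R[i] := Complex (f1 x) (f2 x).
pose g (z : Espace R d) := f (z.1 z.2).
have gf F y : topical_op F -> g (F, y) = f (F y) by [].
have Bg : Binf g.
  exists f; split; first by move=> y a; rewrite /f s1 s2.
  split => //; split => //; split => //.
  exists (2 * Num.max M1 M2) => y; apply: normc_le => /=.
    by rewrite le_max fM1.
  by rewrite le_max fM2 orbT.
have Eg : Ebounded (fun z => g z - Qt P A phi t g z) (2 * M).
  move=> F y tF; rewrite (Qt_twist t F y gf) gf//.
  apply: normc_le => /=; [exact: h1 | exact: h2].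
have := HC g (2 * M) Bg Eg id x id_topical.
move=> /ReIm_le_normc /= [b1 b2].
have M0 : 0 <= M by rewrite (le_trans _ (h1 x)).
have CM : C * (2 * M) <= `|C| * 2 * M.
  by rewrite -mulrA ler_wpM2r ?mulr_ge0// ler_norm.
by split; [exact: le_trans b1 CM | exact: le_trans b2 CM].
Qed.

End twisted.

Section apriori_arithmetic.
Context {R : realType}.

(** The linear inequalities behind [apriori_small]: [F] is the sup norm of the solution, [c1] and
    [c2] are the absolute values of its means, [K] bounds the right-hand side and [q * t] its means.
    Eliminating [F] through [F <= 2 (c1 + c2) + 2 Q K] produces the coefficients [m1] and [m2]; for
    small [t] the remaining terms in [c1 + c2] are absorbed on the left. *)
Lemma apriori_arithmetic (mu B Q K q t F c1 c2 : R) (b := 2 * (1 + B))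
  (m1 := 5 * B + 4 * Q * b * (1 + B)) (m2 := 4 * Q * B + 4 * Q ^+ 2 * b * (1 + B)) :
  0 < mu -> 0 <= B -> 0 <= Q -> 0 <= K -> 0 <= q -> 0 <= F -> 0 <= c1 -> 0 <= c2 -> 0 <= t ->
  t <= 1 -> t * (Q * b) <= 1 / 2 -> t * m1 <= mu / 2 ->
  F <= c1 + c2 + Q * (K + t * b * F) ->
  c1 * mu <= q + t * (F + c1) * B + Q * (K + t * b * F) * (1 + B) ->
  c2 * mu <= q + t * (F + c2) * B + Q * (K + t * b * F) * (1 + B) ->
  F <= (8 / mu + 4 * (2 * Q * (1 + B) + m2) / mu + 2 * Q) * (K + q).
Proof.
move=> mu0 B0 Q0 K0 q0 F0 c10 c20 t0 t1 tQ tm hF h1 h2.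
have b0 : 0 <= b by rewrite mulr_ge0// addr_ge0.
have FF : t * (Q * b) * F <= 1 / 2 * F by rewrite ler_wpM2r.
have F2 : F <= 2 * (c1 + c2) + 2 * Q * K by lra.
pose e := B + Q * b * (1 + B).
have e0 : 0 <= e by rewrite addr_ge0// mulr_ge0 ?mulr_ge0// addr_ge0.
have tF : t * e * F <= t * e * (2 * (c1 + c2) + 2 * Q * K).
  by rewrite ler_wpM2l// mulr_ge0.
have m20 : 0 <= m2 by rewrite addr_ge0 ?mulr_ge0 ?sqr_ge0// addr_ge0.
have tm2 : t * m2 * K <= m2 * K by rewrite ler_wpM2r// ler_piMl.
have tmc : t * m1 * (c1 + c2) <= mu / 2 * (c1 + c2) by rewrite ler_wpM2r// addr_ge0.
have key : (c1 + c2) * (mu / 2) <= 2 * q + (2 * Q * (1 + B) + m2) * K.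
  rewrite /m1 /m2 /e in tF tm2 tmc *; lra.
have mq : 0 <= (2 * Q * (1 + B) + m2) * q.
  by rewrite mulr_ge0// addr_ge0// mulr_ge0 ?mulr_ge0// addr_ge0.
have cc : c1 + c2 <= (2 * q + (2 * Q * (1 + B) + m2) * K) / (mu / 2).
  by rewrite ler_pdivlMr ?divr_gt0.
set m3 := 2 * Q * (1 + B) + m2 in key mq cc *.
have -> : (8 / mu + 4 * m3 / mu + 2 * Q) * (K + q) =
   2 * ((2 * q + m3 * K) / (mu / 2)) + 2 * Q * K + (8 / mu * K + 4 * (m3 * q) / mu + 2 * Q * q).
  by field; rewrite gt_eqF.
have : 0 <= 8 / mu * K + 4 * (m3 * q) / mu + 2 * Q * q.
  have imu : 0 <= mu^-1 by rewrite invr_ge0 ltW.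
  apply: addr_ge0; [apply: addr_ge0|]; apply: mulr_ge0 => //; exact: mulr_ge0.
lra.
Qed.

End apriori_arithmetic.

(** * A priori bounds for the twisted equations *)

Section apriori.
Context {R : realType} {dO : measure_display} {Omega : measurableType dO}.
Variables (P : probability Omega R) (d : nat).
Variables (A : nat -> Omega -> vec R d -> vec R d) (X0 : Omega -> vec R d).
Hypothesis tA : random_topical_ops A.
Hypothesis rX0 : random_vector X0.
Hypothesis iid : iid_and_indep P A X0.
Variable phi : vec R d -> R.
Hypothesis tphi : topical_fun phi.
Variable B : R.
Hypothesis B0 : 0 <= B.
Hypothesis HB : forall x, P.-integrable setT (EFin \o (fun w => incr A phi x w ^+ 2)) /\
    \int[P]_w (incr A phi x w ^+ 2) <= B.
Variable i0 : 'I_d.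
Variable nu0 : probability (PRmax R d) R.
Hypothesis inv : invariant_measure P A nu0.
Variables (N : nat) (p : R).
Hypothesis p0 : 0 < p.
Hypothesis pE : P [set w | rank1 (prod_ops A N w)] = p%:E.

Let g := drift P A phi.
Let T := Top P A.
Let cg : cb g := drift_cb tA tphi B0 HB.
Let sg : shinv g := drift_shinv P tA tphi.

Hypothesis mu0 : 0 < mean_drift P A phi nu0.
Hypothesis wna : weakly_non_arithmetic P A phi.
Let mu := mean_drift P A phi nu0.
Let tw := twist P A phi.

Lemma incr_dominated (h : Omega -> R) x a c : 0 <= a -> 0 <= c ->
  P.-integrable setT (EFin \o h) ->
  (forall w, `|h w| <= a * incr A phi x w ^+ 2 + c * `|incr A phi x w|) ->
  `|\int[P]_w h w| <= a * B + c * (1 + B).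
Proof.
move=> a0 c0 ih hle; have [h1 h2] := HB x.
have ia := incr_integrable tA tphi HB x.
have i1 := integrableZl measurableT a h1.
have i2 := integrableZl measurableT c (integrable_norm ia).
have i3 := integrableD measurableT i1 i2.
rewrite (le_trans (le_normr_Rintegral _ ih))//.
apply: (@le_trans _ _ (\int[P]_w (a * incr A phi x w ^+ 2 + c * `|incr A phi x w|))).
  by apply: le_Rintegral => //; exact: integrable_norm.
rewrite RintegralD// !RintegralZl//; last exact: (integrable_norm ia).
by apply: lerD; apply: ler_wpM2l => //; exact: (incr_abs tA tphi HB).
Qed.

Lemma twist_lip t s f1 f2 F x : cb f1 -> cb f2 ->
  (forall y, `|f1 y| <= F) -> (forall y, `|f2 y| <= F) ->
  `|tw t f1 f2 x - tw s f1 f2 x| <= `|t - s| * (2 * (1 + B)) * F.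
Proof.
move=> c1 c2 b1 b2; have F0 : 0 <= F by rewrite (le_trans _ (b1 0)).
have bt := bmf_twist tA tphi t x c1 c2; have bs := bmf_twist tA tphi s x c1 c2.
rewrite /tw /twist -RintegralB//; try exact: bmf_integrable.
have -> : `|t - s| * (2 * (1 + B)) * F = 0 * B + (`|t - s| * 2 * F) * (1 + B) by ring.
apply: (@incr_dominated _ x) => //.
- by rewrite !mulr_ge0.
- by apply: bmf_integrable; exact: bmfB.
move=> w; rewrite /twist_integrand mul0r add0r; set xi := incr _ _ _ _.
set u := f1 _; set v := f2 _.
have -> : cos (t * xi) * u - sin (t * xi) * v - (cos (s * xi) * u - sin (s * xi) * v) =
  (cos (t * xi) - cos (s * xi)) * u - (sin (t * xi) - sin (s * xi)) * v by ring.
rewrite (le_trans (ler_normB _ _))// !normrM.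
have h1 : `|cos (t * xi) - cos (s * xi)| <= `|t - s| * `|xi|.
  by rewrite -normrM mulrBl cos_lip.
have h2 : `|sin (t * xi) - sin (s * xi)| <= `|t - s| * `|xi|.
  by rewrite -normrM mulrBl sin_lip.
have -> : `|t - s| * 2 * F * `|xi| = `|t - s| * `|xi| * F + `|t - s| * `|xi| * F by ring.
by apply: lerD; apply: ler_pM => //; [exact: b1 | exact: b2].
Qed.

Lemma twist0 f1 f2 x : tw 0 f1 f2 x = T f1 x.
Proof.
by apply: eq_Rintegral => w _; rewrite /twist_integrand mul0r cos0 sin0 mul1r mul0r subr0.
Qed.

(** Expansion at [t = 0] around a constant [c] close to [f2]. The first order term is [- c t g],
    whose [nu0]-mean involves [mu > 0]: this is how an equation for [f1] yields information on the
    mean of [f2]. *)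
Lemma twist_mean t f1 f2 F c De x : cb f1 -> cb f2 ->
  (forall y, `|f1 y| <= F) -> (forall y, `|f2 y - c| <= De) ->
  `|tw t f1 f2 x - T f1 x + c * t * g x| <= t ^+ 2 * (F + `|c|) * B + `|t| * De * (1 + B).
Proof.
move=> c1 c2 b1 b2; have F0 : 0 <= F by rewrite (le_trans _ (b1 0)).
have De0 : 0 <= De by rewrite (le_trans _ (b2 0)).
have bt := bmf_twist tA tphi t x c1 c2.
have bf := bmf_cb_op tA 1 x c1.
have ia := incr_integrable tA tphi HB x.
have i1 := bmf_integrable P (bmfB bt bf).
have i2 := integrableZl measurableT (c * t) ia.
have i3 := integrableD measurableT i1 i2.
have -> : tw t f1 f2 x - T f1 x + c * t * g x =
   \int[P]_w (twist_integrand A phi t f1 f2 x w - f1 (A 1 w x) + c * t * incr A phi x w).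
  rewrite RintegralD// RintegralB//; try exact: bmf_integrable.
  by rewrite RintegralZl.
apply: (@incr_dominated _ x) => //.
- by rewrite mulr_ge0 ?sqr_ge0// addr_ge0.
- by rewrite mulr_ge0.
move=> w; rewrite /twist_integrand; set xi := incr _ _ _ _; set u := f1 _; set v := f2 _.
have -> : cos (t * xi) * u - sin (t * xi) * v - u + c * t * xi =
   (cos (t * xi) - 1) * u - sin (t * xi) * (v - c) - c * (sin (t * xi) - t * xi) by ring.
rewrite (le_trans (ler_normB _ _))//.
apply: (@le_trans _ _ ((t * xi) ^+ 2 * F + `|t * xi| * De + `|c| * (t * xi) ^+ 2)).
  apply: lerD; last by rewrite normrM ler_wpM2l// sin_sub_id.
  rewrite (le_trans (ler_normB _ _))// !normrM; apply: lerD; apply: ler_pM => //.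
  - exact: cos_sub1.
  - exact: b1.
  - by rewrite -normrM; exact: sin_abs.
  - exact: b2.
by rewrite normrM le_eqVlt; apply/orP; left; apply/eqP; ring.
Qed.

Lemma pair_sup (f1 f2 : vec R d -> R) : cb f1 -> cb f2 -> exists F, [/\ 0 <= F,
  (forall x, `|f1 x| <= F), (forall x, `|f2 x| <= F) &
  forall G, (forall x, `|f1 x| <= G) -> (forall x, `|f2 x| <= G) -> F <= G].
Proof.
move=> [_ [M1 fM1]] [_ [M2 fM2]].
pose S := [set `|f1 x| | x in setT] `|` [set `|f2 x| | x in setT].
have S0 : S !=set0 by exists `|f1 0|; left; exists 0.
have hS : has_sup S.
  split => //; exists (Num.max M1 M2) => _ [[x _ <-]|[x _ <-]].
    by rewrite le_max fM1.
  by rewrite le_max fM2 orbT.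
have h1 x : `|f1 x| <= sup S by apply: ub_le_sup; [exact: hS.2 | left; exists x].
have h2 x : `|f2 x| <= sup S by apply: ub_le_sup; [exact: hS.2 | right; exists x].
exists (sup S); split => //; first exact: le_trans (h1 0).
move=> G g1 g2; apply: ge_sup => // _ [[x _ <-]|[x _ <-]] //.
Qed.

Definition twisted_solution t f1 f2 k1 k2 :=
  [/\ cb f1 /\ shinv f1, cb f2 /\ shinv f2, cb k1 /\ shinv k1, cb k2 /\ shinv k2 &
    (forall x, f1 x - tw t f1 f2 x = k1 x) /\
    (forall x, f2 x - tw t f2 (fun y => - f1 y) x = k2 x)].

(** Averaging against [nu0] annihilates [Id - T], so the means of the solution appear in the
    averaged equation multiplied by [t]. They stay bounded as [t] tends to 0 only if the means of
    the right-hand side are of order [t]; [q] measures this. *)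
Definition apriori_bound (C t : R) := forall f1 f2 k1 k2 K q,
  twisted_solution t f1 f2 k1 k2 ->
  (forall x, `|k1 x| <= K) -> (forall x, `|k2 x| <= K) ->
  `|\int[nu0]_x k1 x| <= q * `|t| -> `|\int[nu0]_x k2 x| <= q * `|t| ->
  forall x, `|f1 x| <= C * (K + q) /\ `|f2 x| <= C * (K + q).

Let Q := 2 * N%:R / p.

Let Q0 : 0 <= Q.
Proof. by rewrite divr_ge0 ?mulr_ge0// ltW. Qed.

(** The equation is a Poisson equation for [T], whose right-hand side is [k] plus the effect of
    replacing [t] by 0, of order [t] by [twist_lip]. *)
Lemma twisted_osc t f1 f2 k F K : cb f1 -> shinv f1 -> cb f2 -> cb k -> shinv k ->
  (forall x, f1 x - tw t f1 f2 x = k x) ->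
  (forall x, `|f1 x| <= F) -> (forall x, `|f2 x| <= F) -> (forall x, `|k x| <= K) ->
  forall x, `|f1 x - \int[nu0]_y f1 y| <= Q * (K + `|t| * (2 * (1 + B)) * F).
Proof.
move=> c1 s1 c2 ck sk fk b1 b2 bk x0.
apply: (nu_osc i0) => // x y.
have -> : Q * (K + `|t| * (2 * (1 + B)) * F) =
    2 * N%:R * (K + `|t| * (2 * (1 + B)) * F) / p by rewrite /Q mulrAC.
apply: (poisson_osc tA rX0 iid p0 pE) => // z.
have -> : f1 z - Top P A f1 z = k z + (tw t f1 f2 z - tw 0 f1 f2 z).
  by rewrite twist0 -fk /T; ring.
rewrite (le_trans (ler_normD _ _))//; apply: lerD; first exact: bk.
by have := twist_lip t 0 z c1 c2 b1 b2; rewrite subr0.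
Qed.

(* Averaging the equation for [f1] against [nu0] controls the mean of [f2]. *)
Lemma twisted_mean_bound t f1 f2 k F De c q : cb f1 -> shinv f1 -> cb f2 -> shinv f2 ->
  cb k -> shinv k -> (forall x, f1 x - tw t f1 f2 x = k x) -> (forall x, `|f1 x| <= F) ->
  `|\int[nu0]_x k x| <= q -> (forall x, `|f2 x - c| <= De) ->
  `|c| * `|t| * mu <= q + (t ^+ 2 * (F + `|c|) * B + `|t| * De * (1 + B)).
Proof.
move=> c1 s1 c2 s2 ck sk fk b1 bk bc.
have cT : cb (T f1) by exact: cb_Top.
have sT : shinv (T f1) by exact: shinv_Top.
have m (f : vec R d -> R) : cb f -> shinv f -> nu0.-integrable setT (EFin \o (f : PRmax R d -> R)).
  by move=> cf sf; apply: bmf_integrable; exact: (bmf_PR i0).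
have cs1 : cb (fun x => f1 x - k x) by exact: cbB.
have ss1 : shinv (fun x => f1 x - k x) by move=> x a; rewrite s1 sk.
have cs2 : cb (fun x => f1 x - k x - T f1 x) by exact: cbB.
have ss2 : shinv (fun x => f1 x - k x - T f1 x) by move=> x a; rewrite s1 sk sT.
have cs3 : cb (fun x => c * t * g x) by exact: cbZ.
have ss3 : shinv (fun x => c * t * g x) by move=> x a; rewrite sg.
have e : \int[nu0]_x (f1 x - k x - T f1 x + c * t * g x) = c * t * mu - \int[nu0]_x k x.
  rewrite (RintegralD _ (m _ cs2 ss2) (m _ cs3 ss3))//.
  rewrite (RintegralB _ (m _ cs1 ss1) (m _ cT sT))// (RintegralB _ (m _ c1 s1) (m _ ck sk))//.
  rewrite (RintegralZl _ _ (m _ cg sg))// (nu_Top tA i0 inv c1 s1) /mu /mean_drift; ring.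
have h : `|\int[nu0]_x (f1 x - k x - T f1 x + c * t * g x)| <=
   t ^+ 2 * (F + `|c|) * B + `|t| * De * (1 + B).
  apply: norm_Rintegral_prob_le => [|x].
    by apply: m; [exact: cbD | move=> x a; rewrite ss2 ss3].
  have -> : f1 x - k x = tw t f1 f2 x by rewrite -fk; ring.
  exact: twist_mean.
have -> : `|c| * `|t| * mu = `|(c * t * mu - \int[nu0]_x k x) + \int[nu0]_x k x|.
  by rewrite subrK !normrM (gtr0_norm mu0).
by rewrite (le_trans (ler_normD _ _))// addrC lerD// -e.
Qed.

(** The oscillations are controlled by memory loss. The average of the first equation bounds the
    mean of [f2]; that of the second, whose companion is [- f1], bounds the mean of [f1]. *)
Lemma apriori_small : exists eta C, [/\ 0 < eta, 0 <= C &
  forall t, t != 0 -> `|t| <= eta -> apriori_bound C t].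
Proof.
pose b := 2 * (1 + B).
pose m1 := 5 * B + 4 * Q * b * (1 + B); pose m2 := 4 * Q * B + 4 * Q ^+ 2 * b * (1 + B).
have B1 : 0 <= 1 + B by rewrite addr_ge0.
have b0 : 0 <= b by rewrite mulr_ge0.
have m10 : 0 <= m1 by nonneg.
have m20 : 0 <= m2 by nonneg.
have Qb0 : 0 <= Q * b by rewrite mulr_ge0.
(* The three terms provide [t <= 1], [t * (Q * b) <= 1 / 2] and [t * m1 <= mu / 2], the smallness
   used by [apriori_arithmetic]. *)
exists (Num.min 1 (Num.min (1 / (2 * (Q * b + 1))) (mu / (2 * (m1 + 1))))).
exists (8 / mu + 4 * (2 * Q * (1 + B) + m2) / mu + 2 * Q); split.
- rewrite !lt_min ltr01 !divr_gt0 ?mulr_gt0 ?ltr_wpDl//.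
- have := ltW mu0; rewrite -/mu => mu0'; nonneg.
move=> t t0; rewrite !le_min => /and3P[t1 tQ tm] f1 f2 k1 k2 K q.
move=> [[c1 s1] [c2 s2] [ck1 sk1] [ck2 sk2] [e1 e2]] bk1 bk2 q1 q2.
have [F [F0 bf1 bf2 Fmin]] := pair_sup c1 c2.
have tp : 0 < `|t| by rewrite normr_gt0.
have K0 : 0 <= K by rewrite (le_trans _ (bk1 0)).
have q0 : 0 <= q by rewrite -(pmulr_lge0 _ tp) (le_trans _ q1).
pose De := Q * (K + `|t| * b * F).
have cN : cb (fun x => - f1 x) by exact: cbN.
have sN : shinv (fun x => - f1 x) by move=> x a; rewrite s1.
have bN x : `|- f1 x| <= F by rewrite normrN.
have o1 : forall x, `|f1 x - \int[nu0]_y f1 y| <= De by exact: twisted_osc ck1 sk1 e1 bf1 bf2 bk1.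
have o2 : forall x, `|f2 x - \int[nu0]_y f2 y| <= De by exact: twisted_osc ck2 sk2 e2 bf2 bN bk2.
set d1 := \int[nu0]_y f1 y in o1; set d2 := \int[nu0]_y f2 y in o2.
have o1' x : `|- f1 x - - d1| <= De by rewrite -opprD normrN; exact: o1.
have h2 := twisted_mean_bound c1 s1 c2 s2 ck1 sk1 e1 bf1 q1 o2.
have h1 := twisted_mean_bound c2 s2 cN sN ck2 sk2 e2 bf2 q2 o1'.
rewrite normrN in h1.
(* The division by [t] announced by the form of [apriori_bound]. *)
have div (c : R) : 0 <= c -> c * `|t| * mu <= q * `|t| + (t ^+ 2 * (F + c) * B + `|t| * De * (1 + B)) ->
    c * mu <= q + `|t| * (F + c) * B + De * (1 + B).
  move=> c0 h; rewrite -(ler_pM2r tp).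
  rewrite -(real_normK (num_real t)) in h.
  have -> : c * mu * `|t| = c * `|t| * mu by ring.
  apply: le_trans h _; rewrite le_eqVlt; apply/orP; left; apply/eqP; ring.
have FC : F <= (8 / mu + 4 * (2 * Q * (1 + B) + m2) / mu + 2 * Q) * (K + q).
  apply: (@apriori_arithmetic _ mu B Q K q `|t| F `|d1| `|d2|) => //.
  - rewrite -/b; move: tQ; rewrite ler_pdivlMr ?mulr_gt0 ?ltr_wpDl// => tQ.
    by have := normr_ge0 t; lra.
  - rewrite -/b -/m1; move: tm; rewrite ler_pdivlMr ?mulr_gt0 ?ltr_wpDl// => tm.
    by have := normr_ge0 t; lra.
  - rewrite -/b -/De; apply: Fmin => x.
    + have -> : f1 x = (f1 x - d1) + d1 by ring.
      rewrite (le_trans (ler_normD _ _))//; have := o1 x; have := normr_ge0 d2; lra.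
    + have -> : f2 x = (f2 x - d2) + d2 by ring.
      rewrite (le_trans (ler_normD _ _))//; have := o2 x; have := normr_ge0 d1; lra.
  - exact: div.
  - exact: div.
by move=> x; split; [exact: le_trans (bf1 x) FC | exact: le_trans (bf2 x) FC].
Qed.

Definition resolvent_bound (C t : R) := forall f1 f2 k1 k2 K,
  twisted_solution t f1 f2 k1 k2 ->
  (forall x, `|k1 x| <= K) -> (forall x, `|k2 x| <= K) ->
  forall x, `|f1 x| <= C * K /\ `|f2 x| <= C * K.

(** The bound at [t0] persists nearby: [twist] is Lipschitz in [t], and [delta] is such that
    [C0 * delta * b <= 1 / 2], so the perturbation is absorbed at the cost of doubling the
    constant. *)
Lemma resolvent_local t0 : t0 != 0 ->
  exists delta C, 0 < delta /\ forall t, `|t0 - t| < delta -> resolvent_bound C t.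
Proof.
move=> /(twist_bound tA wna)[C0 C00 HC].
pose b := 2 * (1 + B).
have b1 : 0 < b by rewrite mulr_gt0// ltr_pwDl.
pose delta := (2 * b * (C0 + 1))^-1.
have D0 : 0 < 2 * b * (C0 + 1) by apply: mulr_gt0; [exact: mulr_gt0 | exact: ltr_wpDl].
exists delta, (2 * C0); split; first by rewrite invr_gt0.
move=> t td f1 f2 k1 k2 K [[c1 s1] [c2 s2] [ck1 sk1] [ck2 sk2] [e1 e2]] bk1 bk2.
have [F [F0 bf1 bf2 Fmin]] := pair_sup c1 c2.
have K0 : 0 <= K by rewrite (le_trans _ (bk1 0)).
have cN : cb (fun x => - f1 x) by exact: cbN.
have bN x : `|- f1 x| <= F by rewrite normrN.
have tb : `|t - t0| * b * F <= delta * b * F.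
  by rewrite distrC; apply: ler_wpM2r => //; apply: ler_wpM2r; exact: ltW.
have g1 x : `|f1 x - tw t0 f1 f2 x| <= K + delta * b * F.
  have -> : f1 x - tw t0 f1 f2 x = k1 x + (tw t f1 f2 x - tw t0 f1 f2 x) by rewrite -e1; ring.
  rewrite (le_trans (ler_normD _ _))// lerD//.
  exact: le_trans (twist_lip t t0 x c1 c2 bf1 bf2) tb.
have g2 x : `|f2 x - tw t0 f2 (fun y => - f1 y) x| <= K + delta * b * F.
  have -> : f2 x - tw t0 f2 (fun y => - f1 y) x =
    k2 x + (tw t f2 (fun y => - f1 y) x - tw t0 f2 (fun y => - f1 y) x) by rewrite -e2; ring.
  rewrite (le_trans (ler_normD _ _))// lerD//.
  exact: le_trans (twist_lip t t0 x c2 cN bf2 bN) tb.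
have h := HC f1 f2 _ c1 s1 c2 s2 g1 g2.
have FF : F <= C0 * (K + delta * b * F) by apply: Fmin => x; have [] := h x.
have CF : C0 * (delta * b * F) <= F / 2.
  have -> : C0 * (delta * b * F) = C0 / (C0 + 1) * (F / 2).
    by rewrite /delta; field; rewrite !gt_eqF// ltr_wpDl.
  rewrite ler_piMl// ?divr_ge0// ler_pdivrMr ?ltr_wpDl// mul1r; lra.
have F2 : F <= 2 * C0 * K by lra.
by move=> x; split; [exact: le_trans (bf1 x) F2 | exact: le_trans (bf2 x) F2].
Qed.

Lemma resolvent_bound_le C C' t : C <= C' -> resolvent_bound C t -> resolvent_bound C' t.
Proof.
move=> CC H f1 f2 k1 k2 K sol b1 b2 x; have K0 : 0 <= K by rewrite (le_trans _ (b1 0)).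
have [h1 h2] := H f1 f2 k1 k2 K sol b1 b2 x.
by split; [apply: le_trans h1 _ | apply: le_trans h2 _]; exact: ler_wpM2r.
Qed.

Lemma resolvent_compact (a c : R) : (forall t, a <= t <= c -> t != 0) ->
  exists C, forall t, a <= t <= c -> resolvent_bound C t.
Proof.
move=> ac0.
have /compact_near_coveringP/(_ _ (pinfty_nbhs R) (fun C t => resolvent_bound C t)) := @segment_compact R a c.
case.
  move=> t /=; rewrite in_itv /= => /ac0/resolvent_local[delta [C [d0 H]]].
  exists (ball t delta, [set C' | C <= C']) => /=.
    split; first exact: nbhsx_ballx.
    exact: nbhs_pinfty_ge (num_real C).
  move=> [t' C'] [/= tt' CC']; apply: (resolvent_bound_le CC'); apply: H.
  by move: tt'; rewrite -ball_normE.
move=> M [_ HM]; exists (M + 1) => t tac.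
by apply: (HM (M + 1)); [rewrite ltrDl | rewrite /= in_itv].
Qed.

Lemma apriori L : exists2 C, 0 <= C & forall t, t != 0 -> `|t| <= L -> apriori_bound C t.
Proof.
have [eta [C [eta0 C0 small]]] := apriori_small.
have [C1 H1] : exists C, forall t, eta <= t <= L -> resolvent_bound C t.
  by apply: resolvent_compact => t /andP[et _]; rewrite gt_eqF// (lt_le_trans eta0).
have [C2 H2] : exists C, forall t, - L <= t <= - eta -> resolvent_bound C t.
  apply: resolvent_compact => t /andP[_ et].
  by rewrite lt_eqF// (le_lt_trans et)// oppr_lt0.
pose C' := C + `|C1| + `|C2|.
have C'0 : 0 <= C' by rewrite !addr_ge0.
exists C' => // t t0 tL f1 f2 k1 k2 K q sol b1 b2 q1 q2 x.
have tp : 0 < `|t| by rewrite normr_gt0.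
have K0 : 0 <= K by rewrite (le_trans _ (b1 0)).
have q0 : 0 <= q by rewrite -(pmulr_lge0 _ tp) (le_trans _ q1).
have [te|te] := leP `|t| eta.
  have [h1 h2] := small t t0 te f1 f2 k1 k2 K q sol b1 b2 q1 q2 x.
  have CC : C * (K + q) <= C' * (K + q).
    apply: ler_wpM2r; first exact: addr_ge0.
    by rewrite /C'; have := normr_ge0 C1; have := normr_ge0 C2; lra.
  by split; [exact: le_trans h1 CC | exact: le_trans h2 CC].
have fin D : resolvent_bound D t -> D <= C' ->
    `|f1 x| <= C' * (K + q) /\ `|f2 x| <= C' * (K + q).
  move=> HD DC; have [h1 h2] := HD f1 f2 k1 k2 K sol b1 b2 x.
  have CC : D * K <= C' * (K + q).
    apply: (@le_trans _ _ (C' * K)); first exact: ler_wpM2r.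
    by apply: ler_wpM2l => //; rewrite lerDl.
  by split; [exact: le_trans h1 CC | exact: le_trans h2 CC].
have [t_pos|t_neg] := leP 0 t.
  rewrite ger0_norm// in te tL; apply: (fin C1); first by apply: H1; rewrite ltW.
  by rewrite /C'; have := ler_norm C1; have := normr_ge0 C2; lra.
rewrite ltr0_norm// in te tL; apply: (fin C2).
  by apply: H2; apply/andP; split; lra.
by rewrite /C'; have := ler_norm C2; have := normr_ge0 C1; lra.
Qed.

End apriori.

(** * Removing the pole *)

Section interval_measure.
Context {R : realType}.
Variable K : R.

Definition sym_itv : set (measurableTypeR R) := `[- K, K].

Lemma itv_lty : (lebesgue_measure sym_itv < +oo)%E.
Proof.
rewrite /sym_itv lebesgue_measure_itv /=; case: ifPn => // _.
by rewrite -EFinD ltry.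
Qed.

(** Lebesgue measure on [[- K, K]], seen as a finite measure on the whole line so that the results
    on [bmf] functions, Fubini included, apply to it. *)
Definition leb : set (measurableTypeR R) -> \bar R := @mfrestr _ _ _ sym_itv lebesgue_measure (measurable_itv _) itv_lty.

HB.instance Definition _ := FiniteMeasure.on leb.

Lemma leb_setT : 0 <= K -> fine (leb setT) = 2 * K.
Proof.
move=> K0; rewrite /leb /mfrestr /mrestr setTI /sym_itv lebesgue_measure_itv /= lte_fin.
case: ltP => [_|]; first by rewrite -EFinD /=; ring.
by move=> KK /=; lra.
Qed.

End interval_measure.
Section regularized.
Context {R : realType} {dO : measure_display} {Omega : measurableType dO}.
Variables (P : probability Omega R) (d : nat).
Variables (A : nat -> Omega -> vec R d -> vec R d) (X0 : Omega -> vec R d).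
Hypothesis tA : random_topical_ops A.
Hypothesis rX0 : random_vector X0.
Hypothesis iid : iid_and_indep P A X0.
Variable phi : vec R d -> R.
Hypothesis tphi : topical_fun phi.
Variable B : R.
Hypothesis B0 : 0 <= B.
Hypothesis HB : forall x, P.-integrable setT (EFin \o (fun w => incr A phi x w ^+ 2)) /\
    \int[P]_w (incr A phi x w ^+ 2) <= B.
Variable i0 : 'I_d.
Variable nu0 : probability (PRmax R d) R.
Hypothesis inv : invariant_measure P A nu0.
Variables (N : nat) (p : R).
Hypothesis p0 : 0 < p.
Hypothesis pE : P [set w | rank1 (prod_ops A N w)] = p%:E.

Let g := drift P A phi.
Let cg : cb g := drift_cb tA tphi B0 HB.
Let sg : shinv g := drift_shinv P tA tphi.

Hypothesis mu0 : 0 < mean_drift P A phi nu0.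
Hypothesis wna : weakly_non_arithmetic P A phi.
Let mu := mean_drift P A phi nu0.
Let tw := twist P A phi.

Variables (h : vec R d -> R) (H K : R).
Hypothesis ch : continuous h.
Hypothesis hH : forall x, `|h x| <= H.
Hypothesis K0 : 0 <= K.
Hypothesis hK : forall x, K < `|phi x| -> h x = 0.

Let H0 : 0 <= H. Proof. by rewrite (le_trans _ (hH 0)). Qed.

(* [h] along the fibre of [x], parametrized by the value of [phi]. *)
Definition fibre x s := h (vshift x (s - phi x)).

Lemma fibre_support x s : K < `|s| -> fibre x s = 0.
Proof. by move=> Ks; apply: hK; rewrite tphi.2 addrC subrK. Qed.

Lemma fibre_shinv x a s : fibre (vshift x a) s = fibre x s.
Proof. by rewrite /fibre vshift_add tphi.2; congr (h (vshift x _)); ring. Qed.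

Lemma fibre_continuous x : continuous (fibre x).
Proof.
move=> s; apply: (@continuous_comp _ _ _ (fun s => vshift x (s - phi x)) h s); last exact: ch.
move=> U /= /(nbhs_ballP (vshift x (s - phi x)))[e /= e0 es].
apply/nbhs_ballP; exists e => //= r; rewrite -ball_normE /= => sr.
apply: es; rewrite -ball_normE /=; apply: le_lt_trans sr.
by rewrite (le_trans (vshift_dist _ _ _))// opprB addrA subrK.
Qed.

Lemma fibre_continuous_base s : continuous (fun x => fibre x s).
Proof.
move=> x; apply: (@continuous_comp _ _ _ (fun x => vshift x (s - phi x)) h x); last exact: ch.
move=> U /= /(nbhs_ballP (vshift x (s - phi x)))[e /= e0 es].
have e2 : 0 < e / 2 by rewrite divr_gt0.
apply/nbhs_ballP; exists (e / 2) => //= y; rewrite -ball_normE /= => xy.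
apply: es; rewrite -ball_normE /=.
have -> : vshift x (s - phi x) - vshift y (s - phi y) =
    (x - y) + (vshift y (s - phi x) - vshift y (s - phi y)).
  by apply/rowP => i; rewrite !mxE; ring.
rewrite (le_lt_trans (ler_normD _ _))//.
have h1 := vshift_dist y (s - phi x) (s - phi y).
have h2 := topical_fun_lip x y tphi.
have e1 : `|s - phi x - (s - phi y)| = `|phi x - phi y| by rewrite -normrN; congr `|_|; ring.
rewrite e1 in h1; lra.
Qed.

Lemma fibre_meas x : measurable_fun setT (fibre x).
Proof. by apply: continuous_measurable_fun; exact: fibre_continuous. Qed.

Lemma bmf_fibre x : bmf (fibre x).
Proof. by split; [exact: fibre_meas | exists H => s; exact: hH]. Qed.

Definition fibre_int (e : R -> R) (x : vec R d) : R := \int[leb K]_s (fibre x s * e s).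

Lemma fibre_int_dist (e e' : R -> R) (D : R) x : bmf e -> bmf e' -> 0 <= D ->
  (forall s, `|s| <= K -> `|e s - e' s| <= D) ->
  `|fibre_int e x - fibre_int e' x| <= D * (H * (2 * K)).
Proof.
move=> be be' D0 hD.
have b1 := bmfM (bmf_fibre x) be; have b2 := bmfM (bmf_fibre x) be'.
rewrite /fibre_int -RintegralB//; try exact: bmf_integrable.
have -> : D * (H * (2 * K)) = D * H * fine (leb K setT) by rewrite leb_setT//; ring.
apply: Rintegral_norm_le; first by apply: bmf_integrable; exact: bmfB.
move=> s; rewrite -mulrBr normrM mulrC.
have [sK|Ks] := leP `|s| K.
  by apply: ler_pM => //; [exact: hD | exact: hH].
by rewrite fibre_support// normr0 mulr0 mulr_ge0.
Qed.

Lemma fibre_int0 x : fibre_int (fun=> 0) x = 0.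
Proof.
rewrite /fibre_int; have -> : (fun s => fibre x s * 0) = fun=> 0 by apply/funext => s; rewrite mulr0.
by rewrite Rintegral_cst// mul0r.
Qed.

Lemma fibre_int_abs (e : R -> R) (D : R) x : bmf e -> 0 <= D -> (forall s, `|s| <= K -> `|e s| <= D) ->
  `|fibre_int e x| <= D * (H * (2 * K)).
Proof.
move=> be D0 hD; rewrite -[fibre_int e x]subr0 -(fibre_int0 x).
apply: fibre_int_dist => //; first exact: bmf_cst.
by move=> s sK; rewrite subr0; exact: hD.
Qed.

Lemma fibre_int_cb (e : R -> R) : bmf e -> cb (fibre_int e).
Proof.
move=> be; have [me [M eM]] := be; split; last first.
  exists (M * (H * (2 * K))) => x; apply: fibre_int_abs => //.
  by rewrite (le_trans _ (eM 0)).
move=> x; apply: seq_continuous => u ux.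
apply: (@bmf_dominated _ _ _ (leb K) _ _ (H * M)).
- by move=> n; exact: (bmfM (bmf_fibre (u n)) be).1.
- exact: (bmfM (bmf_fibre x) be).1.
- by move=> n s; rewrite normrM; apply: ler_pM => //; exact: hH.
- apply: aeW => s; apply: cvgM; last exact: cvg_cst.
  apply: (@continuous_cvg _ _ _ \oo _ u (fun x => fibre x s) x _ ux).
  exact: fibre_continuous_base.
Qed.

Lemma fibre_int_shinv e : shinv (fibre_int e).
Proof. by move=> x a; apply: eq_Rintegral => s _; rewrite fibre_shinv. Qed.

(** Real and imaginary parts, with [hsin], of the Fourier transform along the fibre for the kernel
    [exp (- i t s)]. *)
Definition hcos t := fibre_int (fun s => cos (t * s)).
Definition hsin t := fibre_int (fun s => - sin (t * s)).

Let mlin (t : R) : measurable_fun setT (fun s : R => t * s).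
Proof. by apply: measurable_funM => //; exact: measurable_cst. Qed.

Lemma bmf_coslin t : bmf (fun s : R => cos (t * s)).
Proof. by apply: bmf_cos; exact: mlin. Qed.

Lemma bmf_sinlin t : bmf (fun s : R => - sin (t * s)).
Proof. by apply: bmfN; apply: bmf_sin; exact: mlin. Qed.

Let c0 := K * (H * (2 * K)).
Let c00 : 0 <= c0. Proof. rewrite /c0; nonneg. Qed.

Lemma hcos_lip t s x : `|hcos t x - hcos s x| <= `|t - s| * c0.
Proof.
have -> : `|t - s| * c0 = `|t - s| * K * (H * (2 * K)) by rewrite /c0; ring.
apply: (fibre_int_dist x (bmf_coslin t) (bmf_coslin s)); first by rewrite mulr_ge0.
move=> r rK; rewrite (le_trans (cos_lip _ _))// -mulrBl normrM.
by rewrite ler_wpM2l.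
Qed.

Lemma hsin_lip t s x : `|hsin t x - hsin s x| <= `|t - s| * c0.
Proof.
have -> : `|t - s| * c0 = `|t - s| * K * (H * (2 * K)) by rewrite /c0; ring.
apply: (fibre_int_dist x (bmf_sinlin t) (bmf_sinlin s)); first by rewrite mulr_ge0.
move=> r rK; rewrite -opprD normrN (le_trans (sin_lip _ _))// -mulrBl normrM.
by rewrite ler_wpM2l.
Qed.

Lemma hcos_abs t x : `|hcos t x| <= H * (2 * K).
Proof.
rewrite -[leRHS]mul1r; apply: fibre_int_abs => //; first exact: bmf_coslin.
by move=> s _; exact: cos_max.
Qed.

Lemma hsin_abs t x : `|hsin t x| <= H * (2 * K).
Proof.
rewrite -[leRHS]mul1r; apply: fibre_int_abs => //; first exact: bmf_sinlin.
by move=> s _; rewrite normrN; exact: sin_max.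
Qed.

Lemma hsin0 x : hsin 0 x = 0.
Proof.
rewrite -[RHS](fibre_int0 x); apply: eq_Rintegral => s _.
by rewrite mul0r sin0 oppr0.
Qed.

Lemma cb_twist t f1 f2 : cb f1 -> cb f2 -> cb (tw t f1 f2).
Proof.
move=> c1 c2; have [cf1 [M1 b1]] := c1; have [cf2 [M2 b2]] := c2.
pose r F v := cos (t * (phi (F v) - phi v)) * f1 (F v) - sin (t * (phi (F v) - phi v)) * f2 (F v).
have rM F v : `|r F v| <= M1 + M2.
  rewrite (le_trans (ler_normB _ _))// !normrM; apply: lerD.
    by rewrite -[leRHS]mul1r; apply: ler_pM => //; exact: cos_max.
  by rewrite -[leRHS]mul1r; apply: ler_pM => //; exact: sin_max.
have clin (e : R -> R) : continuous e -> continuous (fun y => e (t * y)).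
  move=> ce y; apply: (@continuous_comp _ _ _ (fun y => t * y) e y); last exact: ce.
  exact: mulrl_continuous.
have cct := clin _ (@continuous_cos R); have cst := clin _ (@continuous_sin R).
split; last first.
  exists (M1 + M2) => x; apply: norm_Rintegral_prob_le => [|w]; last exact: (rM (A 1 w) x).
  by apply: bmf_integrable; exact: bmf_twist.
apply: (@one_step_continuous _ _ _ P _ A tA r (M1 + M2)) => //.
- move=> F tF v; rewrite /r.
  apply: (@continuousB _ _ _ (fun v => cos (t * (phi (F v) - phi v)) * f1 (F v))
    (fun v => sin (t * (phi (F v) - phi v)) * f2 (F v)) v).
    apply: (@continuousM _ _ (fun v => cos (t * (phi (F v) - phi v))) (fun v => f1 (F v)) v).
      exact: (trunc_step_continuous tphi cct tF).
    exact: (cb_comp_op c1 tF).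
  apply: (@continuousM _ _ (fun v => sin (t * (phi (F v) - phi v))) (fun v => f2 (F v)) v).
    exact: (trunc_step_continuous tphi cst tF).
  exact: (cb_comp_op c2 tF).
- move=> v; apply: measurable_funB; apply: measurable_funM.
  + exact: (trunc_step_meas tphi v cct).
  + exact: (cb_eval_meas v c1).
  + exact: (trunc_step_meas tphi v cst).
  + exact: (cb_eval_meas v c2).
Qed.

Lemma shinv_twist t f1 f2 : shinv f1 -> shinv f2 -> shinv (tw t f1 f2).
Proof.
move=> s1 s2 x a; apply: eq_Rintegral => w _.
by rewrite /twist_integrand (incr_shift tA tphi) (tA.1 1 w).2 s1 s2.
Qed.

Lemma twistB t f1 f2 e1 e2 x : cb f1 -> cb f2 -> cb e1 -> cb e2 ->
  tw t (fun y => f1 y - e1 y) (fun y => f2 y - e2 y) x = tw t f1 f2 x - tw t e1 e2 x.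
Proof.
move=> c1 c2 c3 c4; rewrite /tw /twist -RintegralB//.
- by apply: eq_Rintegral => w _; rewrite /twist_integrand; ring.
- by apply: bmf_integrable; exact: bmf_twist.
- by apply: bmf_integrable; exact: bmf_twist.
Qed.

Lemma twistZ t c f1 f2 x : cb f1 -> cb f2 ->
  tw t (fun y => c * f1 y) (fun y => c * f2 y) x = c * tw t f1 f2 x.
Proof.
move=> c1 c2; rewrite /tw /twist -RintegralZl//.
  by apply: eq_Rintegral => w _; rewrite /twist_integrand; ring.
by apply: bmf_integrable; exact: bmf_twist.
Qed.

(** [tcos t x + i tsin t x] is the characteristic function at [t] of the increment of [phi] from
    [x], that is the image of the constant 1 under the twisted operator. It enters when a constant
    pole is subtracted from a solution. *)
Definition tsin t x := - tw t (fun=> 0) (fun=> 1) x.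
Definition tcos t x := tw t (fun=> 1) (fun=> 0) x.

Let b := 2 * (1 + B).
Let b0 : 0 <= b. Proof. by rewrite mulr_ge0// addr_ge0. Qed.

Lemma tsin_lip t s x : `|tsin t x - tsin s x| <= `|t - s| * b.
Proof.
have h1 (c : R) : cb (fun _ : vec R d => c) by exact: cb_cst.
have := twist_lip tA tphi HB t s x (h1 0) (h1 1) (F := 1).
rewrite mulr1 /tsin -opprD normrN; apply => y; by rewrite ?normr0 ?normr1.
Qed.

Lemma tcos_lip t s x : `|tcos t x - tcos s x| <= `|t - s| * b.
Proof.
have h1 (c : R) : cb (fun _ : vec R d => c) by exact: cb_cst.
have := twist_lip tA tphi HB t s x (h1 1) (h1 0) (F := 1).
rewrite mulr1; apply => y; by rewrite ?normr0 ?normr1.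
Qed.

Lemma tsin0 x : tsin 0 x = 0.
Proof. by rewrite /tsin /tw twist0 Top_cst oppr0. Qed.

Lemma tcos0 x : tcos 0 x = 1.
Proof. by rewrite /tcos /tw twist0 Top_cst. Qed.

Lemma tsin_mean t x : `|tsin t x - t * g x| <= t ^+ 2 * B.
Proof.
have h1 (c : R) : cb (fun _ : vec R d => c) by exact: cb_cst.
have := twist_mean tA tphi HB t (c := 1) x (h1 0) (h1 1) (F := 0) (De := 0).
rewrite Top_cst normr1 subr0 add0r mul1r mulr1 mulr0 mul0r addr0 => h2.
rewrite /tsin -opprD normrN; apply: h2 => y; first by rewrite normr0.
by rewrite subrr normr0.
Qed.

Lemma tcos_mean t x : `|tcos t x - 1| <= t ^+ 2 * B.
Proof.
have h1 (c : R) : cb (fun _ : vec R d => c) by exact: cb_cst.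
have := twist_mean tA tphi HB t (c := 0) x (h1 1) (h1 0) (F := 1) (De := 0).
rewrite Top_cst normr0 !mul0r !addr0 mulr1 mulr0 mul0r addr0 => h2.
by apply: h2 => y; [rewrite normr1 | rewrite subr0 normr0].
Qed.

Lemma shinv_tsin t : shinv (tsin t).
Proof. by move=> x a; rewrite /tsin shinv_twist. Qed.

Lemma shinv_tcos t : shinv (tcos t).
Proof. by move=> x a; rewrite /tcos shinv_twist. Qed.

Lemma cb_tsin t : cb (tsin t).
Proof. by apply: cbN; apply: cb_twist; exact: cb_cst. Qed.

Lemma cb_tcos t : cb (tcos t).
Proof. by apply: cb_twist; exact: cb_cst. Qed.

Let a0 := \int[nu0]_x hcos 0 x.
(** To leading order [reg1 t] is [hcos 0 + A0 * g], whose [nu0]-mean is [a0 + A0 * mu]. The residue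
    is chosen to cancel it, as the hypothesis on the means in [apriori_bound] demands. *)
Let A0 := - a0 / mu.

(* Data of the twisted equations once the polar part [- A0 / t] of the second
   component has been removed. *)
Definition reg1 t x := hcos t x + A0 / t * tsin t x.
Definition reg2 t x := hsin t x + A0 / t * (1 - tcos t x).

Lemma reg1_cb t : cb (reg1 t) /\ shinv (reg1 t).
Proof.
split; last by move=> x a; rewrite /reg1 shinv_tsin /hcos fibre_int_shinv.
apply: cbD; first by apply: fibre_int_cb; exact: bmf_coslin.
by apply: cbZ; exact: cb_tsin.
Qed.

Lemma reg2_cb t : cb (reg2 t) /\ shinv (reg2 t).
Proof.
split; last by move=> x a; rewrite /reg2 shinv_tcos /hsin fibre_int_shinv.
apply: cbD; first by apply: fibre_int_cb; exact: bmf_sinlin.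
by apply: cbZ; apply: cbB; [exact: cb_cst | exact: cb_tcos].
Qed.

Lemma reg1_abs t x : t != 0 -> `|reg1 t x| <= H * (2 * K) + `|A0| * b.
Proof.
move=> t0; rewrite (le_trans (ler_normD _ _))// lerD ?hcos_abs// normrM (normrM A0) normfV.
have := tsin_lip t 0 x; rewrite tsin0 !subr0 => ht.
rewrite -mulrA ler_wpM2l// ler_pdivrMl ?normr_gt0//.
Qed.

Lemma reg2_abs t x : t != 0 -> `|reg2 t x| <= H * (2 * K) + `|A0| * b.
Proof.
move=> t0; rewrite (le_trans (ler_normD _ _))// lerD ?hsin_abs// normrM (normrM A0) normfV.
have := tcos_lip t 0 x; rewrite tcos0 !subr0 distrC => ht.
rewrite -mulrA ler_wpM2l// ler_pdivrMl ?normr_gt0//.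
Qed.

Let q0 := c0 + `|A0| * B.

Lemma div_sqr_le t u : t != 0 -> `|u| <= t ^+ 2 * B -> `|A0 / t * u| <= `|t| * (`|A0| * B).
Proof.
move=> t0 hu; rewrite normrM (normrM A0) normfV.
have tp : 0 < `|t| by rewrite normr_gt0.
have -> : `|t| * (`|A0| * B) = `|A0| * (`|t| * B) by ring.
rewrite -mulrA ler_wpM2l// ler_pdivrMl//.
by rewrite mulrA -expr2 real_normK ?num_real.
Qed.

Lemma reg1_mean t : t != 0 -> `|\int[nu0]_x reg1 t x| <= q0 * `|t|.
Proof.
move=> t0; have [cr sr] := reg1_cb t.
have m (f : vec R d -> R) : cb f -> shinv f -> nu0.-integrable setT (EFin \o (f : PRmax R d -> R)).
  by move=> cf sf; apply: bmf_integrable; exact: (bmf_PR i0).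
have ch0 : cb (hcos 0) by apply: fibre_int_cb; exact: bmf_coslin.
have sh0 : shinv (hcos 0) by exact: fibre_int_shinv.
have cAg : cb (fun x => A0 * g x) by exact: cbZ.
have sAg : shinv (fun x => A0 * g x) by move=> x a; rewrite sg.
have cr1 : cb (fun x => reg1 t x - hcos 0 x) by exact: cbB.
have sr1 : shinv (fun x => reg1 t x - hcos 0 x) by move=> x a; rewrite sr sh0.
have -> : \int[nu0]_x reg1 t x = \int[nu0]_x (reg1 t x - hcos 0 x - A0 * g x).
  rewrite (RintegralB _ (m _ cr1 sr1) (m _ cAg sAg))// (RintegralB _ (m _ cr sr) (m _ ch0 sh0))//.
  rewrite (RintegralZl _ _ (m _ cg sg))// -/a0.
  rewrite -[\int[nu0]_x g x]/mu /A0; field; exact: lt0r_neq0.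
apply: norm_Rintegral_prob_le => [|x].
  by apply: m; [exact: cbB | move=> x a; rewrite sr1 sAg].
have -> : reg1 t x - hcos 0 x - A0 * g x = (hcos t x - hcos 0 x) + A0 / t * (tsin t x - t * g x).
  by rewrite /reg1; field.
rewrite (le_trans (ler_normD _ _))// [leRHS]mulrC /q0 [leRHS]mulrDr; apply: lerD.
  by have := hcos_lip t 0 x; rewrite subr0.
by apply: div_sqr_le => //; exact: tsin_mean.
Qed.

Lemma reg2_mean t : t != 0 -> `|\int[nu0]_x reg2 t x| <= q0 * `|t|.
Proof.
move=> t0; have [cr sr] := reg2_cb t.
apply: norm_Rintegral_prob_le => [|x].
  by apply: bmf_integrable; exact: (bmf_PR i0).
rewrite (le_trans (ler_normD _ _))// [leRHS]mulrC /q0 [leRHS]mulrDr; apply: lerD.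
  by have := hsin_lip t 0 x; rewrite hsin0 !subr0.
by apply: div_sqr_le => //; rewrite distrC; exact: tcos_mean.
Qed.

(** Since [u] is Lipschitz and vanishes at 0, [u s / s] is bounded; the difference quotient loses a
    single factor [1 / t]. *)
Lemma quotient_lip (u : R -> R) t s : t != 0 -> s != 0 ->
  (forall r r', `|u r - u r'| <= `|r - r'| * b) -> u 0 = 0 ->
  `|A0 / t * u t - A0 / s * u s| <= `|t - s| / `|t| * (2 * (`|A0| * b)).
Proof.
move=> t0 s0 ul u0.
have -> : A0 / t * u t - A0 / s * u s = A0 / t * ((u t - u s) - (t - s) / s * u s).
  by field; rewrite t0 s0.
rewrite normrM normrM normfV.
have tp : 0 < `|t| by rewrite normr_gt0.
have h1 := ul t s; have := ul s 0; rewrite u0 !subr0 => h2.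
have h3 : `|(t - s) / s * u s| <= `|t - s| * b.
  by rewrite !normrM normfV -mulrA ler_wpM2l// ler_pdivrMl ?normr_gt0.
have -> : `|t - s| / `|t| * (2 * (`|A0| * b)) = `|A0| / `|t| * (`|t - s| * b + `|t - s| * b) by ring.
apply: ler_wpM2l; first by rewrite divr_ge0.
by rewrite (le_trans (ler_normB _ _))// lerD.
Qed.

Let Mk L := L * c0 + 2 * (`|A0| * b).

Lemma scale_le (L t s c : R) : t != 0 -> `|t| <= L -> 0 <= c ->
  `|t - s| * c <= `|t - s| / `|t| * (L * c).
Proof.
move=> t0 tL c'; rewrite -mulrA ler_wpM2l// ler_pdivlMl ?normr_gt0//.
by rewrite ler_wpM2r.
Qed.

Lemma reg1_lip (L t s : R) x : t != 0 -> s != 0 -> `|t| <= L ->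
  `|reg1 t x - reg1 s x| <= `|t - s| / `|t| * Mk L.
Proof.
move=> t0 s0 tL.
have -> : reg1 t x - reg1 s x = (hcos t x - hcos s x) + (A0 / t * tsin t x - A0 / s * tsin s x).
  by rewrite /reg1; ring.
rewrite (le_trans (ler_normD _ _))// /Mk [leRHS]mulrDr; apply: lerD.
  by rewrite (le_trans (hcos_lip _ _ _))//; exact: scale_le.
apply: (@quotient_lip (fun r => tsin r x)) => //; last exact: tsin0.
by move=> r r'; exact: tsin_lip.
Qed.

Lemma reg2_lip (L t s : R) x : t != 0 -> s != 0 -> `|t| <= L ->
  `|reg2 t x - reg2 s x| <= `|t - s| / `|t| * Mk L.
Proof.
move=> t0 s0 tL.
have -> : reg2 t x - reg2 s x =
   (hsin t x - hsin s x) + (A0 / t * (1 - tcos t x) - A0 / s * (1 - tcos s x)).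
  by rewrite /reg2; ring.
rewrite (le_trans (ler_normD _ _))// /Mk [leRHS]mulrDr; apply: lerD.
  by rewrite (le_trans (hsin_lip _ _ _))//; exact: scale_le.
apply: (@quotient_lip (fun r => 1 - tcos r x)) => //; last by rewrite tcos0 subrr.
move=> r r'; have -> : 1 - tcos r x - (1 - tcos r' x) = tcos r' x - tcos r x by ring.
by rewrite distrC; exact: tcos_lip.
Qed.

(** In the Lipschitz bound, one factor [1 / t] comes from the quotients by [t] in [reg1] and [reg2],
    the other from the a priori bound, which charges the means of the right-hand side divided by
    [t]. *)
Definition regular_family (f1 f2 : R -> vec R d -> R) :=
  [/\ forall t, t != 0 -> [/\ cb (f1 t) /\ shinv (f1 t), cb (f2 t) /\ shinv (f2 t) &
      forall x, f1 t x - tw t (f1 t) (fun y => f2 t y - A0 / t) x = hcos t x /\ f2 t x - A0 / t - tw t (fun y => f2 t y - A0 / t) (fun y => - f1 t y) x = hsin t x] &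
   forall L : R, exists2 C, 0 <= C & forall t x, t != 0 -> `|t| <= L ->
     [/\ `|f1 t x| <= C, `|f2 t x| <= C &
      forall s, s != 0 -> `|s| <= L -> `|f1 t x - f1 s x| <= C * (`|t - s| / t ^+ 2) /\ `|f2 t x - f2 s x| <= C * (`|t - s| / t ^+ 2)]].

Lemma regular_solution : exists f1 f2 : R -> vec R d -> R,
  forall t, t != 0 -> twisted_solution P A phi t (f1 t) (f2 t) (reg1 t) (reg2 t).
Proof.
have H1 t : exists f : (vec R d -> R) * (vec R d -> R), t != 0 ->
    twisted_solution P A phi t f.1 f.2 (reg1 t) (reg2 t).
  have [->|t0] := eqVneq t 0; first by exists (fun=> 0, fun=> 0).
  have [cr1 sr1] := reg1_cb t; have [cr2 sr2] := reg2_cb t.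
  have [f1 [f2]] := twist_resolvent tA wna t0 cr1 sr1 cr2 sr2.
  by move=> hf; exists (f1, f2) => _; case: hf => *; split.
have [F HF] := choice H1.
by exists (fun t => (F t).1), (fun t => (F t).2).
Qed.

Lemma regular_family_ex : exists f1 f2, regular_family f1 f2.
Proof.
have [f1 [f2 sol]] := regular_solution; exists f1, f2; split.
  move=> t t0; have [[c1 s1] [c2 s2] _ _ [e1 e2]] := sol t t0.
  have cc c : cb (fun _ : vec R d => c : R) by exact: cb_cst.
  have eq1 x : tw t (f1 t) (fun y => f2 t y - A0 / t) x = tw t (f1 t) (f2 t) x + A0 / t * tsin t x.
    have := twistB t x c1 c2 (cc 0) (cc (A0 / t)); rewrite (_ : (fun y => f1 t y - 0) = f1 t); last first.
      by apply/funext => y; rewrite subr0.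
    move=> ->; rewrite /tsin mulrN; congr (_ - _).
    rewrite -(twistZ t (A0 / t) x (cc 0) (cc 1)); congr tw; apply/funext => y; by rewrite ?mulr0 ?mulr1.
  have eq2 x : tw t (fun y => f2 t y - A0 / t) (fun y => - f1 t y) x =
      tw t (f2 t) (fun y => - f1 t y) x - A0 / t * tcos t x.
    have := twistB t x c2 (cbN c1) (cc (A0 / t)) (cc 0).
    rewrite (_ : (fun y => - f1 t y - 0) = (fun y => - f1 t y)); last first.
      by apply/funext => y; rewrite subr0.
    move=> ->; congr (_ - _).
    rewrite -(twistZ t (A0 / t) x (cc 1) (cc 0)); congr tw; apply/funext => y; by rewrite ?mulr0 ?mulr1.
  split => // x; split.
    by rewrite eq1 opprD addrA e1 /reg1 addrK.
  rewrite eq2.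
  have -> : f2 t x - A0 / t - (tw t (f2 t) (fun y => - f1 t y) x - A0 / t * tcos t x) =
    (f2 t x - tw t (f2 t) (fun y => - f1 t y) x) - A0 / t * (1 - tcos t x) by ring.
  by rewrite e2 /reg2 addrK.
move=> L; have [C C0 HC] := apriori tA rX0 iid tphi B0 HB i0 inv p0 pE mu0 wna L.
pose C1 := C * (H * (2 * K) + `|A0| * b + q0).
have q00 : 0 <= q0 by rewrite addr_ge0// mulr_ge0.
have C10 : 0 <= C1 by apply: mulr_ge0 => //; apply: addr_ge0 => //; apply: addr_ge0; apply: mulr_ge0 => //; exact: mulr_ge0.
have bd t x : t != 0 -> `|t| <= L -> `|f1 t x| <= C1 /\ `|f2 t x| <= C1.
  move=> t0 tL; apply: (HC t t0 tL _ _ _ _ _ _ (sol t t0)).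
  - by move=> y; exact: reg1_abs.
  - by move=> y; exact: reg2_abs.
  - exact: reg1_mean.
  - exact: reg2_mean.
pose M := Mk `|L| + `|L| * (b * C1).
have M0 : 0 <= M by rewrite /M /Mk; nonneg.
pose C2 := C * (M * (`|L| + 1)).
have C20 : 0 <= C2 by rewrite /C2; nonneg.
exists (C1 + C2); first exact: addr_ge0.
move=> t x t0 tL; have [h1 h2] := bd t x t0 tL; split.
- by rewrite (le_trans h1)// lerDl.
- by rewrite (le_trans h2)// lerDl.
move=> s s0 sL; have [[c1 s1] [c2 s2] [ck1 sk1] [ck2 sk2] [e1 e2]] := sol t t0.
have [[c1' s1'] [c2' s2'] [ck1' sk1'] [ck2' sk2'] [e1' e2']] := sol s s0.
have tp : 0 < `|t| by rewrite normr_gt0.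
have tLL : `|t| <= `|L| by rewrite (le_trans tL)// ler_norm.
(* The difference of the solutions at [t] and [s] solves the equation at [t]; its right-hand side is
   the variation of the data plus the variation of the operator applied to the solution at [s]. Its
   mean is only bounded by its size [D], hence [q] is [D] divided by the absolute value of [t]. *)
pose u1 y := f1 t y - f1 s y; pose u2 y := f2 t y - f2 s y.
have cu1 : cb u1 by exact: cbB.
have cu2 : cb u2 by exact: cbB.
have su1 : shinv u1 by move=> y a; rewrite /u1 s1 s1'.
have su2 : shinv u2 by move=> y a; rewrite /u2 s2 s2'.
have cuN : cb (fun y => - u1 y) by exact: cbN.
have suN : shinv (fun y => - u1 y) by move=> y a; rewrite su1.
pose k1 y := u1 y - tw t u1 u2 y; pose k2 y := u2 y - tw t u2 (fun z => - u1 z) y.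
have ck : cb k1 /\ shinv k1.
  by split; [apply: cbB => //; exact: cb_twist | move=> y a; rewrite /k1 su1 shinv_twist].
have ck' : cb k2 /\ shinv k2.
  by split; [apply: cbB => //; exact: cb_twist | move=> y a; rewrite /k2 su2 shinv_twist].
pose D := `|t - s| / `|t| * M.
have D0 : 0 <= D by rewrite /D; apply: mulr_ge0 => //; rewrite divr_ge0.
have K1 y : `|k1 y| <= D.
  have -> : k1 y = (reg1 t y - reg1 s y) + (tw t (f1 s) (f2 s) y - tw s (f1 s) (f2 s) y).
    by rewrite -e1 -e1' /k1 /u1 /u2 twistB//; rewrite /tw; ring.
  rewrite (le_trans (ler_normD _ _))// /D /M [leRHS]mulrDr; apply: lerD; first exact: reg1_lip.
  apply: (@le_trans _ _ (`|t - s| * (b * C1))).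
    rewrite mulrA; apply: (twist_lip tA tphi HB) => // z; by have [] := bd s z s0 sL.
  by apply: scale_le => //; exact: mulr_ge0.
have K2 y : `|k2 y| <= D.
  have -> : k2 y = (reg2 t y - reg2 s y) +
      (tw t (f2 s) (fun z => - f1 s z) y - tw s (f2 s) (fun z => - f1 s z) y).
    rewrite -e2 -e2' /k2 /u2 (_ : (fun z => - u1 z) = (fun z => - f1 t z - - f1 s z)).
      by rewrite twistB//; try exact: cbN; rewrite /tw; ring.
    by apply/funext => z; rewrite /u1; ring.
  rewrite (le_trans (ler_normD _ _))// /D /M [leRHS]mulrDr; apply: lerD; first exact: reg2_lip.
  apply: (@le_trans _ _ (`|t - s| * (b * C1))).
    rewrite mulrA; apply: (twist_lip tA tphi HB) => //; first exact: cbN.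
      by move=> z; have [] := bd s z s0 sL.
    by move=> z; rewrite normrN; have [] := bd s z s0 sL.
  by apply: scale_le => //; exact: mulr_ge0.
have mean k : cb k -> shinv k -> (forall y, `|k y| <= D) ->
    `|\int[nu0]_y k y| <= D / `|t| * `|t|.
  move=> c k' kD; rewrite divfK ?gt_eqF//; apply: norm_Rintegral_prob_le => //.
  by apply: bmf_integrable; exact: (bmf_PR i0).
have so : twisted_solution P A phi t u1 u2 k1 k2 by split.
have [r1 r2] := HC t t0 tL _ _ _ _ _ _ so K1 K2 (mean _ ck.1 ck.2 K1) (mean _ ck'.1 ck'.2 K2) x.
have e : C * (D + D / `|t|) = C * (M * (`|t| + 1)) * (`|t - s| / t ^+ 2).
  by rewrite /D -(real_normK (num_real t)); field; rewrite gt_eqF.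
have le1 : C * (D + D / `|t|) <= (C1 + C2) * (`|t - s| / t ^+ 2).
  rewrite e; apply: ler_wpM2r; first by rewrite divr_ge0// sqr_ge0.
  rewrite (@le_trans _ _ C2)// ?lerDr// /C2; apply: ler_wpM2l => //; apply: ler_wpM2l => //.
  by rewrite lerD2r.
by split; [exact: le_trans r1 le1 | exact: le_trans r2 le1].
Qed.

End regularized.

(** * The Riemann-Lebesgue lemma and Fejer kernels *)

Section interval_integrals.
Context {R : realType}.
Local Notation mu := (@lebesgue_measure R).

Lemma measurable_inv : measurable_fun setT (fun t : R => t^-1).
Proof.
rewrite -(setvU [set (0 : R)]); apply/measurable_funU => //.
  by apply: measurableC.
split; last exact: measurable_fun_set1.
apply: open_continuous_measurable_fun.
  by apply: closed_openC; exact: closed_eq.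
move=> t; rewrite inE /= => /eqP t0.
by apply: (@continuousV R R (fun y : R => y) t).
Qed.

Lemma leb_Rintegral (K : R) (f : R -> R) : measurable_fun setT f ->
  \int[leb K]_s f s = \int[mu]_(s in `[- K, K]) f s.
Proof.
move=> mf; rewrite /Rintegral; congr fine.
rewrite integralE [RHS]integralE; have mEf : measurable_fun setT (EFin \o f) by exact/measurable_EFinP.
congr (_ - _)%E; apply: ge0_integral_mrestr => //.
- exact: measurable_funepos.
- exact: measurable_funeneg.
Qed.

Lemma leb_Rintegral_supp (K c : R) (f : R -> R) : measurable_fun setT f -> c <= K ->
  (forall s, c < `|s| -> f s = 0) ->
  \int[leb K]_s f s = \int[mu]_(s in `[- c, c]) f s.
Proof.
move=> mf cK f0; rewrite leb_Rintegral// Rintegral_mkcond [RHS]Rintegral_mkcond.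
congr Rintegral; apply/funext => s; rewrite /patch !mem_setE /= !in_itv /= -!ler_norml.
have [sc|sc] := leP `|s| c; first by rewrite (le_trans sc cK).
by rewrite f0// if_same.
Qed.

Lemma bmf_itv_integrable (a b : R) (f : R -> R) : bmf f -> mu.-integrable `[a, b] (EFin \o f).
Proof.
move=> [mf [M fM]]; apply: measurable_bounded_integrable => //.
- by rewrite /= lebesgue_measure_itv /=; case: ifPn => // _; rewrite -EFinD ltry.
- exact: measurable_funTS.
- exists M; split; first exact: num_real.
  by move=> N MN x _ /=; exact: le_trans (fM x) (ltW MN).
Qed.

Lemma FTC_itv (a b : R) (f F : R -> R) : a <= b -> (forall s : R, is_derive s 1 F (f s)) ->
  continuous f -> \int[mu]_(s in `[a, b]) f s = F b - F a.
Proof.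
rewrite le_eqVlt => /predU1P[->|ab] dF cf.
  by rewrite set_itv1 Rintegral_set1 subrr.
have cF : continuous F.
  by move=> s; apply: differentiable_continuous; apply/derivable1_diffP; case: (dF s).
rewrite /Rintegral (@continuous_FTC2 _ f F)//.
- by apply: continuous_subspaceT.
- split => [s _||]; first by case: (dF s).
  + by apply: cvg_at_right_filter; exact: cF.
  + by apply: cvg_at_left_filter; exact: cF.
- by move=> s _; rewrite derive1E; case: (dF s).
Qed.

Lemma FTC_leb (K : R) (f F : R -> R) : 0 <= K -> (forall s : R, is_derive s 1 F (f s)) ->
  continuous f -> \int[leb K]_s f s = F K - F (- K).
Proof.
move=> K0 dF cf; rewrite leb_Rintegral; last exact: continuous_measurable_fun.
by apply: FTC_itv => //; lra.
Qed.

Lemma lebesgue_measure_shift (c : R) (A : set (measurableTypeR R)) : measurable A ->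
  pushforward mu (fun t : measurableTypeR R => (t + c : measurableTypeR R)) A = mu A.
Proof.
have mc : measurable_fun setT (fun t : measurableTypeR R => (t + c : measurableTypeR R)).
  by apply: measurable_funD => //; exact: measurable_cst.
move=> mA; apply/esym/lebesgue_measure_unique => //= _ [[a b]] _ <-.
rewrite /pushforward /=.
have -> : (fun t => t + c) @^-1` `]a, b] = `]a - c, b - c]%classic.
  by apply/seteqP; split => t /=; rewrite !in_itv /= => /andP[h1 h2]; apply/andP; split; lra.
rewrite !lebesgue_measure_itv /= !lte_fin; congr (if _ then _ else _).
  by apply/idP/idP; lra.
by rewrite -!EFinD; congr EFin; ring.
Qed.

(** The support lies in [[-1, 1]], half of the domain of integration: this leaves room for a shift
    of length at most 1, so translation invariance has no boundary terms. *)
Lemma leb2_shift (c : R) (f : R -> R) : `|c| <= 1 -> bmf f -> (forall s, 1 < `|s| -> f s = 0) ->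
  \int[leb 2]_s f (s + c) = \int[leb 2]_s f s.
Proof.
move=> c1 bf f0; have [mf _] := bf; have /andP[c2 c3] : (- 1 <= c <= 1) by rewrite -ler_norml.
have mc : measurable_fun setT (fun t : measurableTypeR R => (t + c : measurableTypeR R)).
  by apply: measurable_funD => //; exact: measurable_cst.
have mfc : measurable_fun setT (fun s : R => f (s + c)) by apply: (measurableT_comp mf).
rewrite leb_Rintegral// [RHS](@leb_Rintegral_supp 2 1 f)//; last by lra.
rewrite Rintegral_mkcond [RHS]Rintegral_mkcond.
have int1 : mu.-integrable setT (EFin \o (f \_ `[(-1 : R), 1])).
  by rewrite -restrict_EFin -integrable_mkcond//; exact: bmf_itv_integrable.
have e1 : (fun s => f (s + c)) \_ `[- 2, 2] = (f \_ `[(-1 : R), 1]) \o (fun s => s + c).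
  apply/funext => s; rewrite /patch /= !mem_setE /= !in_itv /= -!ler_norml.
  have [s1|s1] := leP `|s + c| 1; last by rewrite f0// if_same.
  rewrite ifT//; move: s1; rewrite !ler_norml => /andP[h1 h2]; apply/andP; split; lra.
rewrite e1 /Rintegral; congr fine.
pose ph := (fun t : measurableTypeR R => (t + c : measurableTypeR R)).
have mEf : measurable_fun setT (EFin \o (f \_ `[(-1 : R), 1])).
  exact: (measurable_int _ int1).
have int2 : mu.-integrable (ph @^-1` setT) ((EFin \o (f \_ `[(-1 : R), 1])) \o ph).
  rewrite preimage_setT [X in integrable _ _ X](_ : _ = EFin \o ((fun s => f (s + c)) \_ `[(- 2 : R), 2])); last first.
    by rewrite e1.
  rewrite -restrict_EFin -integrable_mkcond//; apply: bmf_itv_integrable; split => //.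
  by have [_ [M fM]] := bf; exists M => s; exact: fM.
have <- := integral_pushforward mc mEf int2 measurableT.
by apply: eq_measure_integral => B mB _; exact: (lebesgue_measure_shift c mB).
Qed.

End interval_integrals.

Section riemann_lebesgue.
Context {R : realType}.

(* Amplitudes with the singularity at [0] that dividing by a twisted resolvent creates. *)
Definition amplitude (C : R) (m : R -> R) :=
  [/\ m 0 = 0, forall t, `|m t| <= C, forall t, 1 < `|t| -> m t = 0 &
   forall t s, t != 0 -> `|m t - m s| <= C * (`|t - s| * (1 + (t ^+ 2)^-1))].

Lemma amplitude_sqr_dist C m (t s : R) : amplitude C m ->
  `|t ^+ 2 * m t - s ^+ 2 * m s| <= `|t - s| * (C * (1 + t ^+ 2 + `|t| + `|s|)).
Proof.
move=> [m0 mC _ ml]; have C0 : 0 <= C by rewrite (le_trans _ (mC 0)).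
have -> : t ^+ 2 * m t - s ^+ 2 * m s = t ^+ 2 * (m t - m s) + (t - s) * (t + s) * m s by ring.
rewrite (le_trans (ler_normD _ _))//.
have h1 : `|t ^+ 2 * (m t - m s)| <= `|t - s| * (C * (1 + t ^+ 2)).
  have [->|t0] := eqVneq t 0.
    by rewrite expr0n /= !mul0r normr0 addr0 mulr1 mulr_ge0.
  have t2 : 0 < t ^+ 2 by rewrite exprn_even_gt0.
  rewrite normrM (gtr0_norm t2) -ler_pdivlMl// (le_trans (ml _ s t0))//.
  by rewrite le_eqVlt; apply/orP; left; apply/eqP; field.
have h2 : `|(t - s) * (t + s) * m s| <= `|t - s| * ((`|t| + `|s|) * C).
  rewrite !normrM -mulrA ler_wpM2l//; apply: ler_pM => //; exact: ler_normD.
lra.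
Qed.

(** The factor [t ^+ 2] removes the singularity at 0. As [m 0 = 0], the amplitude is recovered from
    this continuous function by dividing again, which yields its measurability. *)
Lemma amplitude_sqr_continuous C m : amplitude C m -> continuous (fun t : R => t ^+ 2 * m t).
Proof.
move=> mA t; have [_ mC _ _] := mA; have C0 : 0 <= C by rewrite (le_trans _ (mC 0)).
pose D := C * (2 + t ^+ 2 + 2 * `|t|) + 1.
have D0 : 0 < D by rewrite /D ltr_wpDl// mulr_ge0// !addr_ge0 ?sqr_ge0 ?mulr_ge0.
apply/cvgrPdist_lt => e e0; apply/nbhs_ballP.
exists (Num.min 1 (e / D)) => /=; first by rewrite lt_min ltr01 divr_gt0.
move=> s; rewrite /ball /= lt_min => /andP[ts1 ts2].
rewrite (le_lt_trans (amplitude_sqr_dist t s mA))//.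
move: ts2; rewrite ltr_pdivlMr//; apply: le_lt_trans; rewrite ler_wpM2l//.
have hs : `|s| <= `|t| + 1.
  have := ler_normB t (t - s); rewrite (_ : t - (t - s) = s); last by ring.
  by move=> h; rewrite (le_trans h)// lerD2l ltW.
have : C * (1 + t ^+ 2 + `|t| + `|s|) <= C * (2 + t ^+ 2 + 2 * `|t|) by rewrite ler_wpM2l//; lra.
by rewrite /D; lra.
Qed.

Lemma amplitude_sqrE C m t : amplitude C m -> m t = t ^+ 2 * m t * (t ^+ 2)^-1.
Proof.
move=> [m0 _ _ _]; have [->|t0] := eqVneq t 0; first by rewrite m0 mulr0 mul0r.
by rewrite mulrAC divff ?mul1r// sqrf_eq0.
Qed.

Lemma amplitude_bmf C m : amplitude C m -> bmf m.
Proof.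
move=> mA; split; last by have [_ mC _ _] := mA; exists C.
rewrite (_ : m = fun t : R => t ^+ 2 * m t * (t ^+ 2)^-1); last first.
  by apply/funext => t; exact: amplitude_sqrE mA.
apply: measurable_funM; first by apply: continuous_measurable_fun; exact: amplitude_sqr_continuous mA.
by apply: (measurableT_comp measurable_inv); exact: measurable_funX.
Qed.

Definition ind_ball (d t : R) : R := if `|t| <= d then 1 else 0.

Lemma bmf_ind_ball d : bmf (ind_ball d).
Proof.
split; last by exists 1 => t; rewrite /ind_ball; case: ifP; rewrite ?normr1 ?normr0.
rewrite (_ : ind_ball d = \1_(`[- d, d]%classic : set R)); first exact: measurable_indic.
by apply/funext => t; rewrite /ind_ball indicE mem_setE /= in_itv /= -ler_norml; case: (_ <= _).
Qed.

Lemma leb2_ball (d : R) : 0 <= d -> d <= 2 -> \int[leb 2]_t ind_ball d t = 2 * d.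
Proof.
move=> d0 d2; have mi := (bmf_ind_ball d).1.
rewrite (leb_Rintegral_supp mi d2); last by move=> s ds; rewrite /ind_ball leNgt ds.
transitivity (\int[@lebesgue_measure R]_(t in `[- d, d]) 1).
  apply: eq_Rintegral => s; rewrite inE /= in_itv /= -ler_norml /ind_ball => -> //.
rewrite Rintegral_cst// /= lebesgue_measure_itv /= lte_fin mul1r.
by case: ltP => [_|h]; [rewrite -EFinD /=; ring | rewrite /=; lra].
Qed.

(* Translating by half a period changes the sign of the oscillating factor. *)
Lemma oscillation_bound C m (e : R -> R) b d : amplitude C m -> bmf e ->
  (forall u, e (u + pi) = - e u) -> (forall u, `|e u| <= 1) ->
  pi <= `|b| -> 0 < d -> d <= 1 ->
  `|\int[leb 2]_t (m t * e (b * t))| <= C * (2 * d + 4 * (pi / `|b|) / d ^+ 2).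
Proof.
move=> mA be epi e1 bpi d0 d1; have d2 : d <= 2 by lra.
 have [m0 mC mS ml] := mA; have bm := amplitude_bmf mA.
have C0 : 0 <= C by rewrite (le_trans _ (mC 0)).
have b0 : 0 < `|b| by rewrite (lt_le_trans _ bpi)// pi_gt0.
pose c := pi / b.
have c_norm : `|c| = pi / `|b| by rewrite /c normrM normfV gtr0_norm// pi_gt0.
have c1 : `|c| <= 1 by rewrite c_norm ler_pdivrMr// mul1r.
have ml' : measurable_fun setT (fun t : R => b * t).
  by apply: measurable_funM => //; exact: measurable_cst.
have bw : bmf (fun t : R => e (b * t)).
  by split; [apply: (measurableT_comp be.1) | exists 1].
have bme : bmf (fun t : R => m t * e (b * t)) by exact: bmfM.
have mc : measurable_fun setT (fun t : R => t + c).
  by apply: measurable_funD => //; exact: measurable_cst.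
have bmc : bmf (fun t : R => m (t + c)).
  by split; [apply: (measurableT_comp bm.1) | exists C].
have me0 s : 1 < `|s| -> m s * e (b * s) = 0 by move=> s1; rewrite mS// mul0r.
have sh := leb2_shift c1 bme me0.
have sh2 : \int[leb 2]_t (m t * e (b * t)) = - \int[leb 2]_t (m (t + c) * e (b * t)).
  rewrite -sh -mulN1r -RintegralZl//; last by apply: bmf_integrable; exact: bmfM.
  apply: eq_Rintegral => t _; rewrite mulrDr /c (mulrC b (pi / b)) divfK -?normr_gt0//.
  by rewrite epi; ring.
set I := (X in `|X|).
have I2 : 2 * I = \int[leb 2]_t ((m t - m (t + c)) * e (b * t)).
  rewrite (_ : 2 * I = I + I); last by ring.
  rewrite {2}/I sh2 /I -RintegralB//.
  - by apply: eq_Rintegral => t _; ring.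
  - exact: bmf_integrable.
  - by apply: bmf_integrable; exact: bmfM.
(* Within [d] of 0, where the Lipschitz bound degenerates, the difference is at most [2 * C];
   beyond, [1 + (t ^+ 2)^-1] is at most [2 / d ^+ 2]. *)
pose D t : R := 2 * C * ind_ball d t + C * `|c| * 2 / d ^+ 2.
have d2' : 0 < d ^+ 2 by rewrite exprn_gt0.
have cd0 : 0 <= C * `|c| * 2 / d ^+ 2 by rewrite divr_ge0 ?mulr_ge0// ltW.
have bi := bmf_ind_ball d.
have bD1 : bmf (fun t => 2 * C * ind_ball d t).
  by apply: bmfM => //; exact: bmf_cst.
have bD : bmf D by apply: bmfD => //; exact: bmf_cst.
have pw t : `|(m t - m (t + c)) * e (b * t)| <= D t.
  rewrite normrM; apply: (@le_trans _ _ (`|m t - m (t + c)|)); first by rewrite ler_piMr.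
  rewrite /D /ind_ball.
  have [td|td] := leP `|t| d; rewrite ?mulr1 ?mulr0 ?add0r.
    by rewrite (le_trans (ler_normB _ _))//; have := mC t; have := mC (t + c); lra.
  have t0 : t != 0 by rewrite -normr_gt0 (lt_trans d0).
  rewrite (le_trans (ml _ _ t0))// opprD addrA subrr add0r normrN -!mulrA ler_wpM2l//.
  have t2 : 0 < t ^+ 2 by rewrite exprn_even_gt0.
  rewrite ler_wpM2l// mulrDl mul1r; apply: lerD.
    by rewrite invf_ge1// exprn_ile1// ltW.
  rewrite lef_pV2 ?posrE//.
  by rewrite -(real_normK (num_real t)) ler_sqr ?nnegrE ?(ltW d0) ?(ltW td).
have : `|2 * I| <= 2 * C * (2 * d) + C * `|c| * 2 / d ^+ 2 * 4.
  rewrite I2 (le_trans (le_normr_Rintegral _ _))//.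
    by apply: bmf_integrable; apply: bmfM => //; exact: bmfB.
  apply: (@le_trans _ _ (\int[leb 2]_t D t)).
    apply: le_Rintegral => //; try exact: bmf_integrable.
      by apply: bmf_integrable; apply: bmf_norm; apply: bmfM => //; exact: bmfB.
  have hD : \int[leb 2]_t D t = 2 * C * (2 * d) + C * `|c| * 2 / d ^+ 2 * 4.
    rewrite [LHS]RintegralD//; try exact: bmf_integrable; last by apply: bmf_integrable; exact: bmf_cst.
    rewrite RintegralZl//; last exact: bmf_integrable.
    rewrite leb2_ball ?(ltW d0)// Rintegral_cst// leb_setT//.
    by rewrite (_ : 2 * 2 = 4 :> R); [|ring].
  by rewrite le_eqVlt; apply/orP; left; apply/eqP; exact: hD.
rewrite normrM (gtr0_norm (_ : 0 < 2 :> R))// c_norm; set x := pi / _ => hI.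
have -> : C * (2 * d + 4 * x / d ^+ 2) = (2 * C * (2 * d) + C * x * 2 / d ^+ 2 * 4) / 2 by field; exact: lt0r_neq0.
by rewrite ler_pdivlMr// mulrC.
Qed.

(** The threshold depends on the amplitude only through [C]. This uniformity is essential: it is
    applied with amplitudes that vary with the point [x] whose value [phi x] is the frequency. *)
Lemma riemann_lebesgue C (eps : R) : 0 < eps -> exists2 b0, 0 < b0 & forall m b, amplitude C m ->
  b0 <= `|b| -> `|\int[leb 2]_t (m t * cos (b * t))| <= eps /\
    `|\int[leb 2]_t (m t * sin (b * t))| <= eps.
Proof.
move=> eps0; have [C0|C0] := ltP C 0.
  exists 1 => // m b [m0 mC _ _] _.
  by have := le_lt_trans (mC 0) C0; rewrite normr_lt0.
pose d := Num.min 1 (eps / (4 * (C + 1))).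
have C1 : 0 < 4 * (C + 1) by rewrite mulr_gt0// ltr_wpDl.
have d0 : 0 < d by rewrite lt_min ltr01 divr_gt0.
have d1 : d <= 1 by rewrite ge_min lexx.
have dC : 2 * C * d <= eps / 2.
  have : d <= eps / (4 * (C + 1)) by rewrite ge_min lexx orbT.
  rewrite ler_pdivlMr//; have := ltW d0; lra.
have pi0 := @pi_gt0 R.
pose b0 := Num.max pi (8 * C * pi / (d ^+ 2 * eps)).
have d2 : 0 < d ^+ 2 by rewrite exprn_gt0.
have b00 : 0 < b0 by rewrite lt_max pi0.
exists b0 => // m b mA bb.
have bp : pi <= `|b| by rewrite (le_trans _ bb)// le_max lexx.
have bpos : 0 < `|b| by rewrite (lt_le_trans pi0).
have hb : C * (4 * (pi / `|b|) / d ^+ 2) <= eps / 2.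
  have : 8 * C * pi / (d ^+ 2 * eps) <= `|b| by rewrite (le_trans _ bb)// le_max lexx orbT.
  rewrite ler_pdivrMr ?mulr_gt0// => h.
  rewrite (_ : C * (4 * (pi / `|b|) / d ^+ 2) = 8 * C * pi / (`|b| * d ^+ 2) / 2); last first.
    by field; rewrite !gt_eqF.
  rewrite ler_wpM2r// ler_pdivrMr ?mulr_gt0//; lra.
have fin : C * (2 * d + 4 * (pi / `|b|) / d ^+ 2) <= eps by rewrite mulrDr; lra.
split; apply: le_trans fin; apply: oscillation_bound => //.
- by apply: (@bmf_cos _ _ _ (fun u => u)).
- exact: cosDpi.
- exact: cos_max.
- by apply: (@bmf_sin _ _ _ (fun u => u)).
- exact: sinDpi.
- exact: sin_max.
Qed.

End riemann_lebesgue.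

(** * Tents, Fejer kernels and sine integrals *)

Section fejer.
Context {R : realType}.
Local Notation mu := (@lebesgue_measure R).

Definition tent (d t : R) : R := Num.max 0 (1 - `|t| / d).

Lemma tent_ge0 d t : 0 <= tent d t.
Proof. by rewrite /tent le_max lexx. Qed.

Lemma tent_le1 d t : 0 < d -> tent d t <= 1.
Proof. by move=> d0; rewrite /tent ge_max ler01 /= lerBlDr lerDl divr_ge0// ltW. Qed.

Lemma tent_out d t : 0 < d -> d <= `|t| -> tent d t = 0.
Proof. by move=> d0 dt; rewrite /tent max_l// subr_le0 ler_pdivlMr// mul1r. Qed.

Lemma tent_in d t : 0 < d -> `|t| <= d -> tent d t = 1 - `|t| / d.
Proof. by move=> d0 dt; rewrite /tent max_r// subr_ge0 ler_pdivrMr// mul1r. Qed.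

Lemma tent_ball d t : 0 < d -> tent d t <= ind_ball d t.
Proof.
move=> d0; rewrite /ind_ball; case: ifPn => [_|]; first exact: tent_le1.
by rewrite -ltNge => dt; rewrite tent_out// ltW.
Qed.

Lemma tent_lip d t s : 0 < d -> `|tent d t - tent d s| <= `|t - s| / d.
Proof.
move=> d0; have h1 : `|(1 - `|t| / d) - (1 - `|s| / d)| <= `|t - s| / d.
  have -> : (1 - `|t| / d) - (1 - `|s| / d) = (`|s| - `|t|) / d by ring.
  rewrite normrM normfV (gtr0_norm d0) ler_wpM2r ?invr_ge0 ?(ltW d0)//.
  by rewrite (distrC t); exact: ler_dist_dist.
apply: le_trans h1; rewrite /tent; set x := 1 - _; set y := 1 - _.
by rewrite ler_norml; case: (leP 0 x) => ?; case: (leP 0 y) => ?; have := ler_norm (x - y);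
  have := ler_norm (- (x - y)); rewrite normrN => ? ?; apply/andP; split; lra.
Qed.

Lemma tent_continuous d : 0 < d -> continuous (tent d).
Proof.
move=> d0 t; apply/cvgrPdist_lt => e e0; near=> s.
rewrite (le_lt_trans (tent_lip _ _ d0))// ltr_pdivrMr//; near: s.
by apply: (@cvgr_dist_lt _ R); [exact: cvg_id | exact: mulr_gt0].
Unshelve. all: by end_near. Qed.

Lemma bmf_tent d : 0 < d -> bmf (tent d).
Proof.
move=> d0; split; first by apply: continuous_measurable_fun; exact: tent_continuous.
by exists 1 => t; rewrite ger0_norm ?tent_ge0// tent_le1.
Qed.

Lemma tent_sub d t : 0 < d -> d <= 1 -> `|tent 1 t - tent d t| <= `|t| / d.
Proof.
move=> d0 d1; have dt : `|t| <= `|t| / d by rewrite ler_pdivlMr// ler_piMr.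
have h : tent d t <= tent 1 t.
  rewrite /tent divr1 ge_max le_max lexx /= le_max; apply/orP; right; lra.
rewrite ger0_norm ?subr_ge0//.
have := tent_le1 t (@ltr01 R).
have : 1 - `|t| / d <= tent d t by rewrite /tent le_max lexx orbT.
lra.
Qed.

(** It disposes of the value at [t = 0], where quotients by [t] take the default value 0. *)
Lemma leb2_eq (f g : R -> R) : bmf f -> bmf g -> (forall t, t != 0 -> f t = g t) ->
  \int[leb 2]_t f t = \int[leb 2]_t g t.
Proof.
move=> bf bg fg; apply/eqP; rewrite -subr_eq0 -normr_le0 -RintegralB//; try exact: bmf_integrable.
have bfg := bmfB bf bg; have [_ [M fM]] := bfg.
have M0 : 0 <= M by rewrite (le_trans _ (fM 0)).
apply/ler_addgt0Pr => e e0; rewrite add0r.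
pose d := Num.min 2 (e / (2 * (M + 1))).
have M1 : 0 < 2 * (M + 1) by rewrite mulr_gt0// ltr_wpDl.
have d0 : 0 < d by rewrite lt_min ltr0n divr_gt0.
have d2 : d <= 2 by rewrite ge_min lexx.
have de : d * (2 * (M + 1)) <= e by rewrite -ler_pdivlMr// ge_min lexx orbT.
have bi := bmfM (bmf_cst M) (bmf_ind_ball d).
apply: (@le_trans _ _ (M * (2 * d))); last by have := ltW d0; lra.
rewrite -leb2_ball ?(ltW d0)// -RintegralZl//; last by apply: bmf_integrable; exact: bmf_ind_ball.
rewrite (le_trans (le_normr_Rintegral _ _))//; first exact: bmf_integrable.
apply: le_Rintegral => //; try exact: bmf_integrable.
  by apply: bmf_integrable; exact: bmf_norm.
move=> t _; rewrite /ind_ball; case: ifPn => td; first by rewrite mulr1.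
rewrite mulr0 fg ?subrr ?normr0//; apply: contraNneq td => ->.
by rewrite normr0 ltW.
Qed.

Definition fejer (d s : R) := \int[leb 2]_t (tent d t * cos (t * s)).
(** The primitive of [fejer d] that vanishes at 0: nondecreasing because the Fejer kernel is
    nonnegative. It is what a pole at 0 contributes to a frequency integral against the tent. *)
Definition sinint (d s : R) := \int[leb 2]_t (tent d t * (sin (t * s) / t)).

Lemma mulr_meas (s : R) : measurable_fun setT (fun t : R => t * s).
Proof. by apply: measurable_funM => //; exact: measurable_cst. Qed.

Lemma sinq_abs (t s : R) : `|sin (t * s) / t| <= `|s|.
Proof.
have [->|t0] := eqVneq t 0; first by rewrite invr0 mulr0 normr0.
rewrite normrM normfV ler_pdivrMr ?normr_gt0// (le_trans (sin_abs _))//.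
by rewrite normrM mulrC.
Qed.

Lemma bmf_sinq s : bmf (fun t : R => sin (t * s) / t).
Proof.
split; last by exists `|s| => t; exact: sinq_abs.
apply: measurable_funM; last exact: measurable_inv.
by have [] := bmf_sin (mulr_meas s).
Qed.

Lemma derive_sinlin (s t : R) : is_derive t 1 (fun t : R => sin (t * s)) (s * cos (t * s)).
Proof.
have h : is_derive t 1 (fun t : R => t * s) s.
  by apply: is_derive_eq; rewrite -![_ *: _]/(_ * _) mulr1 mulr0 add0r.
have e := @is_derive1_comp _ sin (fun t : R => t * s) t _ _ (is_derive_sin (t * s)) h.
by apply: (is_derive_eq e); rewrite mulrC.
Qed.

Lemma derive_coslin (s t : R) : is_derive t 1 (fun t : R => cos (t * s)) (- (s * sin (t * s))).
Proof.
have h : is_derive t 1 (fun t : R => t * s) s.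
  by apply: is_derive_eq; rewrite -![_ *: _]/(_ * _) mulr1 mulr0 add0r.
have e := @is_derive1_comp _ cos (fun t : R => t * s) t _ _ (is_derive_cos (t * s)) h.
by apply: (is_derive_eq e); rewrite mulrC mulrN.
Qed.

Lemma derive_linear_cos (c s t : R) : s != 0 ->
  is_derive t 1 (fun t : R => (1 - c * t) * (sin (t * s) / s) - c / s ^+ 2 * cos (t * s))
    ((1 - c * t) * cos (t * s)).
Proof.
move=> s0; have h1 : is_derive t 1 (fun t : R => 1 - c * t) (- c).
  by apply: is_derive_eq; rewrite -![_ *: _]/(_ * _); ring.
have h2 := is_deriveM h1 (is_deriveZ s^-1 (derive_sinlin s t)).
have h3 := is_deriveB h2 (is_deriveZ (c / s ^+ 2) (derive_coslin s t)).
have -> : (fun t : R => (1 - c * t) * (sin (t * s) / s) - c / s ^+ 2 * cos (t * s)) =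
   (fun t : R => 1 - c * t) * (s^-1 \*: (fun t : R => sin (t * s))) -
     (c / s ^+ 2) \*: (fun t : R => cos (t * s)).
  by apply/funext => u; rewrite [sin _ / s]mulrC.
apply: (is_derive_eq h3); rewrite -![_ *: _]/(_ * _).
rewrite /= -![_ *: _]/(_ * _); by field.
Qed.

Lemma FTC_linear_cos (a b c s : R) : a <= b -> s != 0 ->
  \int[mu]_(t in `[a, b]) ((1 - c * t) * cos (t * s)) =
  ((1 - c * b) * (sin (b * s) / s) - c / s ^+ 2 * cos (b * s)) -
  ((1 - c * a) * (sin (a * s) / s) - c / s ^+ 2 * cos (a * s)).
Proof.
move=> ab s0; rewrite (@FTC_itv _ a b _ _ ab (fun t => derive_linear_cos c t s0))//.
move=> t; apply: (@continuousM _ _ (fun t => 1 - c * t) (fun t => cos (t * s)) t).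
  apply: (@continuousB _ _ _ (fun _ : R => 1 : R) (fun t : R => c * t) t); first exact: cst_continuous.
  exact: mulrl_continuous.
apply: (@continuous_comp _ _ _ (fun t : R => t * s) (@cos R) t); last exact: continuous_cos.
exact: mulrr_continuous.
Qed.

Lemma fejerE d s : 0 < d -> d <= 2 -> s != 0 -> fejer d s = 2 * (1 - cos (d * s)) / (d * s ^+ 2).
Proof.
move=> d0 d2 s0; have bt := bmf_tent d0.
have bc : bmf (fun t : R => cos (t * s)) by apply: bmf_cos; exact: mulr_meas.
have bf := bmfM bt bc.
rewrite /fejer (leb_Rintegral_supp bf.1 d2); last by move=> t dt; rewrite tent_out ?mul0r// ltW.
have int : mu.-integrable `[- d, d] (EFin \o (fun t => tent d t * cos (t * s))).
  exact: bmf_itv_integrable.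
have := @Rintegral_itvB R (fun t => tent d t * cos (t * s)) (BLeft (- d)) (BRight d) 0 int.
rewrite !bnd_simp oppr_le0 (ltW d0) => /(_ isT isT) hsplit.
have hr : \int[mu]_(t in `]0, d]) (tent d t * cos (t * s)) = (1 - cos (d * s)) / (d * s ^+ 2).
  rewrite Rintegral_itv_obnd_cbnd; last first.
    by apply: (integrableS _ _ _ int) => //; apply: subset_itvr; rewrite bnd_simp oppr_le0 ltW.
  transitivity (\int[mu]_(t in `[0, d]) ((1 - d^-1 * t) * cos (t * s))).
    apply: eq_Rintegral => t; rewrite inE /= in_itv /= => /andP[t0 td].
    by rewrite tent_in// ger0_norm// [d^-1 * t]mulrC.
  rewrite FTC_linear_cos ?(ltW d0)// mulVf ?gt_eqF// mul0r sin0 cos0.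
  by field; rewrite s0 (gt_eqF d0).
have hl : \int[mu]_(t in `[- d, 0]) (tent d t * cos (t * s)) = (1 - cos (d * s)) / (d * s ^+ 2).
  transitivity (\int[mu]_(t in `[- d, 0]) ((1 - (- d^-1) * t) * cos (t * s))).
    apply: eq_Rintegral => t; rewrite inE /= in_itv /= => /andP[td t0].
    by rewrite tent_in// ?ler0_norm//; [congr (_ * _); ring | rewrite lerNl].
  rewrite FTC_linear_cos ?oppr_le0 ?(ltW d0)// mulrNN mulVf ?gt_eqF// mul0r sin0 cos0 (mulNr d s) cosN.
  by field; rewrite s0 (gt_eqF d0).
by move: hsplit; rewrite hl => /eqP; rewrite subr_eq => /eqP ->; rewrite hr; ring.
Qed.

End fejer.

Section sine_integral.
Context {R : realType}.

Lemma cos_quad (x : R) : 0 <= 1 - cos x <= x ^+ 2.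
Proof.
rewrite subr_ge0 cos_le1 /=; have := cos_sub1 x; rewrite distrC.
exact: le_trans (ler_norm _).
Qed.

Lemma bmf_tentcos d s : 0 < d -> bmf (fun t : R => tent d t * cos (t * s)).
Proof. by move=> d0; apply: bmfM; [exact: bmf_tent | apply: bmf_cos; exact: mulr_meas]. Qed.

(** The domination by a Cauchy density has an explicit integral through [atan], which bounds
    [sinint d] by a constant independent of [d]. *)
Lemma fejer_bound (d s : R) : 0 < d -> d <= 2 ->
  0 <= fejer d s /\ fejer d s <= 8 * (d / (1 + (d * s) ^+ 2)).
Proof.
move=> d0 d2; have [->|s0] := eqVneq s 0.
  rewrite /fejer mulr0 expr0n /= addr0 divr1.
  have -> : (fun t : R => tent d t * cos (t * 0)) = tent d.
    by apply/funext => t; rewrite mulr0 cos0 mulr1.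
  split; first by apply: Rintegral_ge0 => t _; exact: tent_ge0.
  apply: (@le_trans _ _ (2 * d)); last by rewrite ler_wpM2r ?(ltW d0)// ler_nat.
  rewrite -leb2_ball ?(ltW d0)//; apply: le_Rintegral => //; last by move=> t _; exact: tent_ball.
    by apply: bmf_integrable; exact: bmf_tent.
  by apply: bmf_integrable; exact: bmf_ind_ball.
rewrite fejerE//; have ds : 0 < d * s ^+ 2 by rewrite mulr_gt0// exprn_even_gt0.
have := cos_quad (d * s); set X := (d * s) ^+ 2 => /andP[h1 h2].
have hX : X = d * (d * s ^+ 2) by rewrite /X; ring.
have X0 : 0 <= X by exact: sqr_ge0.
split; first by rewrite divr_ge0 ?(ltW ds)// mulr_ge0.
rewrite mulrA ler_pdivrMr// mulrAC ler_pdivlMr ?ltr_wpDr//.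
rewrite -mulrA -[leRHS]mulrA -hX.
have h3 : 1 - cos (d * s) <= 2 by have := cos_geN1 (d * s); lra.
have : (1 - cos (d * s)) * X <= 2 * X by rewrite ler_wpM2r.
lra.
Qed.

Lemma affine_meas (L p : R) : measurable_fun setT (fun s : R => L * (p - s)).
Proof.
apply: measurable_funM; first exact: measurable_cst.
by apply: measurable_funB => //; exact: measurable_cst.
Qed.

Lemma bmf_fejer_pair (d L p : R) : 0 < d ->
  bmf (fun z : measurableTypeR R * measurableTypeR R => tent d z.2 * cos (z.2 * (L * (p - z.1)))).
Proof.
move=> d0; apply: bmfM.
  split; last by exists 1 => z; rewrite ger0_norm ?tent_ge0// tent_le1.
  exact: (measurableT_comp (bmf_tent d0).1 measurable_snd).
apply: bmf_cos; apply: measurable_funM; first exact: measurable_snd.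
exact: (measurableT_comp (affine_meas L p) measurable_fst).
Qed.

Lemma bmf_fejer (d L p : R) : 0 < d -> bmf (fun s : R => fejer d (L * (p - s))).
Proof. by move=> d0; exact: (bmf_Rintegral2 (leb 2) (leb 2) (bmf_fejer_pair L p d0)). Qed.

Lemma derive_sinq (b p s : R) : b != 0 ->
  is_derive s 1 (fun s : R => - (sin (b * (p - s)) / b)) (cos (b * (p - s))).
Proof.
move=> b0; have h : is_derive s 1 (fun s : R => b * (p - s)) (- b).
  by apply: is_derive_eq; rewrite -![_ *: _]/(_ * _); ring.
have e := @is_derive1_comp _ sin (fun s : R => b * (p - s)) s _ _ (is_derive_sin _) h.
have e2 := is_deriveZ (- b^-1) e.
have -> : (fun s : R => - (sin (b * (p - s)) / b)) =
    - b^-1 \*: (sin \o (fun s : R => b * (p - s))).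
  by apply/funext => u /=; rewrite -[_ *: _]/(_ * _); ring.
apply: (is_derive_eq e2); rewrite -![_ *: _]/(_ * _).
by field.
Qed.

Lemma cos_affine_continuous (b p : R) : continuous (fun s : R => cos (b * (p - s))).
Proof.
move=> s; apply: (@continuous_comp _ _ _ (fun s : R => b * (p - s)) (@cos R) s); last exact: continuous_cos.
apply: (@continuousM _ _ (fun _ : R => b : R) (fun s : R => p - s) s); first exact: cst_continuous.
by apply: (@continuousB _ _ _ (fun _ : R => p : R) (fun s : R => s) s); first exact: cst_continuous.
Qed.

(** Fubini and the antiderivative of the cosine: the mass on [[- K, K]] of the Fejer kernel centred
    at [p] with scale [1 / L]. *)
Lemma sinint_diff (d L p K : R) : 0 < d -> 0 < L -> 0 <= K ->
  L * \int[leb K]_s fejer d (L * (p - s)) = sinint d (L * (p + K)) - sinint d (L * (p - K)).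
Proof.
move=> d0 L0 K0; have bF := bmf_fejer_pair L p d0; have bt := bmf_tent d0.
have -> : \int[leb K]_s fejer d (L * (p - s)) =
    \int[leb 2]_t \int[leb K]_s (tent d t * cos (t * (L * (p - s)))).
  exact: (bmf_Fubini (leb K) (leb 2) bF).
have bI : bmf (fun t => \int[leb K]_s (tent d t * cos (t * (L * (p - s))))).
  exact: (bmf_Rintegral1 (leb K) (leb 2) bF).
have bq u : bmf (fun t : R => tent d t * (sin (t * u) / t)) by apply: bmfM => //; exact: bmf_sinq.
rewrite -RintegralZl//; last exact: bmf_integrable.
rewrite /sinint -RintegralB//; try by apply: bmf_integrable; exact: bq.
apply: leb2_eq.
- by apply: bmfM => //; exact: bmf_cst.
- exact: bmfB.
move=> t t0; have tL : t * L != 0 by rewrite mulf_neq0// gt_eqF.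
rewrite RintegralZl//; last first.
  apply: bmf_integrable; apply: bmf_cos; apply: measurable_funM; first exact: measurable_cst.
  exact: affine_meas.
have -> : \int[leb K]_s cos (t * (L * (p - s))) = \int[leb K]_s cos (t * L * (p - s)).
  by apply: eq_Rintegral => s _; rewrite mulrA.
rewrite (FTC_leb K0 (fun s => derive_sinq p s tL) (@cos_affine_continuous _ _)).
have -> : p - - K = p + K by ring.
rewrite !(mulrA t L); set x := sin _; set y := sin _.
by field; rewrite t0 gt_eqF.
Qed.

Lemma bmf_tentsinq (d s : R) : 0 < d -> bmf (fun t : R => tent d t * (sin (t * s) / t)).
Proof. by move=> d0; apply: bmfM; [exact: bmf_tent | exact: bmf_sinq]. Qed.

Lemma sinintN (d s : R) : 0 < d -> sinint d (- s) = - sinint d s.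
Proof.
move=> d0; rewrite /sinint -[RHS]mulN1r -RintegralZl//; last by apply: bmf_integrable; exact: bmf_tentsinq.
by apply: eq_Rintegral => t _; rewrite mulrN sinN; ring.
Qed.

Lemma sinint_small (d s : R) : 0 < d -> d <= 2 -> `|sinint d s| <= `|s| * (2 * d).
Proof.
move=> d0 d2; have bi := bmf_ind_ball d; have bt := bmf_tentsinq s d0.
rewrite -leb2_ball ?(ltW d0)// -RintegralZl//; last exact: bmf_integrable.
rewrite (le_trans (le_normr_Rintegral _ _))//; first exact: bmf_integrable.
apply: le_Rintegral => //.
- by apply: bmf_integrable; exact: bmf_norm.
- by apply: bmf_integrable; apply: bmfM => //; exact: bmf_cst.
- move=> t _; rewrite normrM mulrC; apply: ler_pM => //; first exact: sinq_abs.
  by rewrite ger0_norm ?tent_ge0// tent_ball.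
Qed.

Lemma sinint_sym (d s : R) : 0 < d -> 0 <= s ->
  2 * sinint d s = \int[leb s]_u fejer d (1 * (0 - u)).
Proof.
move=> d0 s0; have := sinint_diff 0 d0 (@ltr01 R) s0.
by rewrite !mul1r sub0r add0r sinintN// => ->; ring.
Qed.

Lemma derive_atanlin (d u : R) : is_derive u 1 (fun u : R => 8 * atan (d * u))
  (8 * (d / (1 + (d * u) ^+ 2))).
Proof.
have h : is_derive u 1 (fun u : R => d * u) d.
  by apply: is_derive_eq; rewrite -![_ *: _]/(_ * _); ring.
have e := @is_derive1_comp _ (@atan R) (fun u : R => d * u) u _ _ (is_derive1_atan _) h.
have e2 := is_deriveZ 8 e.
have -> : (fun u : R => 8 * atan (d * u)) = 8 \*: (@atan R \o (fun u : R => d * u)) by [].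
by apply: (is_derive_eq e2); rewrite -![_ *: _]/(_ * _); congr (_ * _); rewrite mulrC.
Qed.

Lemma cauchy_continuous (d : R) : continuous (fun u : R => 8 * (d / (1 + (d * u) ^+ 2))).
Proof.
move=> u; apply: (@continuousM _ _ (fun _ : R => 8 : R) (fun u : R => d / (1 + (d * u) ^+ 2)) u).
  exact: cst_continuous.
apply: (@continuousM _ _ (fun _ : R => d : R) (fun u : R => (1 + (d * u) ^+ 2)^-1) u).
  exact: cst_continuous.
apply: (@continuousV _ _ (fun u : R => 1 + (d * u) ^+ 2) u).
  by rewrite gt_eqF// ltr_wpDr// sqr_ge0.
apply: (@continuousD _ _ _ (fun _ : R => 1 : R) (fun u : R => (d * u) ^+ 2) u).
  exact: cst_continuous.
apply: (@continuous_comp _ _ _ (fun u : R => d * u) (fun v : R => v ^+ 2) u).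
  exact: mulrl_continuous.
exact: exprn_continuous.
Qed.

Lemma sinint_bound_ge0 (d s : R) : 0 < d -> d <= 2 -> 0 <= s -> 0 <= sinint d s /\ sinint d s <= 16.
Proof.
move=> d0 d2 s0; have e := sinint_sym d0 s0; split.
  rewrite -(pmulr_rge0 _ (_ : 0 < 2 :> R))// e; apply: Rintegral_ge0 => u _.
  exact: (fejer_bound _ d0 d2).1.
have cc := @cauchy_continuous d.
have := FTC_leb s0 (derive_atanlin d) cc.
have a1 := atan_abs_le2 (d * s); have a2 := atan_abs_le2 (d * - s).
have : 8 * atan (d * s) - 8 * atan (d * - s) <= 32.
  by move: a1 a2; rewrite !ler_norml => /andP[? ?] /andP[? ?]; lra.
move=> h1 h2; suff : 2 * sinint d s <= 32 by lra.
rewrite e; apply: le_trans h1; rewrite -h2.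
apply: le_Rintegral => //.
- by apply: bmf_integrable; exact: bmf_fejer.
- apply: bmf_integrable; split; first exact: continuous_measurable_fun.
  exists (8 * d) => u; rewrite ger0_norm; last first.
    by apply: mulr_ge0 => //; rewrite divr_ge0 ?(ltW d0)// addr_ge0// sqr_ge0.
  rewrite ler_wpM2l// ler_pdivrMr ?ltr_wpDr ?sqr_ge0// mulrDr mulr1 lerDl.
  by rewrite mulr_ge0 ?sqr_ge0// ltW.
- move=> u _; apply: le_trans (fejer_bound _ d0 d2).2 _.
  by rewrite mul1r sub0r mulrN sqrrN.
Qed.

Lemma sinint_bound (d s : R) : 0 < d -> d <= 2 -> `|sinint d s| <= 16.
Proof.
move=> d0 d2; have [s0|s0] := leP 0 s.
  by have [h1 h2] := sinint_bound_ge0 d0 d2 s0; rewrite ger0_norm.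
have ns0 : 0 <= - s by rewrite oppr_ge0 ltW.
by have [h1 h2] := sinint_bound_ge0 d0 d2 ns0; rewrite -normrN -sinintN// ger0_norm.
Qed.

Lemma sinint_mono (d u v : R) : 0 < d -> d <= 2 -> u <= v -> sinint d u <= sinint d v.
Proof.
move=> d0 d2 uv; have K0 : 0 <= (v - u) / 2 by rewrite divr_ge0// subr_ge0.
have := sinint_diff ((u + v) / 2) d0 (@ltr01 R) K0; rewrite !mul1r.
have -> : (u + v) / 2 + (v - u) / 2 = v by field.
have -> : (u + v) / 2 - (v - u) / 2 = u by field.
move=> e; rewrite -subr_ge0 -e; apply: Rintegral_ge0 => s _.
exact: (fejer_bound _ d0 d2).1.
Qed.

Lemma fejer1_lower (u : R) : 3 / 8 * ind_ball 1 u <= fejer 1 u.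
Proof.
rewrite {1}/ind_ball; case: ifPn => u1; last first.
  rewrite mulr0; exact: (fejer_bound _ (@ltr01 R) (ler1n _ 2)).1.
have d1 : (2^-1 : R) <= 2 by lra.
have bi := bmf_ind_ball (2^-1 : R).
(* For [t] in [[-1/2, 1/2]], an interval of length 1, the tent is at least 1/2 and the cosine at
   least 3/4. *)
rewrite mulr1 (_ : 3 / 8 = 3 / 8 * (2 * 2^-1)); last by field.
rewrite -leb2_ball// ?invr_ge0// -RintegralZl//; last exact: bmf_integrable.
apply: le_Rintegral => //.
- by apply: bmf_integrable; apply: bmfM => //; exact: bmf_cst.
- by apply: bmf_integrable; exact: bmf_tentcos.
move=> t _; have [t1|t1] := leP 1 `|t|.
  rewrite tent_out// mul0r /ind_ball ifF ?mulr0//; apply/negbTE; rewrite -ltNge.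
  by apply: lt_le_trans t1; rewrite invf_lt1// ltr1n.
rewrite tent_in ?(ltW t1)// divr1.
have tu : (t * u) ^+ 2 <= `|t| ^+ 2.
  rewrite exprMn -(real_normK (num_real t)) -(real_normK (num_real u)).
  by rewrite ler_piMr ?sqr_ge0// exprn_ile1.
have /andP[_ h] := cos_quad (t * u).
have c1 : 1 - `|t| ^+ 2 <= cos (t * u) by lra.
have t0 := normr_ge0 t.
apply: (@le_trans _ _ ((1 - `|t|) * (1 - `|t| ^+ 2))); last by apply: ler_wpM2l => //; lra.
rewrite /ind_ball; case: ifPn => th; last first.
  rewrite mulr0 mulr_ge0//; first by lra.
  by rewrite subr_ge0 exprn_ile1// ltW.
have : `|t| ^+ 2 <= 1 / 4 by rewrite expr2; nra.
by nra.
Qed.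

Lemma sinint1_pos : 0 < sinint 1 (2 : R).
Proof.
have := sinint_sym (@ltr01 R) (_ : 0 <= 2); rewrite ler0n => /(_ isT) e.
have bi := bmf_ind_ball (1 : R).
suff : 3 / 8 * (2 * 1) <= 2 * sinint 1 (2 : R) by lra.
rewrite e -leb2_ball// ?ler1n// -RintegralZl//; last exact: bmf_integrable.
apply: le_Rintegral => //.
- by apply: bmf_integrable; apply: bmfM => //; exact: bmf_cst.
- by apply: bmf_integrable; exact: bmf_fejer.
move=> u _; rewrite mul1r sub0r; apply: le_trans (fejer1_lower (- u)).
by rewrite /ind_ball normrN.
Qed.

(** The limit is a supremum, by monotonicity. The constant [c0] occurs both in the mass [2 * c0] of
    the smoothing kernel and in the jump of the potential, so it cancels in the end. *)
Lemma sinint1_limit : exists2 c0 : R, 0 < c0 & forall e, 0 < e -> exists2 S, 0 < S &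
  forall s, S <= s -> `|sinint 1 s - c0| <= e /\ `|sinint 1 (- s) + c0| <= e.
Proof.
have d1 : (0 : R) < 1 := ltr01; have d2 : (1 : R) <= 2 by rewrite ler1n.
pose E := [set sinint 1 (s : R) | s in setT].
have hS : has_sup E.
  split; first by exists (sinint 1 (0 : R)); exists 0.
  by exists 16 => _ [s _ <-]; rewrite (le_trans (ler_norm _))// sinint_bound.
have ub s : sinint 1 s <= sup E by apply: ub_le_sup; [exact: hS.2 | exists s].
exists (sup E); first exact: lt_le_trans sinint1_pos (ub 2).
move=> e e0; have [_ [s0 _ <-] hs] := sup_adherent e0 hS.
exists (`|s0| + 1); first by rewrite ltr_wpDl.
move=> s ss; have h : `|sinint 1 s - sup E| <= e.
  have := sinint_mono d1 d2 (_ : s0 <= s).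
  have -> : s0 <= s by have := ler_norm s0; lra.
  move=> /(_ isT) m; rewrite distrC ger0_norm ?subr_ge0 ?ub//; lra.
by split => //; rewrite sinintN// addrC distrC.
Qed.

End sine_integral.

(** * Fejer smoothing along the fibres *)

Section smoothing.
Context {R : realType} (d : nat).
Variable phi : vec R d -> R.
Hypothesis tphi : topical_fun phi.
Variables (h : vec R d -> R) (H K : R).
Hypothesis ch : continuous h.
Hypothesis hH : forall x, `|h x| <= H.
Hypothesis K0 : 0 <= K.
Hypothesis hK : forall x, K < `|phi x| -> h x = 0.

Let H0 : 0 <= H. Proof. by rewrite (le_trans _ (hH 0)). Qed.

(* [e^{i L t phi x}] times the Fourier transform of [h] along the fibre of [x]. *)
Definition wave (L t : R) (x : vec R d) : R :=
  cos (L * t * phi x) * hcos phi h K (L * t) x - sin (L * t * phi x) * hsin phi h K (L * t) x.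

(** With [e = 1] this is the Fejer smoothing at scale [1 / L]. A small [e] keeps only the
    frequencies near the pole; this part is subtracted first and later shown to vanish with [e]. *)
Definition smooth (L e : R) (x : vec R d) : R := L * \int[leb 2]_t (tent e t * wave L t x).

Lemma smoothE (L e : R) x : 0 < e ->
  smooth L e x = L * \int[leb K]_s (fibre phi h x s * fejer e (L * (phi x - s))).
Proof.
move=> e0; congr (_ * _); have bf := bmf_fibre phi ch hH x.
have bp := bmf_fejer_pair L (phi x) e0.
have bF : bmf (fun z : measurableTypeR R * measurableTypeR R =>
    fibre phi h x z.1 * (tent e z.2 * cos (z.2 * (L * (phi x - z.1))))).
  apply: bmfM => //; split; last by exists H => z; exact: hH.
  exact: (measurableT_comp bf.1 measurable_fst).
transitivity (\int[leb 2]_t \int[leb K]_s (fibre phi h x s * (tent e t * cos (t * (L * (phi x - s)))))).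
  apply: eq_Rintegral => t _; rewrite /wave /hcos /hsin /fibre_int.
  have bc := bmfM bf (bmf_coslin (L * t)); have bs := bmfM bf (bmf_sinlin (L * t)).
  rewrite -!RintegralZl//; try exact: bmf_integrable.
  rewrite -RintegralB//; last 2 first.
  - by apply: bmf_integrable; apply: bmfM => //; exact: bmf_cst.
  - by apply: bmf_integrable; apply: bmfM => //; exact: bmf_cst.
  rewrite -RintegralZl//; last first.
    by apply: bmf_integrable; apply: bmfB; apply: bmfM => //; exact: bmf_cst.
  apply: eq_Rintegral => s _.
  have -> : t * (L * (phi x - s)) = L * t * phi x - L * t * s by ring.
  by rewrite cosB; ring.
rewrite -(bmf_Fubini (leb K) (leb 2) bF); apply: eq_Rintegral => s _ /=.
by rewrite RintegralZl//; exact: (bmf_integrable (leb 2) (bmf_tentcos _ e0)).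
Qed.

Lemma wave_abs (L t : R) x : `|wave L t x| <= 2 * (H * (2 * K)).
Proof.
have h1 := hcos_abs tphi ch hH K0 hK (L * t) x; have h2 := hsin_abs tphi ch hH K0 hK (L * t) x.
rewrite (le_trans (ler_normB _ _))// !normrM mulr2n mulrDl !mul1r; apply: lerD.
  by rewrite -[leRHS]mul1r; apply: ler_pM => //; exact: cos_max.
by rewrite -[leRHS]mul1r; apply: ler_pM => //; exact: sin_max.
Qed.

End smoothing.

Section smoothing_approx.
Context {R : realType} (d : nat).
Variable phi : vec R d -> R.
Hypothesis tphi : topical_fun phi.
Variables (h : vec R d -> R) (H K : R).
Hypothesis ch : continuous h.
Hypothesis hH : forall x, `|h x| <= H.
Hypothesis K4 : 4 <= K.
Hypothesis hK : forall x, K / 4 < `|phi x| -> h x = 0.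
Hypothesis huc : forall e : R, 0 < e -> exists2 r, 0 < r &
  forall x a, `|a| <= r -> `|h (vshift x a) - h x| <= e.

Let H0 : 0 <= H. Proof. by rewrite (le_trans _ (hH 0)). Qed.
Let K0 : 0 <= K. Proof. by rewrite (le_trans _ K4). Qed.

Lemma fibre_zero x s : K / 4 < `|s| -> fibre phi h x s = 0.
Proof. by move=> Ks; apply: hK; rewrite tphi.2 addrC subrK. Qed.

Lemma fejer_tail (L r : R) : 0 < L -> r != 0 -> L * fejer 1 (L * r) <= 8 / (L * r ^+ 2).
Proof.
move=> L0 r0; have [_ h1] := fejer_bound (L * r) (@ltr01 R) (ler1n R 2).
have Lr : 0 < L * r ^+ 2 by rewrite mulr_gt0// exprn_even_gt0.
apply: (@le_trans _ _ (L * (8 * (1 / (1 + (1 * (L * r)) ^+ 2))))).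
  by rewrite ler_wpM2l// ltW.
have -> : 8 / (L * r ^+ 2) = L * (8 * (1 / ((L * r) ^+ 2))) by field; rewrite r0 gt_eqF.
rewrite !mul1r; apply: ler_wpM2l; first exact: ltW.
have Lr2 : 0 < (L * r) ^+ 2 by rewrite exprn_even_gt0// mulf_neq0// gt_eqF.
rewrite ler_wpM2l// lef_pV2 ?posrE//; first by rewrite lerDr.
by rewrite addr_gt0.
Qed.

Lemma bmf_smooth_integrand (L : R) x :
  bmf (fun s : R => (fibre phi h x s - h x) * fejer 1 (L * (phi x - s))).
Proof.
apply: bmfM; last exact: bmf_fejer.
by apply: bmfB; [exact: (bmf_fibre phi ch hH) | exact: bmf_cst].
Qed.

(** The first term measures the variation of [h] along the fibre, the second is [h x] times the mass
    of the kernel on [[- K, K]]. The function [h] vanishes beyond [K / 4], so where it matters this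
    interval extends far on both sides of [phi x]. *)
Lemma smooth_split (L : R) x : 0 < L ->
  smooth phi h K L 1 x = \int[leb K]_s (L * ((fibre phi h x s - h x) * fejer 1 (L * (phi x - s))))
   + h x * (sinint 1 (L * (phi x + K)) - sinint 1 (L * (phi x - K))).
Proof.
move=> L0; rewrite (smoothE phi K ch hH)// -(sinint_diff _ ltr01 L0 K0).
have b1 := bmf_smooth_integrand L x; have b2 : bmf (fun s : R => fejer 1 (L * (phi x - s))).
  exact: bmf_fejer.
rewrite RintegralZl//; last exact: (bmf_integrable (leb K)).
rewrite mulrCA -mulrDr; congr (_ * _).
rewrite -RintegralZl//; last exact: (bmf_integrable (leb K)).
rewrite -RintegralD//; last 2 first.
- exact: (bmf_integrable (leb K)).
- by apply: (bmf_integrable (leb K)); apply: bmfM => //; exact: bmf_cst.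
by apply: eq_Rintegral => s _; ring.
Qed.

(** On the support of the fibre the distance from [s] to [phi x] is at least 3/4 of the absolute
    value of [phi x], so the tail of the kernel decays like [weight]. *)
Lemma smooth_far (L : R) x s : 0 < L -> K < `|phi x| ->
  `|L * ((fibre phi h x s - h x) * fejer 1 (L * (phi x - s)))| <= H * (32 / L) * weight phi 0 x.
Proof.
have KK := K4; move=> L0 Kp; have hx : h x = 0 by apply: hK; lra.
rewrite hx subr0 /weight subr0; set p := phi x in Kp *.
have p1 : 1 <= p ^+ 2.
  by rewrite -(real_normK (num_real p)) exprn_ege1//; lra.
have w0 : 0 <= H * (32 / L) * (1 + p ^+ 2)^-1.
  by apply: mulr_ge0; [apply: mulr_ge0 => //; rewrite divr_ge0// ltW | rewrite invr_ge0 addr_ge0// sqr_ge0].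
have [sK|Ks] := leP `|s| (K / 4); last by rewrite fibre_zero// mul0r mulr0 normr0.
have ps : 3 / 4 * `|p| <= `|p - s|.
  have := ler_normD (p - s) s; rewrite subrK; lra.
have ps0 : p - s != 0 by rewrite -normr_gt0; lra.
have f0 := (fejer_bound (L * (p - s)) (@ltr01 R) (ler1n R 2)).1.
rewrite mulrCA normrM -mulrA -mulrA; apply: ler_pM => //; first exact: hH.
rewrite ger0_norm ?mulr_ge0 ?(ltW L0)//; apply: le_trans (fejer_tail L0 ps0) _.
have q : 9 / 16 * p ^+ 2 <= (p - s) ^+ 2.
  rewrite -(real_normK (num_real p)) -(real_normK (num_real (p - s))) !expr2.
  by have := normr_ge0 p; nra.
have p2 : 0 < p ^+ 2 by lra.
have Q0 : 0 < (p - s) ^+ 2 by lra.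
have p3 : 0 < 1 + p ^+ 2 by rewrite addr_gt0.
rewrite [leRHS](_ : _ = 32 * (p - s) ^+ 2 / (1 + p ^+ 2) / (L * (p - s) ^+ 2)); last first.
  by field; rewrite ps0 (gt_eqF L0) (gt_eqF p3).
apply: ler_wpM2r; first by rewrite invr_ge0 mulr_ge0 ?(ltW L0) ?(ltW Q0).
rewrite ler_pdivlMr//; lra.
Qed.

Lemma smooth_near (L e r : R) x s : 0 < L -> 0 <= e -> 0 < r ->
  (forall x a, `|a| <= r -> `|h (vshift x a) - h x| <= e) ->
  `|L * ((fibre phi h x s - h x) * fejer 1 (L * (phi x - s)))| <=
    L * (e * fejer 1 (L * (phi x - s))) + 2 * H * (8 / (L * r ^+ 2)).
Proof.
move=> L0 e0 r0 hr; set p := phi x.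
have f0 := (fejer_bound (L * (p - s)) (@ltr01 R) (ler1n R 2)).1.
rewrite !normrM (gtr0_norm L0) (ger0_norm f0).
have Lr : 0 < L * r ^+ 2 by rewrite mulr_gt0// exprn_gt0.
have t0 : 0 <= 2 * H * (8 / (L * r ^+ 2)) by rewrite !mulr_ge0// invr_ge0 ltW.
have t1 : 0 <= L * (e * fejer 1 (L * (p - s))) by rewrite !mulr_ge0// ltW.
have [sr|rs] := leP `|s - p| r.
  apply: (@le_trans _ _ (L * (e * fejer 1 (L * (p - s))))); last by rewrite lerDl.
  rewrite ler_wpM2l ?(ltW L0)// ler_wpM2r//; exact: hr.
have ps0 : p - s != 0 by rewrite -normr_gt0 distrC (lt_trans r0).
apply: (@le_trans _ _ (2 * H * (8 / (L * r ^+ 2)))); last by rewrite lerDr.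
rewrite mulrCA; apply: ler_pM => //; first by rewrite mulr_ge0// ltW.
  rewrite (le_trans (ler_normB _ _))//; have := hH x; have := hH (vshift x (s - p)).
  by rewrite /fibre; lra.
apply: le_trans (fejer_tail L0 ps0) _.
rewrite ler_wpM2l// lef_pV2 ?posrE//; last by rewrite mulr_gt0// exprn_even_gt0.
rewrite ler_wpM2l ?(ltW L0)// -(real_normK (num_real (p - s))) distrC.
by rewrite ler_sqr ?nnegrE// ltW.
Qed.

(** Smallness in sup norm would not be enough, since the error is later summed over all times: it
    has to be dominated by [weight], whose sums along the chain are bounded. *)
Lemma smooth_approx (c0 eps : R) : 0 < c0 -> 0 < eps ->
  (forall e, 0 < e -> exists2 S, 0 < S &
    forall s, S <= s -> `|sinint 1 s - c0| <= e /\ `|sinint 1 (- s) + c0| <= e) ->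
  exists2 L, 0 < L & forall x, `|smooth phi h K L 1 x - 2 * c0 * h x| <= eps * weight phi 0 x.
Proof.
move=> c00 eps0 hc0; have KK := K4; pose Q := 1 + K ^+ 2.
have Q0 : 0 < Q by rewrite /Q ltr_wpDr// sqr_ge0.
have H1 : 0 < H + 1 by rewrite ltr_wpDl.
have [S S0 hS] := hc0 (eps / (8 * ((H + 1) * Q))) (divr_gt0 eps0 (mulr_gt0 (ltr0n _ 8) (mulr_gt0 H1 Q0))).
have [r r0 hr] := huc (divr_gt0 eps0 (mulr_gt0 (ltr0n _ 128) Q0)).
set e1 := eps / (128 * Q) in hr; set e2 := eps / (8 * ((H + 1) * Q)) in hS.
have e10 : 0 < e1 by rewrite divr_gt0 ?mulr_gt0.
(* [L] has three tasks: [S] brings the mass of the kernel close to [2 * c0], [T1] makes its tail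
   beyond [r] negligible for bounded [phi x], and [T2] handles large [phi x]. *)
pose T1 := 128 * H * K * Q / (r ^+ 2 * eps); pose T2 := 64 * K * H / eps.
have T10 : 0 <= T1.
  by rewrite divr_ge0// !mulr_ge0// ?sqr_ge0// ltW.
have T20 : 0 <= T2 by rewrite divr_ge0 ?mulr_ge0// ltW.
pose L := S + T1 + T2.
have L0 : 0 < L by rewrite /L; lra.
exists L => // x; rewrite smooth_split//; set p := phi x.
set I := Rintegral _ _ _.
have bi := bmf_smooth_integrand L x.
have bLi : bmf (fun s : R => L * ((fibre phi h x s - h x) * fejer 1 (L * (phi x - s)))).
  by apply: bmfM => //; exact: bmf_cst.
have W : weight phi 0 x = (1 + p ^+ 2)^-1 by rewrite /weight subr0.
have w0 : 0 < weight phi 0 x by rewrite W invr_gt0 ltr_wpDr// sqr_ge0.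
have [pK|Kp] := leP `|p| K; last first.
  have hx : h x = 0 by apply: hK; move: Kp; rewrite /p; lra.
  rewrite hx mul0r mulr0 addr0 subr0.
  have := @Rintegral_norm_le _ _ _ (leb K) _ (H * (32 / L) * weight phi 0 x) (bmf_integrable (leb K) bLi).
  move=> /(_ (fun s => smooth_far s L0 Kp)); rewrite leb_setT// => h1.
  apply: le_trans h1 _; rewrite mulrAC; apply: ler_wpM2r; first exact: ltW.
  have : T2 <= L by rewrite /L; lra.
  rewrite /T2 ler_pdivrMr// => h2.
  by rewrite [leLHS](_ : _ = H * 32 * (2 * K) / L); [rewrite ler_pdivrMr//; lra | ring].
(* For [phi x] in [[- K, K]] the weight is bounded below, and a uniform bound by [eps / Q] is
   enough. *)
have wQ : Q^-1 <= weight phi 0 x.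
  rewrite W lef_pV2 ?posrE// ?ltr_wpDr ?sqr_ge0// lerD2l -(real_normK (num_real p)).
  by rewrite ler_sqr ?nnegrE.
have eQ : eps / Q <= eps * weight phi 0 x by rewrite ler_wpM2l// ltW.
apply: le_trans eQ.
have hI : `|I| <= eps / (2 * Q).
  rewrite (le_trans (le_normr_Rintegral _ (bmf_integrable (leb K) bLi)))//.
  have bf : bmf (fun s : R => fejer 1 (L * (p - s))) by exact: bmf_fejer.
  have be : bmf (fun s : R => L * (e1 * fejer 1 (L * (p - s)))).
    by apply: bmfM; [exact: bmf_cst | apply: bmfM => //; exact: bmf_cst].
  apply: (@le_trans _ _ (\int[leb K]_s (L * (e1 * fejer 1 (L * (p - s))) + 2 * H * (8 / (L * r ^+ 2))))).
    apply: le_Rintegral => //.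
    - by apply: (bmf_integrable (leb K)); exact: bmf_norm.
    - by apply: (bmf_integrable (leb K)); apply: bmfD => //; exact: bmf_cst.
    - by move=> s _; apply: smooth_near => //; exact: ltW.
  have -> : \int[leb K]_s (L * (e1 * fejer 1 (L * (p - s))) + 2 * H * (8 / (L * r ^+ 2))) =
     e1 * (sinint 1 (L * (p + K)) - sinint 1 (L * (p - K))) + 2 * H * (8 / (L * r ^+ 2)) * (2 * K).
    rewrite RintegralD//; last 2 first.
    - exact: (bmf_integrable (leb K)).
    - by apply: (bmf_integrable (leb K)); exact: bmf_cst.
    rewrite Rintegral_cst// leb_setT// -(sinint_diff _ ltr01 L0 K0); congr (_ + _).
    have be1 : bmf (fun s : R => e1 * fejer 1 (L * (p - s))) by apply: bmfM => //; exact: bmf_cst.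
    rewrite RintegralZl//; last exact: (bmf_integrable (leb K)).
    by rewrite RintegralZl//; [ring | exact: (bmf_integrable (leb K))].
  have b1 := sinint_bound (L * (p + K)) (@ltr01 R) (ler1n R 2).
  have b2 := sinint_bound (L * (p - K)) (@ltr01 R) (ler1n R 2).
  have b3 : e1 * (sinint 1 (L * (p + K)) - sinint 1 (L * (p - K))) <= e1 * 32.
    rewrite ler_wpM2l ?(ltW e10)//; move: b1 b2; rewrite !ler_norml => /andP[? ?] /andP[? ?]; lra.
  have b4 : 2 * H * (8 / (L * r ^+ 2)) * (2 * K) <= eps / (4 * Q).
    have : T1 <= L by rewrite /L; lra.
    have r2 : 0 < r ^+ 2 by rewrite exprn_gt0.
    rewrite /T1 ler_pdivrMr ?mulr_gt0// => h2.
    have -> : 2 * H * (8 / (L * r ^+ 2)) * (2 * K) = 32 * H * K / (L * r ^+ 2).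
      by field; rewrite !gt_eqF.
    rewrite ler_pdivrMr ?mulr_gt0// [leRHS]mulrAC ler_pdivlMr ?mulr_gt0//; lra.
  have -> : eps / (2 * Q) = e1 * 32 + eps / (4 * Q) by rewrite /e1; field; rewrite gt_eqF.
  lra.
have hT : `|h x * (sinint 1 (L * (p + K)) - sinint 1 (L * (p - K))) - 2 * c0 * h x| <= eps / (2 * Q).
  have [pK4|Kp4] := leP `|p| (K / 4); last first.
    by rewrite hK// mul0r mulr0 subr0 normr0 divr_ge0 ?mulr_ge0 ?(ltW eps0)// ltW.
  have LS : S <= L by rewrite /L; lra.
  have /andP[pl pu] : - (K / 4) <= p <= K / 4 by rewrite -ler_norml.
  have s1 : S <= L * (p + K) by rewrite (le_trans LS)// ler_peMr ?(ltW L0)//; lra.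
  have s2 : S <= L * (K - p) by rewrite (le_trans LS)// ler_peMr ?(ltW L0)//; lra.
  have [h1 _] := hS _ s1; have [_ h2] := hS _ s2.
  have e : L * (p - K) = - (L * (K - p)) by ring.
  rewrite e; set u := sinint 1 (L * (p + K)) in h1 *; set v := sinint 1 (- _) in h2 *.
  have -> : h x * (u - v) - 2 * c0 * h x = h x * ((u - c0) - (v + c0)) by ring.
  have -> : eps / (2 * Q) = (H + 1) * (4 * e2) by rewrite /e2; field; rewrite !gt_eqF.
  rewrite normrM; apply: ler_pM => //; first by have := hH x; lra.
  rewrite (le_trans (ler_normB _ _))//; have := normr_ge0 (u - c0); lra.
have -> : eps / Q = eps / (2 * Q) + eps / (2 * Q) by field; rewrite gt_eqF.
by rewrite -addrA (le_trans (ler_normD _ _))// lerD.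
Qed.

End smoothing_approx.

(** * The potential *)

Section joint_measurability.
Context {R : realType} {dO : measure_display} {Omega : measurableType dO} {d : nat}.

Lemma measurable_joint (g : R -> vec R d -> R) (Z : Omega -> vec R d) : mvec Z ->
  (forall t, continuous (g t)) -> (forall y, continuous (g ^~ y)) ->
  measurable_fun setT (fun z : Omega * measurableTypeR R => g z.2 (Z z.1)).
Proof.
move=> mZ c1 c2.
apply: (@measurable_caratheodory1 _ _ _ (fun z r => g r (Z z.1)) (fun z => z.2)).
- exact: measurable_snd.
- move=> r; have m1 := @measurable_continuous_vec _ _ _ _ (g r) Z mZ (c1 r).
  exact: (measurableT_comp m1 measurable_fst).
- by move=> z; exact: c2.
Qed.

Lemma measurable_joint_phase (phi : vec R d -> R) (Z : Omega -> vec R d) (L : R) : mvec Z ->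
  continuous phi -> measurable_fun setT (fun z : Omega * measurableTypeR R => L * z.2 * phi (Z z.1)).
Proof.
move=> mZ cphi; apply: measurable_funM.
  by apply: measurable_funM; [exact: measurable_cst | exact: measurable_snd].
have m1 := @measurable_continuous_vec _ _ _ _ phi Z mZ cphi.
exact: (measurableT_comp m1 measurable_fst).
Qed.

End joint_measurability.

Section amplitudes.
Context {R : realType} {d : nat}.
Variables (L C : R) (f : R -> vec R d -> R).
Hypothesis L0 : 0 < L.
Hypothesis C0 : 0 <= C.
Hypothesis fcb : forall t, t != 0 -> cb (f t).
Hypothesis fbd : forall t x, t != 0 -> `|t| <= L -> `|f t x| <= C.
Hypothesis flip : forall t s x, t != 0 -> s != 0 -> `|t| <= L -> `|s| <= L ->
  `|f t x - f s x| <= C * (`|t - s| / t ^+ 2).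

(** The value at [t = 0], where nothing is known of [f], is set to 0 as [amplitude] requires.
    Frequencies are rescaled by [L], so that the tent confines them to the range where [f] is
    bounded. *)
Definition ampl (e t : R) (x : vec R d) : R := if t == 0 then 0 else tent e t * f (L * t) x.

Lemma ampl_abs e t x : 0 < e -> e <= 1 -> `|ampl e t x| <= C * ind_ball e t.
Proof.
move=> e0 e1; rewrite /ampl; have ib0 : 0 <= ind_ball e t by rewrite /ind_ball; case: ifP.
case: eqP => [_|/eqP t0]; first by rewrite normr0 mulr_ge0.
have [te|te] := leP `|t| e; last by rewrite tent_out ?(ltW te)// mul0r normr0 mulr_ge0.
rewrite normrM mulrC (ger0_norm (tent_ge0 e t)); apply: ler_pM => //; last 2 first.
- apply: fbd; first by rewrite mulf_neq0// gt_eqF.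
  by rewrite normrM gtr0_norm// ler_piMr ?(ltW L0)// (le_trans te).
- exact: tent_ball.
- exact: tent_ge0.
Qed.

(** When one of [t], [s] is outside [[-1, 1]] the tent vanishes there, and its own Lipschitz bound
    replaces the one of [f], which holds only up to frequency [L]. *)
Lemma ampl_amplitude e x : 0 < e -> e <= 1 ->
  amplitude (C * (1 + e^-1 + L^-1)) (fun t => ampl e t x).
Proof.
move=> e0 e1; pose C' := C * (1 + e^-1 + L^-1); rewrite -/C'.
have ie : 0 < e^-1 by rewrite invr_gt0.
have iL : 0 < L^-1 by rewrite invr_gt0.
have CC : C <= C' by rewrite /C' ler_peMr//; lra.
have mC t : `|ampl e t x| <= C.
  rewrite (le_trans (ampl_abs _ _ e0 e1))// ler_piMr//.
  by rewrite /ind_ball; case: ifP.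
split.
- by rewrite /ampl eqxx.
- by move=> t; exact: le_trans (mC t) CC.
- move=> t t1; rewrite /ampl tent_out ?mul0r ?if_same// ltW//; exact: le_lt_trans t1.
move=> t s t0; have it : 0 < (t ^+ 2)^-1 by rewrite invr_gt0 exprn_even_gt0.
have base : C * (`|t - s| / e) <= C' * (`|t - s| * (1 + (t ^+ 2)^-1)).
  rewrite [leLHS](_ : _ = C * e^-1 * `|t - s|); last by ring.
  rewrite [leRHS](_ : _ = C * ((1 + e^-1 + L^-1) * (1 + (t ^+ 2)^-1)) * `|t - s|); last by rewrite /C'; ring.
  rewrite ler_wpM2r// ler_wpM2l//.
  have := mulr_ge0 (ltW ie) (ltW it); have := mulr_ge0 (ltW iL) (ltW it); lra.
(* Against the value at 0 no continuity is available; since [r + 1 / r >= 1] for [r > 0],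
   boundedness alone gives the estimate. *)
have [->|s0] := eqVneq s 0.
  rewrite [ampl e 0 x]/ampl eqxx !subr0 (le_trans (mC t))// (le_trans CC)// ler_peMr//.
    exact: le_trans C0 CC.
  rewrite mulrDr mulr1 -(real_normK (num_real t)); have tp : 0 < `|t| by rewrite normr_gt0.
  have -> : `|t| / `|t| ^+ 2 = `|t|^-1 by field; rewrite gt_eqF.
  have [t1|t1] := leP 1 `|t|; first by rewrite (le_trans t1)// lerDl invr_ge0 ltW.
  by apply: (@le_trans _ _ `|t|^-1); [rewrite invf_ge1// ltW | rewrite lerDr ltW].
rewrite /ampl (negbTE t0) (negbTE s0).
have inL u : `|u| <= 1 -> `|L * u| <= L by move=> u1; rewrite normrM gtr0_norm// ler_piMr ?(ltW L0).
have Ln u : u != 0 -> L * u != 0 by move=> u0; rewrite mulf_neq0// gt_eqF.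
have tl := tent_lip t s e0.
have [t1|t1] := leP `|t| 1; have [s1|s1] := leP `|s| 1.
- have -> : tent e t * f (L * t) x - tent e s * f (L * s) x =
     (tent e t - tent e s) * f (L * t) x + tent e s * (f (L * t) x - f (L * s) x) by ring.
  rewrite (le_trans (ler_normD _ _))//.
  have h1 : `|(tent e t - tent e s) * f (L * t) x| <= `|t - s| / e * C.
    by rewrite normrM; apply: ler_pM => //; apply: fbd; [exact: Ln | exact: inL].
  have h2 : `|tent e s * (f (L * t) x - f (L * s) x)| <= C * (`|t - s| / L * (t ^+ 2)^-1).
    rewrite normrM (ger0_norm (tent_ge0 e s)) -[leRHS]mul1r; apply: ler_pM => //; first exact: tent_ge0.
      exact: tent_le1.
    rewrite (le_trans (flip _ _ _ _ _))//; try exact: Ln; try exact: inL.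
    rewrite -mulrBr normrM (gtr0_norm L0) le_eqVlt; apply/orP; left; apply/eqP.
    by field; rewrite t0 gt_eqF.
  rewrite (le_trans (lerD h1 h2))//.
  rewrite [leLHS](_ : _ = C * (e^-1 + L^-1 * (t ^+ 2)^-1) * `|t - s|); last by ring.
  rewrite [leRHS](_ : _ = C * ((1 + e^-1 + L^-1) * (1 + (t ^+ 2)^-1)) * `|t - s|); last by rewrite /C'; ring.
  rewrite ler_wpM2r// ler_wpM2l//.
  have := mulr_ge0 (ltW ie) (ltW it); lra.
- have ts : tent e s = 0 by rewrite tent_out// (le_trans e1)// ltW.
  rewrite ts subr0 in tl; rewrite ts mul0r subr0 (le_trans _ base)// normrM mulrC.
  by apply: ler_pM => //; apply: fbd; [exact: Ln | exact: inL].
- have ts : tent e t = 0 by rewrite tent_out// (le_trans e1)// ltW.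
  rewrite ts sub0r normrN in tl; rewrite ts mul0r sub0r normrN (le_trans _ base)// normrM mulrC.
  by apply: ler_pM => //; apply: fbd; [exact: Ln | exact: inL].
- have ts : tent e s = 0 by rewrite tent_out// (le_trans e1)// ltW.
  have tt : tent e t = 0 by rewrite tent_out// (le_trans e1)// ltW.
  by rewrite ts tt !mul0r subr0 normr0 (le_trans _ base)// mulr_ge0// divr_ge0// ltW.
Qed.

(** After multiplication by [t ^+ 2] the amplitude is continuous in [t] and in the point separately,
    hence jointly measurable; dividing back only adds a measurable factor. *)
Lemma ampl_joint {dO : measure_display} {Omega : measurableType dO} (Z : Omega -> vec R d) e :
  0 < e -> e <= 1 -> mvec Z -> bmf (fun z : Omega * measurableTypeR R => ampl e z.2 (Z z.1)).
Proof.
move=> e0 e1 mZ; split; last first.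
  exists C => z; rewrite (le_trans (ampl_abs _ _ e0 e1))// ler_piMr//.
  by rewrite /ind_ball; case: ifP.
rewrite (_ : (fun z => _) = (fun z : Omega * measurableTypeR R =>
    (z.2 ^+ 2 * ampl e z.2 (Z z.1)) * (z.2 ^+ 2)^-1)); last first.
  by apply/funext => z; exact: (amplitude_sqrE z.2 (ampl_amplitude (Z z.1) e0 e1)).
apply: measurable_funM; last first.
  apply: (measurableT_comp measurable_inv); apply: measurable_funX; exact: measurable_snd.
apply: (@measurable_joint _ _ _ _ (fun t y => t ^+ 2 * ampl e t y) Z mZ).
- move=> t y; apply: (@continuousM _ _ (fun=> t ^+ 2) (fun y => ampl e t y) y).
    exact: (@cst_continuous _ _ (t ^+ 2) y).
  rewrite /ampl; case: eqP => [_|/eqP t0]; first exact: (@cst_continuous _ _ (0 : R) y).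
  apply: (@continuousM _ _ (fun=> tent e t) (fun y => f (L * t) y) y).
    exact: (@cst_continuous _ _ (tent e t) y).
  by apply: (fcb _).1; rewrite mulf_neq0// gt_eqF.
- by move=> y; exact: (amplitude_sqr_continuous (ampl_amplitude y e0 e1)).
Qed.

End amplitudes.

Section potential.
Context {R : realType} {d : nat}.
Variable phi : vec R d -> R.
Hypothesis tphi : topical_fun phi.
Variables (L C A0 : R) (f1 f2 : R -> vec R d -> R).
Hypothesis L0 : 0 < L.
Hypothesis C0 : 0 <= C.
Hypothesis cb1 : forall t, t != 0 -> cb (f1 t).
Hypothesis cb2 : forall t, t != 0 -> cb (f2 t).
Hypothesis bd1 : forall t x, t != 0 -> `|t| <= L -> `|f1 t x| <= C.
Hypothesis bd2 : forall t x, t != 0 -> `|t| <= L -> `|f2 t x| <= C.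
Hypothesis lip1 : forall t s x, t != 0 -> s != 0 -> `|t| <= L -> `|s| <= L ->
  `|f1 t x - f1 s x| <= C * (`|t - s| / t ^+ 2).
Hypothesis lip2 : forall t s x, t != 0 -> s != 0 -> `|t| <= L -> `|s| <= L ->
  `|f2 t x - f2 s x| <= C * (`|t - s| / t ^+ 2).

Let cphi : continuous phi := topical_fun_continuous tphi.

Definition regint (e : R) (x : vec R d) (t : R) : R :=
  cos (L * t * phi x) * ampl L f1 e t x - sin (L * t * phi x) * ampl L f2 e t x.

Definition regpart (e : R) (x : vec R d) : R := \int[leb 2]_t regint e x t.

(* The regular part plus the contribution of the pole [- A0 / (L t)]. *)
Definition potential (e : R) (x : vec R d) : R := L * regpart e x + A0 * sinint e (L * phi x).

Lemma regint_joint {dO : measure_display} {Omega : measurableType dO} (Z : Omega -> vec R d) e :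
  0 < e -> e <= 1 -> mvec Z -> bmf (fun z : Omega * measurableTypeR R => regint e (Z z.1) z.2).
Proof.
move=> e0 e1 mZ; have mp := measurable_joint_phase L mZ cphi.
apply: bmfB; apply: bmfM.
- exact: bmf_cos.
- exact: (ampl_joint L0 C0 cb1 bd1 lip1).
- exact: bmf_sin.
- exact: (ampl_joint L0 C0 cb2 bd2 lip2).
Qed.

Lemma bmf_ampl (f : R -> vec R d -> R) e x :
  (forall t x, t != 0 -> `|t| <= L -> `|f t x| <= C) ->
  (forall t s x, t != 0 -> s != 0 -> `|t| <= L -> `|s| <= L ->
    `|f t x - f s x| <= C * (`|t - s| / t ^+ 2)) ->
  0 < e -> e <= 1 -> bmf (fun t : R => ampl L f e t x).
Proof.
by move=> bd lip e0 e1; exact: (amplitude_bmf (ampl_amplitude L0 C0 bd lip x e0 e1)).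
Qed.

Lemma phase_meas (p : R) : measurable_fun setT (fun t : R => L * t * p).
Proof.
by apply: measurable_funM; [apply: measurable_funM|]; exact: measurable_cst || exact: measurable_id.
Qed.

Lemma bmf_regint e x : 0 < e -> e <= 1 -> bmf (regint e x).
Proof.
move=> e0 e1; apply: bmfB; apply: bmfM.
- by apply: bmf_cos; exact: phase_meas.
- exact: bmf_ampl.
- by apply: bmf_sin; exact: phase_meas.
- exact: bmf_ampl.
Qed.

Lemma regpart_abs e x : 0 < e -> e <= 1 -> `|regpart e x| <= 4 * C * e.
Proof.
move=> e0 e1; have bi := bmf_ind_ball e; have br := bmf_regint x e0 e1.
have e2 : e <= 2 by lra.
have -> : 4 * C * e = 2 * C * (2 * e) by ring.
rewrite -(leb2_ball (ltW e0) e2) -RintegralZl//; last exact: (bmf_integrable (leb 2)).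
rewrite (le_trans (le_normr_Rintegral _ _))//; first exact: (bmf_integrable (leb 2)).
apply: le_Rintegral => //.
- by apply: (bmf_integrable (leb 2)); exact: bmf_norm.
- by apply: (bmf_integrable (leb 2)); apply: bmfM => //; exact: bmf_cst.
move=> t _; rewrite (le_trans (ler_normB _ _))// !normrM.
have -> : 2 * C * ind_ball e t = 1 * (C * ind_ball e t) + 1 * (C * ind_ball e t) by ring.
apply: lerD; apply: ler_pM => //; try exact: cos_max; try exact: sin_max.
  exact: (ampl_abs L0 C0 bd1).
exact: (ampl_abs L0 C0 bd2).
Qed.

Lemma potential_bound x : `|potential 1 x| <= L * (4 * C) + `|A0| * 16.
Proof.
have h1 := regpart_abs x (@ltr01 R) (lexx 1); have h2 := sinint_bound (L * phi x) (@ltr01 R) (ler1n R 2).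
rewrite (le_trans (ler_normD _ _))// !normrM (gtr0_norm L0); apply: lerD; rewrite ler_wpM2l ?(ltW L0)//.
by rewrite mulr1 in h1.
Qed.

(** The Riemann-Lebesgue lemma at frequency [L * phi x], with amplitudes that depend on [x] but
    share one constant. *)
Lemma regpart_limit (eps : R) : 0 < eps -> exists2 S, 0 < S & forall x, S <= `|phi x| ->
  `|regpart 1 x| <= eps.
Proof.
move=> eps0; have e2 : 0 < eps / 2 by rewrite divr_gt0.
have [b0 b00 hb] := riemann_lebesgue (C * (1 + 1^-1 + L^-1)) e2.
exists (b0 / L); first by rewrite divr_gt0.
move=> x; rewrite ler_pdivrMr// => hx.
have bL : b0 <= `|L * phi x| by rewrite normrM (gtr0_norm L0) mulrC.
have A1 := ampl_amplitude L0 C0 bd1 lip1 x (@ltr01 R) (lexx 1).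
have A2 := ampl_amplitude L0 C0 bd2 lip2 x (@ltr01 R) (lexx 1).
have [h1 _] := hb _ _ A1 bL; have [_ h2] := hb _ _ A2 bL.
have -> : regpart 1 x = \int[leb 2]_t (ampl L f1 1 t x * cos (L * phi x * t)) -
   \int[leb 2]_t (ampl L f2 1 t x * sin (L * phi x * t)).
  have m p : measurable_fun setT (fun t : R => p * t) by apply: measurable_funM => //; exact: measurable_cst.
  have b1 := amplitude_bmf A1; have b2 := amplitude_bmf A2.
  rewrite -RintegralB//; last 2 first.
  - by apply: (bmf_integrable (leb 2)); apply: bmfM => //; apply: bmf_cos; exact: m.
  - by apply: (bmf_integrable (leb 2)); apply: bmfM => //; apply: bmf_sin; exact: m.
  apply: eq_Rintegral => t _; rewrite /regint; have -> : L * t * phi x = L * phi x * t by ring.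
  by ring.
by rewrite (le_trans (ler_normB _ _))//; lra.
Qed.

Lemma potential_limit (c0 : R) : (forall e, 0 < e -> exists2 S, 0 < S &
    forall s, S <= s -> `|sinint 1 s - c0| <= e /\ `|sinint 1 (- s) + c0| <= e) ->
  forall e, 0 < e -> exists2 S, 0 < S & forall x,
    (S <= phi x -> `|potential 1 x - A0 * c0| <= e) /\
    (phi x <= - S -> `|potential 1 x + A0 * c0| <= e).
Proof.
move=> hc e e0; have a0 : 0 < `|A0| + 1 by rewrite ltr_wpDl.
have [S1 S10 h1] := regpart_limit (divr_gt0 e0 (mulr_gt0 (ltr0n R 2) L0)).
have [S2 S20 h2] := hc _ (divr_gt0 e0 (mulr_gt0 (ltr0n R 2) a0)).
exists (S1 + S2 / L); first by rewrite addr_gt0// divr_gt0.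
have S2L : 0 < S2 / L by rewrite divr_gt0.
have reg x : S1 + S2 / L <= `|phi x| -> `|L * regpart 1 x| <= e / 2.
  move=> hx; have := h1 x; rewrite (le_trans _ hx) ?lerDl ?(ltW S2L)// => /(_ isT) hr.
  rewrite normrM (gtr0_norm L0) (le_trans (ler_wpM2l (ltW L0) hr))//.
  by rewrite le_eqVlt; apply/orP; left; apply/eqP; field; rewrite gt_eqF.
have sm (u : R) : `|u| <= e / (2 * (`|A0| + 1)) -> `|A0 * u| <= e / 2.
  move=> hu; rewrite normrM (le_trans (ler_wpM2l (normr_ge0 _) hu))//.
  have -> : `|A0| * (e / (2 * (`|A0| + 1))) = `|A0| / (`|A0| + 1) * (e / 2) by field; rewrite gt_eqF.
  rewrite ler_piMl ?divr_ge0 ?(ltW e0)// ler_pdivrMr// mul1r lerDl//.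
have e2 : e = e / 2 + e / 2 by field.
move=> x; split => hx.
  have s1 : S2 <= L * phi x by rewrite mulrC -ler_pdivrMr//; lra.
  have [q _] := h2 _ s1.
  have -> : potential 1 x - A0 * c0 = L * regpart 1 x + A0 * (sinint 1 (L * phi x) - c0).
    by rewrite /potential; ring.
  rewrite [leRHS]e2 (le_trans (ler_normD _ _))// lerD//; last exact: sm.
  by apply: reg; rewrite (le_trans hx)// ler_norm.
have s1 : S2 <= L * - phi x by rewrite mulrC -ler_pdivrMr//; lra.
have [_ q] := h2 _ s1.
have -> : potential 1 x + A0 * c0 = L * regpart 1 x + A0 * (sinint 1 (L * phi x) + c0).
  by rewrite /potential; ring.
rewrite [leRHS]e2 (le_trans (ler_normD _ _))// lerD//.
  by apply: reg; rewrite -normrN (le_trans _ (ler_norm _))//; lra.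
by apply: sm; move: q; rewrite mulrN opprK.
Qed.

(* The tent difference vanishes at [0], which makes the polar factor bounded. *)
Definition cutpot (e t : R) (x : vec R d) : R := (tent 1 t - tent e t) *
  (cos (L * t * phi x) * f1 (L * t) x - sin (L * t * phi x) * (f2 (L * t) x - A0 / (L * t))).

Definition poleint (e : R) (x : vec R d) (t : R) : R :=
  (tent 1 t - tent e t) * (sin (L * t * phi x) / t).

Lemma cutpotE e t x : 0 < e ->
  cutpot e t x = regint 1 x t - regint e x t + A0 / L * poleint e x t.
Proof.
move=> e0; rewrite /cutpot /regint /poleint /ampl; have [->|t0] := eqVneq t 0.
  rewrite !(mulr0, mul0r) sin0 !tent_in ?normr0// ?(ltW e0)//.
  by rewrite !mul0r subrr; ring.
by field; rewrite t0 gt_eqF.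
Qed.

Lemma poleint_abs e x t : 0 < e -> e <= 1 -> `|poleint e x t| <= e^-1.
Proof.
move=> e0 e1; have ie : 0 <= e^-1 by rewrite invr_ge0 ltW.
have [->|t0] := eqVneq t 0; first by rewrite /poleint invr0 !mulr0 normr0.
have tp : 0 < `|t| by rewrite normr_gt0.
rewrite /poleint !normrM normfV.
have -> : e^-1 = (`|t| / e) * (1 * `|t|^-1) by field; rewrite !gt_eqF.
apply: ler_pM; [by [] | by rewrite divr_ge0 | exact: tent_sub |].
by rewrite ler_wpM2r ?invr_ge0//; exact: sin_max.
Qed.

Lemma poleint_joint {dO : measure_display} {Omega : measurableType dO} (Z : Omega -> vec R d) e :
  0 < e -> e <= 1 -> mvec Z -> bmf (fun z : Omega * measurableTypeR R => poleint e (Z z.1) z.2).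
Proof.
move=> e0 e1 mZ; split; last by exists e^-1 => z; exact: poleint_abs.
have mt c : 0 < c -> measurable_fun setT (fun z : Omega * measurableTypeR R => tent c z.2).
  by move=> c0; exact: (measurableT_comp (bmf_tent c0).1 measurable_snd).
apply: measurable_funM; first by apply: measurable_funB; exact: mt.
apply: measurable_funM; last exact: (measurableT_comp measurable_inv measurable_snd).
by have [] := bmf_sin (measurable_joint_phase L mZ cphi).
Qed.

Lemma cutpot_joint {dO : measure_display} {Omega : measurableType dO} (Z : Omega -> vec R d) e :
  0 < e -> e <= 1 -> mvec Z -> bmf (fun z : Omega * measurableTypeR R => cutpot e z.2 (Z z.1)).
Proof.
move=> e0 e1 mZ.
rewrite (_ : (fun z => _) = fun z : Omega * measurableTypeR R => regint 1 (Z z.1) z.2 -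
   regint e (Z z.1) z.2 + A0 / L * poleint e (Z z.1) z.2); last first.
  by apply/funext => z; exact: cutpotE.
apply: bmfD.
  by apply: bmfB; exact: regint_joint.
by apply: bmfM; [exact: bmf_cst | exact: poleint_joint].
Qed.

Lemma bmf_poleint e x : 0 < e -> e <= 1 -> bmf (poleint e x).
Proof.
move=> e0 e1; split; last by exists e^-1 => t; exact: poleint_abs.
apply: measurable_funM; first by apply: measurable_funB; [exact: (bmf_tent ltr01).1 | exact: (bmf_tent e0).1].
by apply: measurable_funM; [exact: (bmf_sin (phase_meas _)).1 | exact: measurable_inv].
Qed.

Lemma cutpot_integral e x : 0 < e -> e <= 1 ->
  L * \int[leb 2]_t cutpot e t x = potential 1 x - potential e x.
Proof.
move=> e0 e1; have r1 := bmf_regint x (@ltr01 R) (lexx 1); have r2 := bmf_regint x e0 e1.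
have bp := bmf_poleint x e0 e1.
have bp' : bmf (fun t : R => A0 / L * poleint e x t) by apply: bmfM => //; exact: bmf_cst.
have -> : \int[leb 2]_t cutpot e t x =
    \int[leb 2]_t (regint 1 x t - regint e x t + A0 / L * poleint e x t).
  by apply: eq_Rintegral => t _; exact: cutpotE.
rewrite RintegralD//; last 2 first.
- by apply: (bmf_integrable (leb 2)); exact: bmfB.
- exact: (bmf_integrable (leb 2)).
rewrite RintegralB//; try exact: (bmf_integrable (leb 2)).
rewrite RintegralZl//; last exact: (bmf_integrable (leb 2)).
have -> : \int[leb 2]_t poleint e x t = sinint 1 (L * phi x) - sinint e (L * phi x).
  rewrite /sinint -RintegralB//; last 2 first.
  - by apply: (bmf_integrable (leb 2)); exact: bmf_tentsinq.
  - by apply: (bmf_integrable (leb 2)); exact: bmf_tentsinq.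
  apply: eq_Rintegral => t _; rewrite /poleint; have -> : L * t * phi x = t * (L * phi x) by ring.
  by ring.
by rewrite /potential /regpart; field; rewrite gt_eqF.
Qed.

End potential.

(** * Renewal sums *)

Section lipschitz.
Context {R : realType}.

Lemma lip_continuous_real (u : R -> R) (c : R) : (forall t s, `|u t - u s| <= `|t - s| * c) -> continuous u.
Proof.
move=> ul t; have c0 : 0 < `|c| + 1 by rewrite ltr_wpDl.
apply/cvgrPdist_lt => e e0; near=> s.
apply: (@le_lt_trans _ _ (`|t - s| * (`|c| + 1))).
  by rewrite (le_trans (ul t s))// ler_wpM2l//; have := ler_norm c; lra.
rewrite -ltr_pdivlMr//; near: s.
by apply: (@cvgr_dist_lt _ R); [exact: cvg_id | exact: divr_gt0].
Unshelve. all: by end_near. Qed.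

Lemma sinint_lip (e s r : R) : 0 < e -> e <= 2 -> `|sinint e s - sinint e r| <= `|s - r| * (2 * e).
Proof.
move=> e0 e2; have bi := bmf_ind_ball e.
have b1 := bmf_tentsinq s e0; have b2 := bmf_tentsinq r e0.
rewrite -(leb2_ball (ltW e0) e2) -RintegralZl//; last exact: (bmf_integrable (leb 2)).
rewrite /sinint -RintegralB//; try exact: (bmf_integrable (leb 2)).
rewrite (le_trans (le_normr_Rintegral _ _))//; first by apply: (bmf_integrable (leb 2)); exact: bmfB.
apply: le_Rintegral => //.
- by apply: (bmf_integrable (leb 2)); apply: bmf_norm; exact: bmfB.
- by apply: (bmf_integrable (leb 2)); apply: bmfM => //; exact: bmf_cst.
move=> t _; rewrite -mulrBr normrM mulrC; apply: ler_pM => //; last first.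
  by rewrite ger0_norm ?tent_ge0// tent_ball.
have [->|t0] := eqVneq t 0; first by rewrite invr0 !mulr0 subrr normr0.
rewrite -mulrBl normrM normfV ler_pdivrMr ?normr_gt0// (le_trans (sin_lip _ _))//.
by rewrite -mulrBr normrM mulrC.
Qed.

End lipschitz.

Section markov_step.
Context {R : realType} {dO : measure_display} {Omega : measurableType dO}.
Variables (P : probability Omega R) (d : nat).
Variables (A : nat -> Omega -> vec R d -> vec R d) (X0 : Omega -> vec R d).
Hypothesis tA : random_topical_ops A.
Hypothesis rX0 : random_vector X0.
Hypothesis iid : iid_and_indep P A X0.
Variable phi : vec R d -> R.
Hypothesis tphi : topical_fun phi.

Let T := Top P A.
Let tw := twist P A phi.
Let cphi : continuous phi := topical_fun_continuous tphi.

Lemma cbM (f g : vec R d -> R) : cb f -> cb g -> cb (fun x => f x * g x).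
Proof.
move=> [cf [M fM]] [cg [N gN]]; split; first by move=> x; apply: (@continuousM _ _ f g x (cf x) (cg x)).
by exists (M * N) => x; rewrite normrM; apply: ler_pM.
Qed.

Lemma cb_phase (t : R) : cb (fun x => cos (t * phi x)) /\ cb (fun x => sin (t * phi x)).
Proof.
have c x : {for x, continuous (fun x => t * phi x)}.
  apply: (@continuousM _ _ (fun=> t) phi x); last exact: cphi.
  exact: (@cst_continuous _ _ t x).
split; split.
- by move=> x; apply: (@continuous_comp _ _ _ (fun x => t * phi x) (@cos R) x (c x)); exact: continuous_cos.
- by exists 1 => x; exact: cos_max.
- by move=> x; apply: (@continuous_comp _ _ _ (fun x => t * phi x) (@sin R) x (c x)); exact: continuous_sin.
- by exists 1 => x; exact: sin_max.
Qed.

Definition rotate (t : R) (u1 u2 : vec R d -> R) (x : vec R d) : R :=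
  cos (t * phi x) * u1 x - sin (t * phi x) * u2 x.

Lemma cb_rotate t u1 u2 : cb u1 -> cb u2 -> cb (rotate t u1 u2).
Proof. by move=> c1 c2; have [cc cs] := cb_phase t; apply: cbB; exact: cbM. Qed.

(** Multiplication by the phase [exp (i t phi)] intertwines the twisted operator with the plain
    Markov operator, by the addition formulas. *)
Lemma Top_rotate t u1 u2 x : cb u1 -> cb u2 ->
  T (rotate t u1 u2) x = rotate t (tw t u1 u2) (tw t u2 (fun y => - u1 y)) x.
Proof.
move=> c1 c2; have c3 := cbN c1.
have b1 := bmf_twist tA tphi t x c1 c2; have b2 := bmf_twist tA tphi t x c2 c3.
rewrite /rotate /tw /twist -!RintegralZl//; try exact: bmf_integrable.
rewrite -RintegralB//; last 2 first.
- by apply: bmf_integrable; apply: bmfM => //; exact: bmf_cst.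
- by apply: bmf_integrable; apply: bmfM => //; exact: bmf_cst.
apply: eq_Rintegral => w _; rewrite /twist_integrand /incr.
have -> : t * phi (A 1 w x) = t * phi x + t * (phi (A 1 w x) - phi x) by ring.
by rewrite cosD sinD; ring.
Qed.

Variable a : R.

Definition shifted k w := vshift (state A X0 k w) (- a).

Lemma shifted_mvec k : mvec (shifted k).
Proof.
move=> i; under eq_fun do rewrite /shifted /vshift !mxE.
by apply: measurable_funD; [exact: (state_mvec tA rX0 (@init_start _ _ _ _ A X0)) | exact: measurable_cst].
Qed.

Lemma bmf_shifted k g : cb g -> bmf (fun w => g (shifted k w)).
Proof.
by move=> [cg [M gM]]; split; [exact: measurable_continuous_vec (shifted_mvec k) cg | exists M => w].
Qed.

(** Topical operators commute with shifts, so the translated chain is driven by the same Markov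
    operator. *)
Lemma shifted_Top k g : cb g -> \int[P]_w g (shifted k.+1 w) = \int[P]_w T g (shifted k w).
Proof.
move=> cg; pose ga x := g (vshift x (- a)).
have cga : cb ga.
  have [cg1 [M gM]] := cg; split; last by exists M => x; exact: gM.
  move=> x; apply: (@continuous_comp _ _ _ (fun x => vshift x (- a)) g x); last exact: cg1.
  exact: vshift_continuous.
rewrite -[LHS]/(\int[P]_w ga (state A X0 k.+1 w)).
rewrite (state_Top tA rX0 iid (@init_start _ _ _ _ A X0) k cga).
apply: eq_Rintegral => w _; apply: eq_Rintegral => w' _.
by rewrite /ga /shifted (tA.1 1 w').2.
Qed.

(** Conjugated by the phase, [Id - Q_t] becomes [Id - T], which in expectation is the difference
    between two consecutive times. *)
Lemma shifted_telescope k t u1 u2 : cb u1 -> cb u2 ->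
  \int[P]_w rotate t (fun x => u1 x - tw t u1 u2 x)
     (fun x => u2 x - tw t u2 (fun y => - u1 y) x) (shifted k w) =
  \int[P]_w rotate t u1 u2 (shifted k w) - \int[P]_w rotate t u1 u2 (shifted k.+1 w).
Proof.
move=> c1 c2; have cr := cb_rotate t c1 c2; rewrite (shifted_Top k cr) -RintegralB//; last 2 first.
- by apply: bmf_integrable; exact: bmf_shifted.
- by apply: bmf_integrable; apply: bmf_shifted; exact: cb_Top.
apply: eq_Rintegral => w _; rewrite Top_rotate// /rotate; ring.
Qed.

End markov_step.

Lemma cvg0_of_bound {R : realType} (u e : nat -> R) (c : R) : (forall n, `|u n| <= e n * c) ->
  e n @[n --> \oo] --> 0 -> u n @[n --> \oo] --> 0.
Proof.
move=> ue ecv; apply/norm_cvg0P.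
have h : e n * c @[n --> \oo] --> 0.
  by rewrite -[X in _ --> X](mul0r c); apply: cvgM => //; exact: cvg_cst.
apply: (@squeeze_cvgr _ _ _ _ (fun=> 0) (fun n => e n * c)) => //; last exact: cvg_cst.
by apply: nearW => n; rewrite normr_ge0 ue.
Qed.

Lemma lim_identity {R : realType} (s p q : R) (u v w : nat -> R) :
  (forall n, s - u n = (p - v n) - (q - w n)) -> u n @[n --> \oo] --> 0 ->
  v n @[n --> \oo] --> 0 -> w n @[n --> \oo] --> 0 -> s = p - q.
Proof.
move=> e cu cv cw.
have c : u n - v n + w n @[n --> \oo] --> 0 - 0 + 0 by apply: cvgD => //; exact: cvgB.
have ec : (fun n => u n - v n + w n) = fun=> s - (p - q).
  by apply/funext => n; have := e n; lra.
rewrite ec subr0 addr0 in c.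
have c2 : (fun _ : nat => s - (p - q)) n @[n --> \oo] --> s - (p - q) by exact: cvg_cst.
have e2 : s - (p - q) = 0.
  by rewrite -(cvg_lim (@norm_hausdorff _ R) c2) (cvg_lim (@norm_hausdorff _ R) c).
by apply/eqP; rewrite -subr_eq0 e2.
Qed.

Lemma telescope_ord {R : realType} (s p : nat -> R) M : (forall k, s k = p k - p k.+1) ->
  \sum_(k < M) s k = p 0 - p M.
Proof.
move=> e; elim: M => [|M ih]; first by rewrite big_ord0 subrr.
by rewrite big_ord_recr /= ih e addrA subrK.
Qed.

Section renewal_identity.
Context {R : realType} {dO : measure_display} {Omega : measurableType dO}.
Variables (P : probability Omega R) (d : nat).
Variables (A : nat -> Omega -> vec R d -> vec R d) (X0 : Omega -> vec R d).
Hypothesis tA : random_topical_ops A.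
Hypothesis rX0 : random_vector X0.
Hypothesis iid : iid_and_indep P A X0.
Variable phi : vec R d -> R.
Hypothesis tphi : topical_fun phi.
Variables (h : vec R d -> R) (H K : R).
Hypothesis ch : continuous h.
Hypothesis hH : forall x, `|h x| <= H.
Hypothesis K0 : 0 <= K.
Hypothesis hK : forall x, K < `|phi x| -> h x = 0.
Variables (L C A0 : R) (f1 f2 : R -> vec R d -> R).
Hypothesis L0 : 0 < L.
Hypothesis C0 : 0 <= C.
Hypothesis cb1 : forall t, t != 0 -> cb (f1 t).
Hypothesis cb2 : forall t, t != 0 -> cb (f2 t).
Hypothesis bd1 : forall t x, t != 0 -> `|t| <= L -> `|f1 t x| <= C.
Hypothesis bd2 : forall t x, t != 0 -> `|t| <= L -> `|f2 t x| <= C.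
Hypothesis lip1 : forall t s x, t != 0 -> s != 0 -> `|t| <= L -> `|s| <= L ->
  `|f1 t x - f1 s x| <= C * (`|t - s| / t ^+ 2).
Hypothesis lip2 : forall t s x, t != 0 -> s != 0 -> `|t| <= L -> `|s| <= L ->
  `|f2 t x - f2 s x| <= C * (`|t - s| / t ^+ 2).
Hypothesis sol : forall t x, t != 0 ->
  f1 t x - twist P A phi t (f1 t) (fun y => f2 t y - A0 / t) x = hcos phi h K t x /\
  f2 t x - A0 / t - twist P A phi t (fun y => f2 t y - A0 / t) (fun y => - f1 t y) x = hsin phi h K t x.

Let H0 : 0 <= H. Proof. by rewrite (le_trans _ (hH 0)). Qed.
Let cphi : continuous phi := topical_fun_continuous tphi.

Let wv := wave phi h K L.
Let pot := potential phi L A0 f1 f2.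
Let cut := cutpot phi L A0 f1 f2.
Let sm := smooth phi h K L.

Lemma cb_wave t : cb (wv t).
Proof.
have [cc cs] := cb_phase tphi (L * t); apply: cbB; apply: cbM => //.
  by apply: (fibre_int_cb tphi ch hH K0 hK); exact: bmf_coslin.
by apply: (fibre_int_cb tphi ch hH K0 hK); exact: bmf_sinlin.
Qed.

Lemma wave_continuous_t x : continuous (wv ^~ x).
Proof.
have ph t : {for t, continuous (fun t : R => L * t * phi x)}.
  apply: (@continuousM _ _ (fun t : R => L * t) (fun _ : R => phi x : R) t); last exact: cst_continuous.
  exact: mulrl_continuous.
have cc := hcos_lip tphi ch hH K0 hK; have cs := hsin_lip tphi ch hH K0 hK.
have sc (u : R -> vec R d -> R) c : (forall t s y, `|u t y - u s y| <= `|t - s| * c) ->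
    continuous (fun t : R => u (L * t) x).
  move=> ul; apply: (@lip_continuous_real _ _ (L * c)) => t s.
  by rewrite (le_trans (ul _ _ _))// -mulrBr normrM (gtr0_norm L0) mulrA (mulrC L).
move=> t; apply: (@continuousB _ _ _ (fun t : R => cos (L * t * phi x) * hcos phi h K (L * t) x)
   (fun t : R => sin (L * t * phi x) * hsin phi h K (L * t) x) t).
  apply: (@continuousM _ _ (fun t : R => cos (L * t * phi x)) (fun t : R => hcos phi h K (L * t) x) t).
    by apply: (@continuous_comp _ _ _ (fun t : R => L * t * phi x) (@cos R) t (ph t)); exact: continuous_cos.
  exact: (sc _ _ cc).
apply: (@continuousM _ _ (fun t : R => sin (L * t * phi x)) (fun t : R => hsin phi h K (L * t) x) t).
  by apply: (@continuous_comp _ _ _ (fun t : R => L * t * phi x) (@sin R) t (ph t)); exact: continuous_sin.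
exact: (sc _ _ cs).
Qed.

Lemma bmf_wave x : bmf (wv ^~ x).
Proof.
split; first by apply: continuous_measurable_fun; exact: wave_continuous_t.
by exists (2 * (H * (2 * K))) => t; exact: (wave_abs tphi ch hH K0 hK).
Qed.

Let D e t : R := tent 1 t - tent e t.

Let bD e : 0 < e -> bmf (D e).
Proof. by move=> e0; apply: bmfB; exact: bmf_tent. Qed.

Lemma cutwave_joint (Z : Omega -> vec R d) e : 0 < e -> mvec Z ->
  bmf (fun z : Omega * measurableTypeR R => D e z.2 * wv z.2 (Z z.1)).
Proof.
move=> e0 mZ; have [mD [M DM]] := bD e0; apply: bmfM.
  by split; [exact: (measurableT_comp mD measurable_snd) | exists M => z; exact: DM].
split; last by exists (2 * (H * (2 * K))) => z; exact: (wave_abs tphi ch hH K0 hK).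
apply: (measurable_joint mZ); last exact: wave_continuous_t.
by move=> t; exact: (cb_wave t).1.
Qed.

Lemma smooth_sub e x : 0 < e -> sm 1 x - sm e x = L * \int[leb 2]_t (D e t * wv t x).
Proof.
move=> e0; have bw := bmf_wave x; rewrite /sm /smooth -mulrBr; congr (_ * _).
rewrite -RintegralB//; last 2 first.
- by apply: (bmf_integrable (leb 2)); apply: bmfM => //; exact: bmf_tent.
- by apply: (bmf_integrable (leb 2)); apply: bmfM => //; exact: bmf_tent.
by apply: eq_Rintegral => t _; rewrite /D /wv; ring.
Qed.

Lemma cutwave_step a k e t : 0 < e -> e <= 1 ->
  \int[P]_w (D e t * wv t (shifted A X0 a k w)) =
  \int[P]_w cut e t (shifted A X0 a k w) - \int[P]_w cut e t (shifted A X0 a k.+1 w).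
Proof.
move=> e0 e1; have [->|t0] := eqVneq t 0.
  have z0 x : cut e 0 x = 0.
    by rewrite /cut /cutpot !tent_in ?normr0// ?(ltW e0)// !mul0r subrr mul0r.
  have -> : (fun w => D e 0 * wv 0 (shifted A X0 a k w)) = fun=> 0.
    by apply/funext => w; rewrite /D !tent_in ?normr0// ?(ltW e0)// !mul0r subrr mul0r.
  under [X in _ = X - _]eq_Rintegral do rewrite z0.
  under [X in _ = _ - X]eq_Rintegral do rewrite z0.
  by rewrite subrr Rintegral_cst// mul0r.
have Lt : L * t != 0 by rewrite mulf_neq0// gt_eqF.
have cc2 : cb (fun y => f2 (L * t) y - A0 / (L * t)).
  by apply: cbB; [exact: cb2 | exact: cb_cst].
have cw := cb_wave t; have cr := cb_rotate tphi (L * t) (cb1 Lt) cc2.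
have bZ g n : cb g -> bmf (fun w => g (shifted A X0 a n w)) by exact: (bmf_shifted tA rX0).
have e' n : \int[P]_w cut e t (shifted A X0 a n w) =
   D e t * \int[P]_w rotate phi (L * t) (f1 (L * t)) (fun y => f2 (L * t) y - A0 / (L * t)) (shifted A X0 a n w).
  by rewrite -RintegralZl//; apply: bmf_integrable; exact: bZ.
rewrite !e' -mulrBr -(shifted_telescope tA rX0 iid tphi)//; last exact: cb1.
rewrite RintegralZl//; last by apply: bmf_integrable; exact: bZ.
congr (_ * _); apply: eq_Rintegral => w _; rewrite /rotate.
by have [-> ->] := sol (shifted A X0 a k w) Lt.
Qed.

Let mZ a k := shifted_mvec tA rX0 (A := A) (X0 := X0) a k.

(** The telescoping at each frequency, integrated over the frequencies. The cutoff [tent 1 - tent e]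
    vanishes at 0 and keeps the integrands bounded in spite of the pole, so that Fubini applies. *)
Lemma smooth_step_cut a k e : 0 < e -> e <= 1 ->
  \int[P]_w (sm 1 (shifted A X0 a k w) - sm e (shifted A X0 a k w)) =
  \int[P]_w (pot 1 (shifted A X0 a k w) - pot e (shifted A X0 a k w)) -
  \int[P]_w (pot 1 (shifted A X0 a k.+1 w) - pot e (shifted A X0 a k.+1 w)).
Proof.
move=> e0 e1.
have cj n := cutpot_joint tphi A0 L0 C0 cb1 cb2 bd1 bd2 lip1 lip2 e0 e1 (mZ a n).
have ec n : \int[P]_w (pot 1 (shifted A X0 a n w) - pot e (shifted A X0 a n w)) =
   L * \int[leb 2]_t \int[P]_w cut e t (shifted A X0 a n w).
  rewrite -(bmf_Fubini P (leb 2) (cj n)) -RintegralZl//; last first.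
    by apply: bmf_integrable; exact: (bmf_Rintegral2 P (leb 2) (cj n)).
  apply: eq_Rintegral => w _; rewrite /pot.
  by rewrite -(cutpot_integral phi A0 L0 C0 bd1 bd2 lip1 lip2 (shifted A X0 a n w) e0 e1).
have wj := cutwave_joint e0 (mZ a k).
have bc n := bmf_Rintegral1 P (leb 2) (cj n).
rewrite !ec -mulrBr -RintegralB//; last 2 first.
- exact: (bmf_integrable (leb 2) (bc k)).
- exact: (bmf_integrable (leb 2) (bc k.+1)).
transitivity (\int[P]_w (L * \int[leb 2]_t (D e t * wv t (shifted A X0 a k w)))).
  by apply: eq_Rintegral => w _; exact: smooth_sub.
rewrite RintegralZl//; last by apply: bmf_integrable; exact: (bmf_Rintegral2 P (leb 2) wj).
congr (_ * _); rewrite (bmf_Fubini P (leb 2) wj).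
by apply: eq_Rintegral => t _; exact: cutwave_step.
Qed.

Lemma bmf_potential a k e : 0 < e -> e <= 1 -> bmf (fun w => pot e (shifted A X0 a k w)).
Proof.
move=> e0 e1; have e2 : e <= 2 by lra.
have rj := regint_joint tphi L0 C0 cb1 cb2 bd1 bd2 lip1 lip2 e0 e1 (mZ a k).
apply: bmfD; apply: bmfM; try exact: bmf_cst.
  exact: (bmf_Rintegral2 P (leb 2) rj).
split; last by exists 16 => w; exact: sinint_bound.
have ms : measurable_fun setT (fun s : R => sinint e (L * s)).
  apply: continuous_measurable_fun; apply: (@lip_continuous_real _ _ (L * (2 * e))) => s r.
  rewrite (le_trans (sinint_lip _ _ e0 e2))// -mulrBr normrM (gtr0_norm L0).
  by rewrite le_eqVlt; apply/orP; left; apply/eqP; ring.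
exact: (measurableT_comp ms (measurable_continuous_vec (mZ a k) cphi)).
Qed.

Lemma smooth_abs e x : 0 < e -> e <= 2 -> `|sm e x| <= e * (L * (4 * (H * (2 * K)))).
Proof.
move=> e0 e2; have bi := bmf_ind_ball e; have bw := bmf_wave x.
have bt : bmf (fun t => tent e t * wv t x) by apply: bmfM => //; exact: bmf_tent.
rewrite /sm /smooth normrM (gtr0_norm L0).
have -> : e * (L * (4 * (H * (2 * K)))) = L * (2 * (H * (2 * K)) * (2 * e)) by ring.
rewrite ler_wpM2l ?(ltW L0)// -(leb2_ball (ltW e0) e2) -RintegralZl//; last exact: (bmf_integrable (leb 2)).
rewrite (le_trans (le_normr_Rintegral _ _))//; first exact: (bmf_integrable (leb 2)).
apply: le_Rintegral => //.
- by apply: (bmf_integrable (leb 2)); exact: bmf_norm.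
- by apply: (bmf_integrable (leb 2)); apply: bmfM => //; exact: bmf_cst.
move=> t _; rewrite normrM mulrC; apply: ler_pM => //.
  exact: (wave_abs tphi ch hH K0 hK).
by rewrite ger0_norm ?tent_ge0// tent_ball.
Qed.

Lemma bmf_smooth a k e : 0 < e -> e <= 2 -> bmf (fun w => sm e (shifted A X0 a k w)).
Proof.
move=> e0 e2; split; last by exists (e * (L * (4 * (H * (2 * K))))) => w; exact: smooth_abs.
have j : bmf (fun z : Omega * measurableTypeR R => tent e z.2 * wv z.2 (shifted A X0 a k z.1)).
  apply: bmfM.
    split; first exact: (measurableT_comp (bmf_tent e0).1 measurable_snd).
    by exists 1 => z; rewrite ger0_norm ?tent_ge0// tent_le1.
  split; last by exists (2 * (H * (2 * K))) => z; exact: (wave_abs tphi ch hH K0 hK).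
  apply: (measurable_joint (mZ a k)); last exact: wave_continuous_t.
  by move=> t; exact: (cb_wave t).1.
apply: measurable_funM; first exact: measurable_cst.
exact: (bmf_Rintegral2 P (leb 2) j).1.
Qed.

Lemma potential_small e x : 0 < e -> e <= 1 ->
  `|pot e x| <= e * (L * (4 * C) + `|A0| * (`|L * phi x| * 2)).
Proof.
move=> e0 e1; have e2 : e <= 2 by lra.
have h1 := regpart_abs phi L0 C0 bd1 bd2 lip1 lip2 x e0 e1.
have h2 := sinint_small (L * phi x) e0 e2.
rewrite (le_trans (ler_normD _ _))// !(normrM L, normrM A0) (gtr0_norm L0) mulrDr; apply: lerD.
  rewrite (le_trans (ler_wpM2l (ltW L0) h1))//.
  by rewrite le_eqVlt; apply/orP; left; apply/eqP; ring.
rewrite (le_trans (ler_wpM2l (normr_ge0 A0) h2))// normrM (gtr0_norm L0).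
by rewrite le_eqVlt; apply/orP; left; apply/eqP; ring.
Qed.

(** The cutoff is removed along [e = 1 / (n + 1)]. The terms at [e] vanish pointwise, for the
    potential not uniformly since [phi] is unbounded; the bound on [sinint e] independent of [e]
    gives the domination. *)
Lemma smooth_step a k :
  \int[P]_w sm 1 (shifted A X0 a k w) =
  \int[P]_w pot 1 (shifted A X0 a k w) - \int[P]_w pot 1 (shifted A X0 a k.+1 w).
Proof.
pose e n : R := n.+1%:R^-1.
have e0 n : 0 < e n by rewrite invr_gt0.
have e1 n : e n <= 1 by rewrite invf_le1// ler1n.
have e2 n : e n <= 2 by have := e1 n; lra.
have ecv : e n @[n --> \oo] --> 0 by exact: cvg_harmonic.
have l1 : (1 : R) <= 2 by rewrite ler1n.
have bp n e' : 0 < e' -> e' <= 1 -> bmf (fun w => pot e' (shifted A X0 a n w)) by exact: bmf_potential.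
have bs e' : 0 < e' -> e' <= 2 -> bmf (fun w => sm e' (shifted A X0 a k w)) by exact: bmf_smooth.
have limS : \int[P]_w sm (e n) (shifted A X0 a k w) @[n --> \oo] --> 0.
  have -> : 0 = \int[P]_w (0 : R) by rewrite Rintegral_cst// mul0r.
  apply: (@bmf_dominated _ _ _ P _ _ (L * (4 * (H * (2 * K))))) => //.
  - by move=> n; exact: (bs _ (e0 n) (e2 n)).1.
  - move=> n w; rewrite (le_trans (smooth_abs _ (e0 n) (e2 n)))// ler_piMl//.
    by rewrite !mulr_ge0// ltW.
  - by apply: aeW => w; apply: (cvg0_of_bound _ ecv) => n; exact: smooth_abs.
have limP j : \int[P]_w pot (e n) (shifted A X0 a j w) @[n --> \oo] --> 0.
  have -> : 0 = \int[P]_w (0 : R) by rewrite Rintegral_cst// mul0r.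
  apply: (@bmf_dominated _ _ _ P _ _ (L * (4 * C) + `|A0| * 16)) => //.
  - by move=> n; exact: (bp j _ (e0 n) (e1 n)).1.
  - move=> n w; have h1 := regpart_abs phi L0 C0 bd1 bd2 lip1 lip2 (shifted A X0 a j w) (e0 n) (e1 n).
    have h2 := sinint_bound (L * phi (shifted A X0 a j w)) (e0 n) (e2 n).
    rewrite (le_trans (ler_normD _ _))// !(normrM L, normrM A0) (gtr0_norm L0); apply: lerD.
      by rewrite ler_wpM2l ?(ltW L0)// (le_trans h1)// ler_piMr// mulr_ge0.
    by rewrite ler_wpM2l.
  - by apply: aeW => w; apply: (cvg0_of_bound _ ecv) => n; exact: potential_small.
have I g : bmf g -> P.-integrable setT (EFin \o g) by exact: bmf_integrable.
apply: (lim_identity _ limS (limP k) (limP k.+1)) => n.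
rewrite -RintegralB//; [|exact: I (bs _ ltr01 l1)|exact: I (bs _ (e0 n) (e2 n))].
rewrite smooth_step_cut// RintegralB//; [|exact: I (bp _ _ ltr01 (lexx 1))|exact: I (bp _ _ (e0 n) (e1 n))].
by rewrite RintegralB//; [exact: I (bp _ _ ltr01 (lexx 1))|exact: I (bp _ _ (e0 n) (e1 n))].
Qed.

Lemma smooth_sum a M :
  \sum_(k < M) \int[P]_w sm 1 (shifted A X0 a k.+1 w) =
  \int[P]_w pot 1 (shifted A X0 a 1 w) - \int[P]_w pot 1 (shifted A X0 a M.+1 w).
Proof.
exact: (telescope_ord (s := fun k => \int[P]_w sm 1 (shifted A X0 a k.+1 w))
  (p := fun k => \int[P]_w pot 1 (shifted A X0 a k.+1 w)) M (fun k => smooth_step a k.+1)).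
Qed.

End renewal_identity.

Section compact_support.
Context {R : realType} {d : nat}.
Variable h : vec R d -> R.
Hypothesis ch : continuous h.
Hypothesis cS : compact (closure [set x | h x != 0]).
Let S := closure [set x | h x != 0].

Lemma out_support x : ~ S x -> h x = 0.
Proof. by move=> nS; apply/eqP/negPn/negP => hx; apply: nS; exact: subset_closure. Qed.

Lemma bounded_on_support (g : vec R d -> R) : continuous g ->
  exists2 M, 0 <= M & forall x, S x -> `|g x| <= M.
Proof.
move=> cg; have := cS.
move=> /compact_near_coveringP/(_ _ (pinfty_nbhs R) (fun C x => `|g x| <= C))[].
  move=> x _; have /cvgrPdist_lt/(_ 1 ltr01) gx := cg x.
  exists ([set y | `|g x - g y| < 1], [set C | `|g x| + 1 <= C]) => /=.
    by split; [exact: gx | exact: nbhs_pinfty_ge (num_real _)].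
  move=> [y C] [/= xy gC]; apply: le_trans gC.
  have -> : g y = g x - (g x - g y) by ring.
  by rewrite (le_trans (ler_normB _ _))// lerD2l ltW.
move=> M [_ HM]; exists (`|M| + 1); first by rewrite addr_ge0.
move=> x Sx; apply: (HM (`|M| + 1)) => //.
by rewrite (le_lt_trans (ler_norm M))// ltrDl.
Qed.

Lemma shift_uniform_continuity (e : R) : 0 < e -> exists2 r, 0 < r &
  forall x a, `|a| <= r -> `|h (vshift x a) - h x| <= e.
Proof.
move=> e0; have e2 : 0 < e / 2 by rewrite divr_gt0.
have [r r0 hr] : exists2 r, 0 < r & forall x a, `|a| < r -> S x -> `|h (vshift x a) - h x| <= e.
  have := cS.
  move=> /compact_near_coveringP/(_ _ (nbhs (0 : R)) (fun a x => `|h (vshift x a) - h x| <= e))[].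
    move=> x _; have cx : {for x, continuous h} by exact: ch.
    have /cvgrPdist_lt/(_ _ e2)/(nbhs_ballP x)[r /= r0 hr] := cx.
    exists (ball x (r / 2), ball (0 : R) (r / 2)) => /=.
      by split; apply: nbhsx_ballx; rewrite divr_gt0.
    move=> [y a] [/= xy]; rewrite /ball /= sub0r normrN => ar.
    move: xy; rewrite -ball_normE /= => xy.
    have h1 : `|h x - h y| < e / 2.
      by apply: hr; rewrite -ball_normE /=; lra.
    have h2 : `|h x - h (vshift y a)| < e / 2.
      apply: hr; rewrite -ball_normE /=.
      have -> : x - vshift y a = (x - y) - (vshift y a - vshift y 0).
        by rewrite vshift0; apply/rowP => i; rewrite !mxE; ring.
      rewrite (le_lt_trans (ler_normB _ _))//.
      by have := vshift_dist y a 0; rewrite subr0; lra.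
    have -> : h (vshift y a) - h y = (h x - h y) - (h x - h (vshift y a)) by ring.
    by rewrite (le_trans (ler_normB _ _))//; lra.
  move=> r /= r0 hr; exists r => // x a ar Sx.
  by apply: (hr a _ x Sx); rewrite /= sub0r normrN.
exists (r / 2); first by rewrite divr_gt0.
move=> x a ar; have ar' : `|a| < r by lra.
have [Sx|nSx] := pselect (S x); first exact: hr.
have [Sa|nSa] := pselect (S (vshift x a)); last by rewrite !out_support// subrr normr0 ltW.
(* The roles are exchanged: [x] is the shift by [- a] of a point of the support. *)
have := hr (vshift x a) (- a); rewrite normrN vshift_add subrr vshift0 => /(_ ar' Sa).
by rewrite distrC.
Qed.

End compact_support.

Section alpha_integral.
Context {R : realType} {d : nat}.
Variable phi : vec R d -> R.
Hypothesis tphi : topical_fun phi.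
Variables (h : vec R d -> R) (H K : R).
Hypothesis ch : continuous h.
Hypothesis hH : forall x, `|h x| <= H.
Hypothesis K0 : 0 <= K.
Hypothesis hK : forall x, K < `|phi x| -> h x = 0.

(** The inner integral of [alpha_int] is the Fourier transform along the fibre at frequency 0, so
    the residue [A0] is indeed governed by [alpha(h)]. *)
Lemma alpha_int_hcos (nu0 : probability (PRmax R d) R) :
  fine (alpha_int phi nu0 h) = \int[nu0]_x hcos phi h K 0 x.
Proof.
rewrite /alpha_int /Rintegral; congr fine; apply: eq_integral => x _.
have bf := bmf_fibre phi ch hH x.
have -> : hcos phi h K 0 x = \int[lebesgue_measure]_(s in `[- K, K]) fibre phi h x s.
  rewrite -leb_Rintegral; last exact: bf.1.
  by apply: eq_Rintegral => s _; rewrite mul0r cos0 mulr1.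
rewrite /Rintegral fineK; last first.
  by apply: integrable_fin_num => //; exact: bmf_itv_integrable.
rewrite [RHS]integral_mkcond; apply: eq_integral => s _.
rewrite patchE mem_setE /= in_itv /= -ler_norml -/(fibre phi h x s).
by case: leP => // Ks; rewrite (fibre_support tphi hK).
Qed.

End alpha_integral.

Section drift_limits.
Context {R : realType} {dO : measure_display} {Omega : measurableType dO}.
Variables (P : probability Omega R) (d : nat).
Variables (A : nat -> Omega -> vec R d -> vec R d) (X0 : Omega -> vec R d).
Variable phi : vec R d -> R.
Hypothesis tphi : topical_fun phi.
Variables (g : vec R d -> R) (G l : R).
Hypothesis gG : forall x, `|g x| <= G.
Hypothesis bg : forall a n, bmf (fun w => g (shifted A X0 a n w)).
Hypothesis gl : forall e, 0 < e -> exists2 S, 0 < S & forall x,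
    (S <= phi x -> `|g x - l| <= e) /\ (phi x <= - S -> `|g x + l| <= e).

Lemma phi_shifted a n w : phi (shifted A X0 a n w) = phi (state A X0 n w) - a.
Proof. by rewrite /shifted tphi.2. Qed.

Lemma phi_state_infty (gamma : R) w : 0 < gamma ->
  (forall i : 'I_d, (fun n : nat => (traj A X0 n w) 0 i / n%:R) @ \oo --> gamma) ->
  forall S, \forall n \near \oo, S <= phi (state A X0 n w).
Proof.
move=> g0 hw S; have c := @phi_cvg_ratio _ _ _ tphi (fun n => state A X0 n w) gamma hw.
have g2 : 0 < gamma / 2 by rewrite divr_gt0.
near=> n; have n0 : 0 < n%:R :> R by rewrite ltr0n; near: n; exact: nbhs_infty_gt.
have h1 : gamma / 2 <= phi (state A X0 n w) / n%:R.
  near: n; move/cvgrPdist_le : c => /(_ _ g2); apply: filterS => n.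
  rewrite ler_norml => /andP[_ q]; move: q; set y := _ / _ => q; lra.
have h2 : S / (gamma / 2) <= n%:R by near: n; exact: nbhs_infty_ger.
rewrite ler_pdivlMr// in h1; rewrite ler_pdivrMr// in h2.
by rewrite (le_trans h2)// mulrC.
Unshelve. all: by end_near. Qed.

Lemma forward_limit (gamma a : R) : 0 < gamma -> lyapunov_exponent P A X0 gamma ->
  \int[P]_w g (shifted A X0 a M.+1 w) @[M --> \oo] --> l.
Proof.
move=> g0 lyap; have -> : l = \int[P]_w l by rewrite Rintegral_prob_cst.
apply: (@bmf_dominated _ _ _ P _ _ G) => //.
- by move=> n; exact: (bg a n.+1).1.
apply: filterS lyap => w hw; have inf := phi_state_infty g0 hw.
apply/cvgrPdist_le => e e0; have [S _ hS] := gl e0.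
have hN := inf (S + a); near=> n.
rewrite distrC; apply: (hS _).1; rewrite phi_shifted lerBrDr.
near: n; move: hN => [N _ HN]; exists N => // n /= Nn; apply: HN => /=.
by rewrite (leq_trans Nn).
Unshelve. all: by end_near. Qed.

Lemma far_right_limit : \int[P]_w g (shifted A X0 a 1 w) @[a --> +oo] --> - l.
Proof.
apply/cvg_pinftyP => u uy; have -> : - l = \int[P]_w (- l) by rewrite Rintegral_prob_cst.
apply: (@bmf_dominated _ _ _ P _ _ G) => //.
- by move=> n; exact: (bg (u n) 1).1.
apply: aeW => w; apply/cvgrPdist_le => e e0; have [S _ hS] := gl e0.
near=> n; rewrite distrC opprK; apply: (hS _).2; rewrite phi_shifted.
have : phi (state A X0 1 w) + S <= u n by near: n; move/cvgryPge : uy; exact.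
lra.
Unshelve. all: by end_near. Qed.

Lemma far_left_limit : \int[P]_w g (shifted A X0 a 1 w) @[a --> -oo] --> l.
Proof.
apply/cvgNy_compNP; apply/cvg_pinftyP => u uy; have -> : l = \int[P]_w l by rewrite Rintegral_prob_cst.
apply: (@bmf_dominated _ _ _ P _ _ G) => //.
- by move=> n; exact: (bg (- u n) 1).1.
apply: aeW => w; apply/cvgrPdist_le => e e0; have [S _ hS] := gl e0.
near=> n; rewrite distrC; apply: (hS _).1; rewrite phi_shifted opprK.
have : S - phi (state A X0 1 w) <= u n by near: n; move/cvgryPge : uy; exact.
lra.
Unshelve. all: by end_near. Qed.

End drift_limits.

(** * Renewal limits *)

Section renewal.
Context {R : realType} {dO : measure_display} {Omega : measurableType dO}.
Variables (P : probability Omega R) (d : nat).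
Variables (A : nat -> Omega -> vec R d -> vec R d) (X0 : Omega -> vec R d).
Hypothesis tA : random_topical_ops A.
Hypothesis rX0 : random_vector X0.
Hypothesis iid : iid_and_indep P A X0.
Variable phi : vec R d -> R.
Hypothesis tphi : topical_fun phi.
Variable B : R.
Hypothesis B0 : 0 <= B.
Hypothesis HB : forall x, P.-integrable setT (EFin \o (fun w => incr A phi x w ^+ 2)) /\
    \int[P]_w (incr A phi x w ^+ 2) <= B.
Variable i0 : 'I_d.
Variable nu0 : probability (PRmax R d) R.
Hypothesis inv : invariant_measure P A nu0.
Variables (N : nat) (p : R).
Hypothesis p0 : 0 < p.
Hypothesis pE : P [set w | rank1 (prod_ops A N w)] = p%:E.
Hypothesis N0 : (0 < N)%N.
Hypothesis wna : weakly_non_arithmetic P A phi.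
Variable gamma : R.
Hypothesis g0 : 0 < gamma.
Hypothesis lyap : lyapunov_exponent P A X0 gamma.

Let muE : mean_drift P A phi nu0 = gamma.
Proof. exact: (lyapunov_mean_drift tA rX0 iid tphi B0 HB i0 inv p0 pE N0 lyap). Qed.

Let mu0 : 0 < mean_drift P A phi nu0. Proof. by rewrite muE. Qed.

Variables (h : vec R d -> R) (H K : R).
Hypothesis ch : continuous h.
Hypothesis hH : forall x, `|h x| <= H.
Hypothesis K4 : 4 <= K.
Hypothesis hK4 : forall x, K / 4 < `|phi x| -> h x = 0.
Hypothesis huc : forall e : R, 0 < e -> exists2 r, 0 < r &
  forall x a, `|a| <= r -> `|h (vshift x a) - h x| <= e.

Let H0 : 0 <= H. Proof. by rewrite (le_trans _ (hH 0)). Qed.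
Let K0 : 0 <= K. Proof. by rewrite (le_trans _ K4). Qed.
Let hK x : K < `|phi x| -> h x = 0.
Proof. by have KK := K4 => Kx; apply: hK4; lra. Qed.

Let cbh : cb h. Proof. by split => //; exists H. Qed.
Let cbw a : cb (weight phi a) := weight_cb tphi a.

Let Z := shifted A X0.

Lemma weight_shifted a k w : weight phi 0 (Z a k w) = weight phi a (state A X0 k w).
Proof. by rewrite /weight /Z (phi_shifted A X0 tphi) subr0. Qed.

Lemma weight_ge0 a x : 0 <= weight phi a x.
Proof. by have /andP[] := inv_sqr_le1 (phi x - a). Qed.

Lemma occupation_shifted : exists2 c : R, 0 <= c & forall a n,
  \sum_(k < n) \int[P]_w weight phi 0 (Z a k.+1 w) <= c.
Proof.
have [c hc] := occupation_bound tA rX0 iid tphi B0 HB i0 inv p0 pE N0 mu0.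
have w0 a k : 0 <= \int[P]_w weight phi a (state A X0 k w).
  by apply: Rintegral_ge0 => w _; exact: weight_ge0.
exists c; first by have := hc 0 0%N; rewrite big_ord0.
move=> a n; apply: le_trans (hc a n.+1); rewrite big_ord_recl.
rewrite -[leLHS]add0r; apply: lerD; first exact: w0.
by apply: ler_sum => k _; under eq_Rintegral do rewrite weight_shifted.
Qed.

Lemma h_weight x : `|h x| <= H * (1 + K ^+ 2) * weight phi 0 x.
Proof.
have Q0 : 0 < 1 + K ^+ 2 by rewrite ltr_wpDr// sqr_ge0.
have [pK|Kp] := leP `|phi x| K; last first.
  by rewrite hK// normr0 !mulr_ge0 ?(ltW Q0)// weight_ge0.
rewrite (le_trans (hH x))// -mulrA ler_peMr// /weight subr0 ler_pdivlMr ?ltr_wpDr ?sqr_ge0// mul1r.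
by rewrite lerD2l -(real_normK (num_real (phi x))) ler_sqr ?nnegrE.
Qed.

Lemma renewal_termE a k : renewal_term P A X0 h a k = \int[P]_w h (Z a k.+1 w).
Proof. by []. Qed.

Let bZ a k g : cb g -> bmf (fun w => g (Z a k w)).
Proof. by move=> cg; exact: (bmf_shifted tA rX0). Qed.

Lemma renewal_series_cvg a : cvgn (series (renewal_term P A X0 h a)).
Proof.
have [c c0 hc] := occupation_shifted.
apply: (@normed_cvg R R); apply: nondecreasing_is_cvgn; first by apply: nondecreasing_series => * /=; exact: normr_ge0.
have W0 : 0 <= H * (1 + K ^+ 2) by rewrite mulr_ge0// addr_ge0// sqr_ge0.
exists (H * (1 + K ^+ 2) * c) => _ [n _ <-].
rewrite -[leLHS]/(series (fun k => `|renewal_term P A X0 h a k|) n) seriesEord /=.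
apply: (@le_trans _ _ (\sum_(k < n) (H * (1 + K ^+ 2) * \int[P]_w weight phi 0 (Z a k.+1 w)))).
  apply: ler_sum => k _; rewrite renewal_termE.
  rewrite -RintegralZl//; last by apply: bmf_integrable; exact: bZ.
  have bh := bZ a k.+1 cbh; have bw := bZ a k.+1 (cbw 0).
  rewrite (le_trans (le_normr_Rintegral _ _))//; first exact: bmf_integrable.
  apply: le_Rintegral => //.
  - by apply: bmf_integrable; exact: bmf_norm.
  - by apply: bmf_integrable; apply: bmfM => //; exact: bmf_cst.
  - by move=> w _; exact: h_weight.
by rewrite -mulr_sumr ler_wpM2l.
Qed.

Let a0 := \int[nu0]_x hcos phi h K 0 x.
Let A0 := - a0 / mean_drift P A phi nu0.

(** Here [g] is the potential divided by [2 * c0], the mass of the smoothing kernel. The error does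
    not depend on [a] or [M], because the occupation sums are bounded uniformly. *)
Lemma renewal_potential e : 0 < e -> exists g : vec R d -> R, exists G : R,
  [/\ forall x, `|g x| <= G, forall a n, bmf (fun w => g (Z a n w)),
   forall e', 0 < e' -> exists2 S, 0 < S & forall x,
    (S <= phi x -> `|g x - A0 / 2| <= e') /\ (phi x <= - S -> `|g x + A0 / 2| <= e') &
   forall a M, `|series (renewal_term P A X0 h a) M -
      (\int[P]_w g (Z a 1 w) - \int[P]_w g (Z a M.+1 w))| <= e].
Proof.
move=> e0; have [c0 c00 hc0] := @sinint1_limit R.
have [c c_ge0 hc] := occupation_shifted.
(* The precision of the smoothing: once divided by [2 * c0] and summed against an occupation of at
   most [c], it contributes at most [e]. *)
have d0 : 0 < e * (2 * c0) / (c + 1) by rewrite divr_gt0 ?mulr_gt0// ltr_wpDl.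
have [L L0 hL] := smooth_approx tphi ch hH K4 hK4 huc c00 d0 hc0.
have [f1 [f2 [fam reg]]] := regular_family_ex tA rX0 iid tphi B0 HB i0 inv p0 pE mu0 wna ch hH K0 hK.
have [C C0 HC] := reg L.
have cb1 t : t != 0 -> cb (f1 t) by move=> /fam[[]].
have cb2 t : t != 0 -> cb (f2 t) by move=> /fam[_ []].
have bd1 t x : t != 0 -> `|t| <= L -> `|f1 t x| <= C by move=> t0 tL; have [] := HC t x t0 tL.
have bd2 t x : t != 0 -> `|t| <= L -> `|f2 t x| <= C by move=> t0 tL; have [] := HC t x t0 tL.
have lip1 t s x : t != 0 -> s != 0 -> `|t| <= L -> `|s| <= L ->
    `|f1 t x - f1 s x| <= C * (`|t - s| / t ^+ 2).
  by move=> t0 s0 tL sL; have [_ _ l] := HC t x t0 tL; have [] := l s s0 sL.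
have lip2 t s x : t != 0 -> s != 0 -> `|t| <= L -> `|s| <= L ->
    `|f2 t x - f2 s x| <= C * (`|t - s| / t ^+ 2).
  by move=> t0 s0 tL sL; have [_ _ l] := HC t x t0 tL; have [] := l s s0 sL.
have sol t x (t0 : t != 0) : _ := let: And3 _ _ s := fam t t0 in s x.
pose pot := potential phi L A0 f1 f2 1.
have bp a n : bmf (fun w => pot (Z a n w)).
  exact: (bmf_potential P tA rX0 tphi A0 L0 C0 cb1 cb2 bd1 bd2 lip1 lip2 a n ltr01 (lexx 1)).
have sum a M := smooth_sum tA rX0 iid tphi ch hH K0 hK L0 C0 cb1 cb2 bd1 bd2 lip1 lip2 sol a M.
have plim := potential_limit phi A0 L0 C0 bd1 bd2 lip1 lip2 hc0.
have pbd := potential_bound phi A0 L0 C0 bd1 bd2 lip1 lip2.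
have l12 : (1 : R) <= 2 by rewrite ler1n.
have bs a k : bmf (fun w => smooth phi h K L 1 (Z a k w)).
  exact: (bmf_smooth P tA rX0 tphi ch hH K0 hK L0 a k ltr01 l12).
have c2 : 0 < 2 * c0 by rewrite mulr_gt0.
have ic2 : 0 <= (2 * c0)^-1 by rewrite invr_ge0 ltW.
exists (fun x => (2 * c0)^-1 * pot x), ((2 * c0)^-1 * (L * (4 * C) + `|A0| * 16)); split.
- by move=> x; rewrite normrM ger0_norm// ler_wpM2l//; exact: pbd.
- by move=> a n; apply: bmfM => //; exact: bmf_cst.
- move=> e' e'0; have [S S0 hS] := plim _ (mulr_gt0 e'0 c2).
  exists S => // x; have [h1 h2] := hS x; split => hx.
    have -> : (2 * c0)^-1 * pot x - A0 / 2 = (2 * c0)^-1 * (pot x - A0 * c0) by field; rewrite gt_eqF.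
    by rewrite normrM ger0_norm// ler_pdivrMl// [leRHS]mulrC; exact: h1.
  have -> : (2 * c0)^-1 * pot x + A0 / 2 = (2 * c0)^-1 * (pot x + A0 * c0) by field; rewrite gt_eqF.
  by rewrite normrM ger0_norm// ler_pdivrMl// [leRHS]mulrC; exact: h2.
move=> a M; rewrite !RintegralZl//; try exact: bmf_integrable.
rewrite -mulrBr; have := sum a M; rewrite -/(pot _) => e1.
pose s k := \int[P]_w smooth phi h K L 1 (Z a k.+1 w).
have e2 : \int[P]_w pot (Z a 1 w) - \int[P]_w pot (Z a M.+1 w) = \sum_(k < M) s k by rewrite [RHS]e1.
rewrite e2 seriesEord /= mulr_sumr -sumrB.
rewrite (le_trans (ler_norm_sum _ _ _))//.
pose u k := \int[P]_w weight phi 0 (Z a k.+1 w).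
apply: (@le_trans _ _ (\sum_(k < M) (e / (c + 1) * u k))).
  apply: ler_sum => k _; rewrite renewal_termE /s /u.
  have bh := bZ a k.+1 cbh; have bw := bZ a k.+1 (cbw 0); have bsk := bs a k.+1.
  have bsk' : bmf (fun w => (2 * c0)^-1 * smooth phi h K L 1 (Z a k.+1 w)).
    by apply: bmfM => //; exact: bmf_cst.
  rewrite -!RintegralZl//; try exact: bmf_integrable.
  rewrite -RintegralB//; try exact: bmf_integrable.
  rewrite (le_trans (le_normr_Rintegral _ _))//; first by apply: bmf_integrable; exact: bmfB.
  apply: le_Rintegral => //.
  - by apply: bmf_integrable; apply: bmf_norm; exact: bmfB.
  - by apply: bmf_integrable; apply: bmfM => //; exact: bmf_cst.
  move=> w _; set x := Z a k.+1 w.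
  have -> : h x - (2 * c0)^-1 * smooth phi h K L 1 x =
     - ((2 * c0)^-1 * (smooth phi h K L 1 x - 2 * c0 * h x)) by field; rewrite gt_eqF.
  rewrite normrN normrM ger0_norm// ler_pdivrMl//; apply: le_trans (hL x) _.
  by rewrite le_eqVlt; apply/orP; left; apply/eqP; field; rewrite gt_eqF// ltr_wpDl.
rewrite -mulr_sumr; apply: (@le_trans _ _ (e / (c + 1) * c)).
  by apply: ler_wpM2l; [rewrite divr_ge0 ?(ltW e0)// addr_ge0 | exact: hc].
by rewrite mulrAC ler_pdivrMr ?ltr_wpDl// ler_wpM2l ?(ltW e0)// lerDl.
Qed.

Let F a := limn (series (renewal_term P A X0 h a)).

(** As [M] grows the last position tends almost surely to [+oo] along [phi], because [gamma > 0],
    and there [g] tends to [A0 / 2]. The error remains uniform in [a], so the limits in [a] can be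
    taken for a fixed [g]. *)
Lemma renewal_approx e : 0 < e -> exists g : vec R d -> R, exists G : R,
  [/\ forall x, `|g x| <= G, forall a n, bmf (fun w => g (Z a n w)),
   forall e', 0 < e' -> exists2 S, 0 < S & forall x,
    (S <= phi x -> `|g x - A0 / 2| <= e') /\ (phi x <= - S -> `|g x + A0 / 2| <= e') &
   forall a, `|F a - (\int[P]_w g (Z a 1 w) - A0 / 2)| <= e].
Proof.
move=> e0; have [g [G [gG bg gl hg]]] := renewal_potential e0.
exists g, G; split => // a.
have fl := forward_limit tphi gG bg gl a g0 lyap.
have cF : series (renewal_term P A X0 h a) M @[M --> \oo] --> F a by exact: (renewal_series_cvg (a := a)).
have c1 : series (renewal_term P A X0 h a) M - (\int[P]_w g (Z a 1 w) - \int[P]_w g (Z a M.+1 w))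
    @[M --> \oo] --> F a - (\int[P]_w g (Z a 1 w) - A0 / 2).
  by apply: cvgB => //; apply: cvgB => //; exact: cvg_cst.
pose v M := series (renewal_term P A X0 h a) M - (\int[P]_w g (Z a 1 w) - \int[P]_w g (Z a M.+1 w)).
have c2 : `|v M| @[M --> \oo] --> `|F a - (\int[P]_w g (Z a 1 w) - A0 / 2)| by exact: cvg_norm c1.
rewrite -(cvg_lim (@norm_hausdorff _ R) c2); apply: limr_le; first exact: cvgP c2.
by apply: nearW => M; exact: hg.
Qed.

(** The first position now also goes to [+oo] along [phi]: both ends of the telescoped sum have the
    same limit [A0 / 2]. *)
Lemma renewal_left : F a @[a --> -oo] --> 0.
Proof.
apply/cvgrPdist_le => e e0; have e2 : 0 < e / 2 by rewrite divr_gt0.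
have [g [G [gG bg gl hg]]] := renewal_approx e2.
have /cvgrPdist_le/(_ _ e2) ll := far_left_limit P tphi gG bg gl.
near=> a; have h1 := hg a.
have h2 : `|A0 / 2 - \int[P]_w g (Z a 1 w)| <= e / 2 by near: a.
rewrite sub0r normrN; set I := Rintegral _ _ _ in h1 h2.
have -> : F a = (F a - (I - A0 / 2)) - (A0 / 2 - I) by ring.
by rewrite (le_trans (ler_normB _ _))//; lra.
Unshelve. all: by end_near. Qed.

(** The two ends are on opposite sides, and their difference is [- A0 / 2 - A0 / 2 = a0 / gamma]. *)
Lemma renewal_right : F a @[a --> +oo] --> a0 / gamma.
Proof.
apply/cvgrPdist_le => e e0; have e2 : 0 < e / 2 by rewrite divr_gt0.
have [g [G [gG bg gl hg]]] := renewal_approx e2.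
have /cvgrPdist_le/(_ _ e2) ll := far_right_limit P tphi gG bg gl.
near=> a; have h1 := hg a.
have h2 : `|- (A0 / 2) - \int[P]_w g (Z a 1 w)| <= e / 2 by near: a.
set I := Rintegral _ _ _ in h1 h2.
have -> : a0 / gamma - F a = - (F a - (I - A0 / 2)) + (- (A0 / 2) - I).
  by rewrite /A0 muE; field; exact: lt0r_neq0.
by rewrite (le_trans (ler_normD _ _))// normrN; lra.
Unshelve. all: by end_near. Qed.

Lemma renewal_limits :
  ((\forall a \near -oo, cvgn (series (renewal_term P A X0 h a))) /\
   (limn (series (renewal_term P A X0 h a)) @[a --> -oo] --> 0)) /\
  ((\forall a \near +oo, cvgn (series (renewal_term P A X0 h a))) /\
   (limn (series (renewal_term P A X0 h a)) @[a --> +oo]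
      --> fine (alpha_int phi nu0 h) / gamma)).
Proof.
split; split.
- by apply: nearW => a; exact: renewal_series_cvg.
- exact: renewal_left.
- by apply: nearW => a; exact: renewal_series_cvg.
- by rewrite (alpha_int_hcos tphi ch hH hK); exact: renewal_right.
Qed.

End renewal.

Theorem theorem2p5 (R : realType) (dO : measure_display) (Omega : measurableType dO)
  (P : probability Omega R) (d : nat)
  (A : nat -> Omega -> 'rV[R]_d -> 'rV[R]_d) (X0 : Omega -> 'rV[R]_d)
  (phi : 'rV[R]_d -> R) (gamma : R) (nu0 : probability (PRmax R d) R) :
  random_topical_ops A ->
  random_vector X0 ->
  iid_and_indep P A X0 ->
  memory_loss P A ->
  topical_fun phi ->
  finite_second_moment P A phi ->
  lyapunov_exponent P A X0 gamma ->
  invariant_measure P A nu0 ->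
  0 < gamma ->
  weakly_non_arithmetic P A phi ->
  forall h : 'rV[R]_d -> R, continuous h -> compact (closure [set x | h x != 0]) ->
  ((\forall a \near -oo, cvgn (series (renewal_term P A X0 h a))) /\
   (limn (series (renewal_term P A X0 h a)) @[a --> -oo] --> 0)) /\
  ((\forall a \near +oo, cvgn (series (renewal_term P A X0 h a))) /\
   (limn (series (renewal_term P A X0 h a)) @[a --> +oo]
      --> fine (alpha_int phi nu0 h) / gamma)).
Proof.
move=> tA rX0 iid [N [N0 ml]] tphi fsm lyap inv g0 wna h ch cS.
(* In dimension 0 a shift does not move the only vector, whereas [phi] would have to increase by
   1. *)
have i0 : 'I_d.
  case: d phi tphi {A X0 nu0 tA rX0 iid ml fsm lyap inv wna h ch cS} => [phi [_ tphi]|d' *]; last exact: ord0.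
  exfalso; have := tphi 0 1; have -> : vshift (0 : 'rV[R]_0) 1 = 0 by apply/rowP; case.
  lra.
have [B B0 HB] := exists_second_moment tA tphi fsm.
have mr := measurable_rank1 tA rX0 N.
have fin : P [set w | rank1 (prod_ops A N w)] \is a fin_num by exact: fin_num_measure.
pose p := fine (P [set w | rank1 (prod_ops A N w)]).
have pE : P [set w | rank1 (prod_ops A N w)] = p%:E by rewrite fineK.
have p0 : 0 < p by rewrite -lte_fin -pE.
have cphi : continuous phi := topical_fun_continuous tphi.
have [H H0 hH] := bounded_on_support cS ch.
have [M M0 hM] := bounded_on_support cS cphi.
have hH' x : `|h x| <= H.
  have [Sx|nSx] := pselect (closure [set x | h x != 0] x); first exact: hH.
  by rewrite (out_support nSx) normr0.
(* The margin used by the smoothing: [M] bounds [phi] on the support of [h], and [K / 4 = M + 1]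
   exceeds it. *)
have K4 : 4 <= 4 * (M + 1) by lra.
have hK4 x : 4 * (M + 1) / 4 < `|phi x| -> h x = 0.
  move=> hx; apply: out_support => Sx; have := hM x Sx; lra.
have huc := shift_uniform_continuity ch cS.
exact: (renewal_limits tA rX0 iid tphi B0 HB i0 inv p0 pE N0 wna g0 lyap ch hH' K4 hK4 huc).
Qed.
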